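(* Let $n$ be a positive integer, let $\nu \vdash n$ and $\lambda \vdash n+1$ be integer partitions, and let $\alpha$ be the Jack parameter. Then the Jack connection coefficients satisfy \begin{align*} \sum_{i:\,m_{i-1}(\nu) \neq 0} i\,(m_i(\nu)+1)\,a_{(n+1),\nu^{\uparrow(i-1)}}^\lambda(\alpha) = \sum_{i =1}^{\ell(\lambda)}\lambda_i \Big[ (\alpha-1)(\lambda_i-1)\,a_{(n),\nu}^{\lambda_{\downarrow(\lambda_i)}}(\alpha) +\sum_{d=1}^{\lambda_i-2}a_{(n),\nu}^{\lambda^{\uparrow(\lambda_i-1-d,d)}}(\alpha)+\alpha\sum_{j\neq i}\lambda_j\,a_{(n),\nu}^{\lambda_{\downarrow(\lambda_i,\lambda_j)}}(\alpha)\Big], \end{align*} where in the last inner sum $j$ runs over the indices $1\le j\le \ell(\lambda)$ with $j\neq i$.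
   Context: For a partition $\lambda=(\lambda_1\ge\lambda_2\ge\dots\ge\lambda_p)$, $\ell(\lambda)=p$ is its number of parts, $m_i(\lambda)$ the number of parts equal to $i$, and $z_\lambda=\prod_i i^{m_i(\lambda)}m_i(\lambda)!$. Partition operations: $\lambda_{\downarrow(k)}$ is obtained from $\lambda$ (containing a part $k$) by replacing one part $k$ by $k-1$ (a part $0$ is discarded); $\lambda^{\uparrow(k)}$ replaces one part $k$ by $k+1$; $\lambda_{\downarrow(k,l)}$ removes a part $k$ and a part $l$ and adds a part $k+l-1$; $\lambda^{\uparrow(k,l)}$ removes a part $k+l+1$ and adds parts $k$ and $l$. For a box $s$ of the Young diagram of $\lambda$, $a(s)$ and $l(s)$ are its arm length (boxes to the east) and leg length (boxes to the south); $h_\lambda(\alpha)=\prod_{s}(\alpha a(s)+l(s)+1)$. Let $p_\lambda$ be power sum symmetric functions, $m_\lambda$ monomial symmetric functions, and $\langle\cdot,\cdot\rangle_\alpha$ the scalar product on symmetric functions with $\langle p_\lambda,p_\mu\rangle_\alpha=\alpha^{\ell(\lambda)}z_\lambda\delta_{\lambda\mu}$. The Jack symmetric functions $J^\alpha_\lambda$ are the orthogonal basis for $\langle\cdot,\cdot\rangle_\alpha$ whose transition matrix to monomials is triangular (dominance order), normalized so that $[m_\lambda]J^\alpha_\lambda=h_\lambda(\alpha)$. The Jack connection coefficients $a^\lambda_{\mu\nu}(\alpha)$, for $\lambda,\mu,\nu\vdash n$, are defined by $$\sum_{\lambda, \mu, \nu \vdash n}\alpha^{-\ell(\lambda)}z_\lambda^{-1}a_{\mu\nu}^\lambda(\alpha)p_\lambda(x)p_\mu(y)p_\nu(z)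 = \sum_{\gamma \vdash n}\frac{J^{\alpha}_\gamma(x)J^{\alpha}_\gamma(y)J^{\alpha}_\gamma(z)}{\langle J^{\alpha}_\gamma,J^{\alpha}_\gamma\rangle_{\alpha}}$$ for three sets of indeterminates $x,y,z$. The single-part partition of $k$ is written $(k)$. *)

(* Defs.v *)
(* Symmetric functions of degree n are represented by their
   coordinates in the power-sum basis (p_mu)_{mu |- n}. *)
From HB Require Import structures.
From mathcomp Require Import all_boot all_order all_algebra.
Set Implicit Arguments. Unset Strict Implicit. Unset Printing Implicit Defensive.
Import Order.TTheory GRing.Theory Num.Theory.

Definition is_partition (n : nat) (s : seq nat) : bool :=
  [&& sorted geq s, all (fun x => 0 < x) s & sumn s == n].

Fixpoint parts_bnd (fuel k n : nat) : seq (seq nat) :=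
  match fuel with
  | 0 => if n == 0 then [:: [::]] else [::]
  | fuel'.+1 =>
      if n == 0 then [:: [::]] else
      flatten [seq [seq i :: p | p <- parts_bnd fuel' i (n - i)] | i <- iota 1 (minn k n)]
  end.

Definition partitions (n : nat) : seq (seq nat) := parts_bnd n n n.

Definition mult (i : nat) (s : seq nat) : nat := count_mem i s.

Definition zee (s : seq nat) : nat :=
  \prod_(i <- undup s) (i ^ mult i s * (mult i s)`!).

Definition normp (s : seq nat) : seq nat := sort geq [seq x <- s | x != 0].

Definition dominated (kappa lambda : seq nat) : bool :=
  (sumn kappa == sumn lambda) &&
  [forall k : 'I_(size kappa + size lambda).+1,
      sumn (take k kappa) <= sumn (take k lambda)].

(* [m_kappa] p_mu : coefficient of x_1^kappa_1 ... x_l^kappa_l in p_mu *)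
Definition pm_coef (mu kappa : seq nat) : nat :=
  #|[set f : {ffun 'I_(size mu) -> 'I_(size kappa)} |
      [forall i : 'I_(size kappa), \sum_(j < size mu | f j == i) nth 0 mu j == nth 0 kappa i]]|.

Local Open Scope ring_scope.

Section Jack.
Variable R : realFieldType.

(* h_lambda(alpha) = prod_s (alpha a(s) + l(s) + 1); box s = (r, c), 0-based *)
Definition arm (lam : seq nat) (r c : nat) : nat := (nth 0 lam r - c).-1.
Definition leg (lam : seq nat) (r c : nat) : nat :=
  count (fun x => (c < x)%N) (drop r.+1 lam).
Definition hookp (alpha : R) (lam : seq nat) : R :=
  \prod_(r < size lam) \prod_(c < nth 0 lam r)
     (alpha * (arm lam r c)%:R + (leg lam r c)%:R + 1).

(* coefficient of m_kappa in the symmetric function with p-coordinates f (degree n) *)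
Definition mcoef (n : nat) (f : seq nat -> R) (kappa : seq nat) : R :=
  \sum_(mu <- partitions n) f mu * (pm_coef mu kappa)%:R.

(* <f, g>_alpha on degree n, with <p_l, p_m> = alpha^l(l) z_l delta *)
Definition jscal (alpha : R) (n : nat) (f g : seq nat -> R) : R :=
  \sum_(lam <- partitions n) alpha ^+ size lam * (zee lam)%:R * f lam * g lam.

(* J lam = p-coordinates of J^alpha_lam.  is_jack alpha n J : J restricted to
   partitions of n is the Jack basis of degree n. *)
Definition is_jack (alpha : R) (n : nat) (J : seq nat -> seq nat -> R) : Prop :=
  (forall lam, lam \in partitions n ->
     (forall kappa, kappa \in partitions n -> mcoef n (J lam) kappa != 0 ->
        dominated kappa lam) /\
     mcoef n (J lam) lam = hookp alpha lam) /\
  (forall lam mu, lam \in partitions n -> mu \in partitions n -> lam != mu ->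
     jscal alpha n (J lam) (J mu) = 0).

(* a^lam_{mu nu}(alpha) = alpha^l(lam) z_lam sum_gamma [p_lam]J_g [p_mu]J_g [p_nu]J_g / <J_g,J_g>,
   i.e. the coefficient extraction from the defining generating series *)
Definition conn (alpha : R) (n : nat) (J : seq nat -> seq nat -> R)
    (lam mu nu : seq nat) : R :=
  alpha ^+ size lam * (zee lam)%:R *
  \sum_(g <- partitions n) J g lam * J g mu * J g nu / jscal alpha n (J g) (J g).

End Jack.

Definition part_up (nu : seq nat) (k : nat) : seq nat := normp (k.+1 :: rem k nu).
Definition part_down (lam : seq nat) (i : nat) : seq nat :=
  normp (set_nth 0 lam i (nth 0 lam i).-1).
Definition drop_idx (lam : seq nat) (i : nat) : seq nat :=
  [seq nth 0 lam k | k <- iota 0 (size lam) & k != i].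
(* lam^{up(k,l)} where k + l + 1 = lam_i : remove part of index i, add parts k, l *)
Definition part_split (lam : seq nat) (i k l : nat) : seq nat :=
  normp (k :: l :: drop_idx lam i).
Definition part_join (lam : seq nat) (i j : nat) : seq nat :=
  normp ((nth 0 lam i + nth 0 lam j).-1 ::
         [seq nth 0 lam k | k <- iota 0 (size lam) & (k != i) && (k != j)]).

(* Main.v *)
Require Import Defs.
From HB Require Import structures.
From mathcomp Require Import all_boot all_order all_algebra.
From mathcomp Require Import zify ring lra.
Import Order.TTheory GRing.Theory Num.Theory.
Set Implicit Arguments. Unset Strict Implicit. Unset Printing Implicit Defensive.
Local Open Scope ring_scope.

(* A symmetric function [f] is encoded by the functional [phi w = <f, p_w>_alpha] on words [w],
   so that operators on symmetric functions become explicit sums over the letters of [w].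

   Let [D] be the Laplace-Beltrami operator. It is self-adjoint and triangular on monomials, so
   the triangularity and orthogonality of the Jack functions force [D J_g = e_g J_g] with [e_g]
   the sum of the alpha-contents of [g]. With [p_1] the multiplication operator, one has
   [[D, p_1] = sum_i i p_(i+1) d/dp_i], whose adjoint, applied to [J_y] and read off at [p_nu],
   gives the left-hand side, while [[D, [D, p_1]]] gives the cut-and-join expression on the
   right-hand side. On Jack functions, [p_1 J_x] expands on some [J_y], and the two commutators
   multiply the coefficient by [e_y - e_x] and [(e_y - e_x)^2]. Finally [[p_n] J_y] is the product of the
   alpha-contents of the boxes of [y] other than the corner, so it changes by the factor
   [e_y - e_x] from [x] to [y], which reconciles the two sides.

   The Pieri support and the value of [[p_n] J_y] are obtained without the general theory:
   removing the first row of [g] relates [J_g] to a smaller Jack function through the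
   eigenvalue equation, and removing the first column gives the normalisation. Orthogonality
   is only assumed in degrees [n] and [n + 1]; eigenvalues of [D] may collide, so it is
   transferred from degree [n + 1] down to all smaller degrees. *)

(** Different partitions may share an eigenvalue, so the eigenvalue equation alone determines
    neither [P_g] nor its orthogonality. What always holds is that the content sum increases
    strictly along dominance, so the equation together with triangularity has at most one solution.
    This is proved for coefficient functions on words of a fixed length, zeros allowed, so that it
    also applies to a slice [F (a :: t)] and to a shift [F (map succn t)]: that is how rows and
    columns are removed. If [P_x] and [P_y] of degree [n] were not orthogonal, they would share an
    eigenvalue, and orthogonality in degree [n + 1] would put [y] with a new part 1 into [p_1 P_x],
    and [x] with a new part 1 into [p_1 P_y]; comparing rows from the top down then forces [x = y].
    The content product is kept as a polynomial in [X] because removing a row shifts every content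
    by -1. At [X] equal to the number of rows, a new first column multiplies it by the same factors
    as the hook product; this is why evaluating [P_g] yields its hook normalisation, and with it
    [[p_n] J_g]. *)

(** * Sums over letters and pairs of letters of a word *)

Section SumPick.
Variable R : comNzRingType.
Implicit Types (w v u : seq nat).

(* The sum of [G x v] over the positions of [w], with [x] the letter at that position
   and [v] the other letters. *)
Fixpoint spick (G : nat -> seq nat -> R) w : R :=
  if w is k :: w' then G k w' + spick (fun x v => G x (k :: v)) w' else 0.

(* The same over pairs of positions [i < j]. *)
Fixpoint spair (H : nat -> nat -> seq nat -> R) w : R :=
  if w is k :: w' then
    spick (fun y u => H k y u) w' + spair (fun a b u => H a b (k :: u)) w'
  else 0.

Definition symf (f : seq nat -> R) := forall v v', perm_eq v v' -> f v = f v'.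

Lemma eq_spick G H w :
  (forall x v, perm_eq (x :: v) w -> G x v = H x v) -> spick G w = spick H w.
Proof.
elim: w G H => //= k w IH G H eqGH; rewrite eqGH //; congr (_ + _).
apply: IH => x v xv; apply: eqGH.
by rewrite -(perm_cons k) in xv; rewrite -(permPr xv) (perm_catCA [:: x] [:: k] v).
Qed.

Lemma eq_spickT G H w : (forall x v, G x v = H x v) -> spick G w = spick H w.
Proof. by move=> eqGH; apply: eq_spick. Qed.

Lemma spickD G H w :
  spick (fun x v => G x v + H x v) w = spick G w + spick H w.
Proof.
by elim: w G H => [|k w IH] G H /=; rewrite ?addr0 // IH addrACA.
Qed.

Lemma spick0 w : spick (fun _ _ => 0) w = 0.
Proof. by elim: w => //= k w ->; rewrite addr0. Qed.

Lemma spickZ c G w : spick (fun x v => c * G x v) w = c * spick G w.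
Proof. by elim: w G => [|k w IH] G /=; rewrite ?mulr0 // IH mulrDr. Qed.

Lemma spickZr c G w : spick (fun x v => G x v * c) w = spick G w * c.
Proof. by rewrite mulrC -spickZ; apply: eq_spickT => x v; rewrite mulrC. Qed.

Lemma spickN G w : spick (fun x v => - G x v) w = - spick G w.
Proof.
by rewrite -mulN1r -spickZ; apply: eq_spickT => x v; rewrite mulN1r.
Qed.

Lemma spickB G H w :
  spick (fun x v => G x v - H x v) w = spick G w - spick H w.
Proof. by rewrite spickD spickN. Qed.

Lemma spick_sum (I : Type) (r : seq I) (P : pred I) G w :
  spick (fun x v => \sum_(i <- r | P i) G i x v) w =
  \sum_(i <- r | P i) spick (G i) w.
Proof.
elim: w G => [|k w IH] G /=; first by rewrite big1.
by rewrite IH -big_split.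
Qed.

Lemma spick_exch (G : nat -> seq nat -> nat -> seq nat -> R) w u :
  spick (fun x v => spick (fun y t => G x v y t) u) w =
  spick (fun y t => spick (fun x v => G x v y t) w) u.
Proof.
elim: w G => [|k w IH] G /=; first by rewrite spick0.
by rewrite IH -spickD.
Qed.

Lemma spick_swap (G : nat -> nat -> seq nat -> R) w :
  spick (fun x v => spick (fun y u => G x y u) v) w =
  spick (fun x v => spick (fun y u => G y x u) v) w.
Proof.
elim: w G => //= k w IH G; rewrite !spickD addrCA; congr (_ + (_ + _)).
exact: (IH (fun x y u => G x y (k :: u))).
Qed.

(** [rem] deletes the first occurrence of a letter, while the picked position may be a later one;
    the two remainders are rearrangements of each other. *)
Lemma spickE G w : (forall x, symf (G x)) ->
  spick G w = \sum_(x <- w) G x (rem x w).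
Proof.
elim: w G => [|k w IH] G sG /=; first by rewrite big_nil.
rewrite big_cons eqxx IH => [|x v v' vv']; last by apply: sG; rewrite perm_cons.
congr (_ + _); rewrite big_seq [RHS]big_seq; apply: eq_bigr => x xw.
apply: sG; case: eqP => [->|_] //.
by rewrite perm_sym perm_to_rem.
Qed.

Lemma perm_remm (x : nat) w w' : perm_eq w w' -> perm_eq (rem x w) (rem x w').
Proof.
move=> ww'; have [xw|xw] := boolP (x \in w); last first.
  by rewrite !rem_id // -(perm_mem ww').
rewrite -(perm_cons x) -(permPl (perm_to_rem xw)) (permPl ww').
by apply: perm_to_rem; rewrite -(perm_mem ww').
Qed.

Lemma spick_perm G w w' : (forall x, symf (G x)) -> perm_eq w w' ->
  spick G w = spick G w'.
Proof.
move=> sG ww'; rewrite !spickE // (perm_big _ ww') /=.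
by apply: eq_bigr => x _; apply: sG; apply: perm_remm.
Qed.

Lemma spick_nth G w :
  spick G w = \sum_(i < size w) G (nth 0%N w i) (drop_idx w i).
Proof.
elim: w G => [|k w IH] G /=; first by rewrite big_ord0.
rewrite big_ord_recl IH /=; congr (_ + _).
  congr (G _ _); rewrite /drop_idx /= (iotaDl 1 0) filter_map -map_comp.
  rewrite -[LHS](@mkseq_nth _ 0%N) /mkseq; congr (map _ _).
  by rewrite -[LHS]filter_predT.
apply: eq_bigr => i _; rewrite /drop_idx /= (iotaDl 1 0) filter_map -map_comp.
by congr (G _ (_ :: map _ _)).
Qed.

Lemma spick_pair (H : nat -> nat -> seq nat -> R) w :
  (forall a b u, H a b u = H b a u) ->
  spick (fun x v => spick (fun y u => H x y u) v) w = 2 * spair H w.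
Proof.
elim: w H => [|k w IH] H sH /=; first by rewrite mulr0.
rewrite spickD IH => [|a b u]; last exact: sH.
rewrite (@eq_spickT (fun x v => H x k v) (fun y u => H k y u)) //.
by ring.
Qed.

Lemma eq_spair G H w :
  (forall a b u, perm_eq (a :: b :: u) w -> G a b u = H a b u) ->
  spair G w = spair H w.
Proof.
elim: w G H => //= k w IH G H eqGH; congr (_ + _).
  by apply: eq_spick => x v xv; apply: eqGH; rewrite perm_cons.
apply: IH => a b u abu; apply: eqGH.
rewrite -(perm_cons k) in abu; rewrite -(permPr abu).
by rewrite (perm_catCA [:: a; b] [:: k] u).
Qed.

Lemma spairD G H w :
  spair (fun a b u => G a b u + H a b u) w = spair G w + spair H w.
Proof.
elim: w G H => [|k w IH] G H /=; first by rewrite addr0.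
by rewrite spickD IH addrACA.
Qed.

Lemma spair0 w : spair (fun _ _ _ => 0) w = 0.
Proof. by elim: w => //= k w ->; rewrite spick0 addr0. Qed.

Lemma spairZ c H w : spair (fun a b u => c * H a b u) w = c * spair H w.
Proof.
by elim: w H => [|k w IH] H /=; rewrite ?mulr0 // IH spickZ mulrDr.
Qed.

Lemma spair_sum (I : Type) (r : seq I) (P : pred I) H w :
  spair (fun a b u => \sum_(i <- r | P i) H i a b u) w =
  \sum_(i <- r | P i) spair (H i) w.
Proof.
elim: w H => [|k w IH] H /=; first by rewrite big1.
by rewrite IH spick_sum -big_split.
Qed.

End SumPick.

(** * Monomial coefficients of products of power sums *)

Section PowerSums.
Variable R : realFieldType.
Implicit Types (w v u kap : seq nat).

(* The coefficient of [x^kap] in [p_w], for a finite list of variables indexed by [kap]. *)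
Fixpoint powc w kap : R :=
  if w is k :: w' then
    spick (fun y v => (k <= y)%:R * powc w' ((y - k)%N :: v)) kap
  else (all (pred1 0%N) kap)%:R.

Lemma powc_symr w : symf (powc w).
Proof.
elim: w => [|k w IH] v v' vv' /=; first by rewrite (perm_all _ vv').
apply: spick_perm vv' => x u u' uu'; congr (_ * _).
by apply: IH; rewrite perm_cons.
Qed.

(** Two letters are placed either in the same variable or in two different ones, and each of the two
    resulting sums is symmetric in the letters. *)
Lemma powc_swap k l w kap : powc (k :: l :: w) kap = powc (l :: k :: w) kap.
Proof.
have expand p q : powc (p :: q :: w) kap =
   spick (fun y v => ((p + q <= y)%N)%:R * powc w ((y - (p + q))%N :: v)) kap +
   spick (fun y v => spick (fun z u =>
     ((p <= y)%N)%:R * ((q <= z)%N)%:R *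
       powc w ((y - p)%N :: (z - q)%N :: u)) v) kap.
  rewrite -spickD /=; apply: eq_spickT => y v; rewrite mulrDr; congr (_ + _).
    rewrite mulrA -natrM mulnb subnDA.
    have -> : ((p <= y)%N && (q <= y - p)%N) = (p + q <= y)%N by lia.
    by [].
  rewrite -spickZ; apply: eq_spickT => z u; rewrite mulrA; congr (_ * _).
  by apply: powc_symr; rewrite (perm_catCA [:: _] [:: _] u).
rewrite !expand addnC spick_swap; congr (_ + _).
apply: eq_spickT => y v; apply: eq_spickT => z u; rewrite [X in X * _]mulrC.
by congr (_ * _); apply: powc_symr; rewrite (perm_catCA [:: _] [:: _] u).
Qed.

Lemma powc_syml kap : symf (fun w => powc w kap).
Proof.
have mid k w1 w2 kp : powc (w1 ++ k :: w2) kp = powc (k :: w1 ++ w2) kp.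
  elim: w1 kp => //= l w1 IH kp.
  rewrite -[RHS]/(powc [:: k, l & w1 ++ w2] kp) powc_swap.
  by apply: eq_spickT => y v; rewrite IH.
move=> w w'; elim: w w' kap => [|k w IH] w' kap ww'.
  by case: w' ww' => // k w'; rewrite perm_sym => /perm_nilP.
have kw' : k \in w' by rewrite -(perm_mem ww') mem_head.
case/splitPr: kw' ww' => w1 w2.
rewrite (perm_sym _ (_ ++ _)) perm_catC /= perm_cons perm_catC perm_sym => ww'.
by rewrite mid /=; apply: eq_spickT => y v; rewrite (IH _ _ ww').
Qed.

Lemma powc_rcons0 w kap : 0%N \notin w -> powc w (0%N :: kap) = powc w kap.
Proof.
elim: w kap => //= k w IH kap; rewrite inE negb_or => /andP[k0 w0].
rewrite leqn0 eq_sym (negbTE k0) mul0r add0r; apply: eq_spickT => y v.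
rewrite -(IH ((y - k)%N :: v) w0); congr (_ * _).
by apply: powc_symr; rewrite (perm_catCA [:: _] [:: _] v).
Qed.

Lemma powc_sumn w kap : powc w kap != 0 -> sumn kap = sumn w.
Proof.
elim: w kap => [|k w IH] kap /=.
  rewrite pnatr_eq0 eqb0 negbK => /allP all0.
  by rewrite sumnE big_seq big1 // => x /all0 /eqP.
apply: contraNeq => kapk; apply/eqP; rewrite -[RHS](spick0 R kap).
apply: eq_spick => y v yv; have [ky|_] := boolP (k <= y)%N; last by rewrite mul0r.
rewrite mul1r; apply/eqP; apply: contraNT kapk => /IH /= eqS.
by rewrite -(perm_sumn yv) /=; apply/eqP; lia.
Qed.

(* The operator [x_1 d/dx_1] applied to [p_w]. *)
Lemma powc_euler w t kap : t%:R * powc w (t :: kap) =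
  spick (fun x v => x%:R * ((x <= t)%:R * powc v ((t - x)%N :: kap))) w.
Proof.
elim: w t kap => [|k w IH] t kap /=.
  by case: t => [|t]; rewrite ?mul0r //= mulr0.
rewrite mulrDr.
have -> : spick (fun x v => x%:R * ((x <= t)%:R *
    ((k <= t - x)%:R * powc v (t - x - k :: kap)%N +
     spick (fun y u => (k <= y)%:R * powc v [:: (y - k)%N, (t - x)%N & u]) kap))) w =
  (k <= t)%:R * ((t - k)%:R * powc w ((t - k)%N :: kap)) +
  t%:R * spick (fun y u => (k <= y)%:R * powc w [:: (y - k)%N, t & u]) kap.
  rewrite IH -!spickZ.
  have -> : spick (fun y u => t%:R * ((k <= y)%:R * powc w [:: (y - k)%N, t & u])) kap =
    spick (fun y u => spick (fun x v => (k <= y)%:R * (x%:R * ((x <= t)%:R *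
      powc v [:: (t - x)%N, (y - k)%N & u]))) w) kap.
    apply: eq_spickT => y u; rewrite mulrCA spickZ -IH; congr (_ * (_ * _)).
    by apply: powc_symr; rewrite (perm_catCA [:: _] [:: _] u).
  rewrite -spick_exch -spickD; apply: eq_spickT => x v.
  rewrite !mulrDr; congr (_ + _).
    rewrite [RHS]mulrCA; congr (_ * _); rewrite !mulrA -!natrM !mulnb.
    rewrite -!subnDA addnC.
    by have -> : ((x <= t) && (k <= t - x) = (k <= t) && (x <= t - k))%N by lia.
  rewrite -!spickZ; apply: eq_spickT => y u.
  rewrite [RHS]mulrCA; congr (_ * _); rewrite [RHS]mulrCA.
  do 2!congr (_ * _); apply: powc_symr.
  by rewrite (perm_catCA [:: _] [:: _] u).
rewrite addrA; congr (_ + _).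
(* When the first letter sits in the distinguished variable, the other letters account for [t - k]
   and the letter itself for [k]. *)
have [kt|_] := boolP (k <= t)%N; last by rewrite !mul0r !mulr0 addr0.
by rewrite !mul1r -mulrDl -natrD subnKC.
Qed.

End PowerSums.

(** * The Laplace-Beltrami operator on monomial coefficients *)

Section LaplaceBeltrami.
Variables (R : realFieldType) (alpha : R).
Implicit Types (w v u kap : seq nat) (phi : seq nat -> R).

(* The Laplace-Beltrami operator in power sums; it is self-adjoint, so acting on the
   argument of the pairing [f |-> <f, p_w>] is acting on [f]. *)
Definition laplace_beltrami phi w : R := 2^-1 * spick (fun x v =>
  (alpha - 1) * (x%:R * (x%:R - 1)) * phi (x :: v)
  + x%:R * \sum_(1 <= a < x) phi [:: a, (x - a)%N & v]
  + alpha * (x%:R * spick (fun y u => y%:R * phi ((x + y)%N :: u)) v)) w.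
Notation lapb := laplace_beltrami.

(* The sum of the alpha-contents [alpha j - i] over the boxes [(i, j)] of [kap]. *)
Fixpoint eigv kap : R :=
  if kap is k :: kap' then
    alpha * (k%:R * (k%:R - 1)) / 2 + (eigv kap' - (sumn kap')%:R)
  else 0.

(* The off-diagonal part of the Laplace-Beltrami operator on monomial coefficients. *)
Definition raise F kap : R := spair (fun a b u =>
  \sum_(1 <= r < b.+1) (a%:R - b%:R + 2 * r%:R) * F [:: (a + r)%N, (b - r)%N & u])
  kap.

Notation powc := (@powc R).

Lemma lapbZ c phi w : lapb (fun v => c * phi v) w = c * lapb phi w.
Proof.
rewrite /lapb mulrCA; congr (_ * _); rewrite -spickZ; apply: eq_spickT => x v.
rewrite -mulr_sumr; under [X in alpha * (_ * X)]eq_spickT => y u do rewrite mulrCA.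
by rewrite spickZ; ring.
Qed.

Lemma big_nat1_if (n m : nat) (P : nat -> bool) (f : nat -> R) (c : R) :
  (forall s, (s < n)%N -> P s = (s == m)) ->
  \sum_(0 <= s < n) c * ((P s)%:R * f s) = c * ((m < n)%:R * f m).
Proof.
move=> Pm; rewrite -mulr_sumr; congr (_ * _).
have [mn|nm] := ltnP m n; last first.
  rewrite mul0r big_nat big1 // => s /andP[_ sn]; rewrite Pm //.
  by case: eqP => [sm|_]; rewrite ?mul0r //; lia.
rewrite (bigD1_seq m) ?mem_index_iota ?iota_uniq //= Pm // eqxx big_seq_cond big1 ?addr0 //.
by move=> s /andP[]; rewrite mem_index_iota => /= sn sm; rewrite Pm // (negbTE sm) mul0r.
Qed.

Lemma sum_subl (n : nat) (f : nat -> R) :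
  \sum_(0 <= s < n) f (n - s)%N = \sum_(1 <= a < n.+1) f a.
Proof.
rewrite big_nat_rev /= [RHS]big_add1 /= big_nat [RHS]big_nat.
by apply: eq_bigr => s /andP[_ sn]; congr f; lia.
Qed.

Section PairIdentity.
Variables (A B : nat) (rho w : seq nat).

(** [Z s t] deletes one letter from [w], necessarily [x = A + B - s - t], and leaves exponents [s]
    and [t] for two distinguished variables whose exponents totalled [A + B]. *)
Let Z s t : R := spick (fun x v =>
  x%:R * ((x + s + t == A + B)%N%:R * powc v [:: s, t & rho])) w.

Let ZC s t : Z s t = Z t s.
Proof.
apply: eq_spickT => x v; rewrite addnAC; congr (_ * (_ * _)).
by apply: powc_symr; rewrite (perm_catCA [:: _] [:: _] rho).
Qed.

Let Zl C E : (C + E = A + B)%N ->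
  C%:R * powc w [:: C, E & rho] = \sum_(0 <= s < C) Z s E.
Proof.
move=> CE; rewrite powc_euler -spick_sum; apply: eq_spickT => x v.
case: x => [|x].
  by rewrite mul0r big1 // => s _; rewrite mul0r.
have [xC|xC] := leqP x.+1 C; last first.
  rewrite mul0r mulr0 big_nat big1 // => s /andP[_ sC].
  have -> : (x.+1 + s + E == A + B)%N = false by lia.
  by rewrite mul0r mulr0.
rewrite (@big_nat1_if _ (C - x.+1)%N) => [|s _]; last by lia.
by have -> : (C - x.+1 < C)%N = true by lia.
Qed.

Let Zr C E : (C + E = A + B)%N ->
  E%:R * powc w [:: C, E & rho] = \sum_(0 <= t < E) Z C t.
Proof.
move=> CE; have -> : powc w [:: C, E & rho] = powc w [:: E, C & rho].
  by apply: powc_symr; rewrite (perm_catCA [:: _] [:: _] rho).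
by rewrite Zl 1?addnC //; apply: eq_bigr => t _; rewrite ZC.
Qed.

(** A letter cut into [a] for the first variable and [x - a] for the second leaves [s = A - a] and
    [t = B - (x - a)]; the pieces are nonempty exactly when [s < A] and [t < B]. *)
Let split_sum : spick (fun x v => x%:R * \sum_(1 <= a < x)
    ((a <= A)%:R * ((x - a <= B)%:R * powc v [:: (B - (x - a))%N, (A - a)%N & rho]))) w
  = \sum_(0 <= t < B) \sum_(0 <= s < A) Z s t.
Proof.
rewrite exchange_big_nat /=.
under eq_bigr => s _ do rewrite -spick_sum.
rewrite -spick_sum; apply: eq_spickT => x v.
pose h a := ((a < x) && (x - a <= B))%N%:R * 
  powc v [:: (B - (x - a))%N, (A - a)%N & rho].
have -> : \sum_(1 <= a < x) ((a <= A)%:R * ((x - a <= B)%:R *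
   powc v [:: (B - (x - a))%N, (A - a)%N & rho])) = \sum_(1 <= a < A.+1) h a.
  rewrite (@big_nat_widen _ _ _ _ x (A + x).+1) /=; last by lia.
  rewrite [RHS](@big_nat_widen _ _ _ _ A.+1 (A + x).+1) /=; last by lia.
  rewrite big_mkcond [RHS]big_mkcond; apply: eq_bigr => a _ /=.
  by rewrite /h ltnS; case: ltnP => _; case: leqP => _; rewrite ?mul0r ?mul1r.
rewrite -sum_subl mulr_sumr big_nat [RHS]big_nat; apply: eq_bigr => s /andP[_ sA].
rewrite /h.
have [/andP[c1 c2]|c] := boolP ((A - s < x) && (x - (A - s) <= B))%N; last first.
  rewrite mul0r mulr0 big_nat big1 // => t /andP[_ tB].
  have -> : (x + s + t == A + B)%N = false by move: c; rewrite negb_and; lia.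
  by rewrite mul0r mulr0.
rewrite (@big_nat1_if _ (B - (x - (A - s)))%N) => [|t _]; last by lia.
have -> : (B - (x - (A - s)) < B)%N = true by lia.
rewrite !mul1r; congr (_ * _); apply: powc_symr.
have -> : (A - (A - s) = s)%N by lia.
by rewrite (perm_catCA [:: _] [:: _] rho).
Qed.

(** Since [A - B + 2 r] is the difference of the exponents [A + r] and [B - r], [Zl] and [Zr] turn
    each term on the right into a sum of [Z] over [s] minus a sum over [t]. After summation over [r]
    the cells with [s > A] cancel. What remains is the rectangle of [split_sum] and the line
    [s = A], whose sum is [B * powc w [:: A, B & rho]]. *)
Lemma powc_pair : spick (fun x v => x%:R * \sum_(1 <= a < x)
    ((a <= A)%:R * ((x - a <= B)%:R * powc v [:: (B - (x - a))%N, (A - a)%N & rho]))) w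
  = - (B%:R * powc w [:: A, B & rho]) +
    \sum_(1 <= r < B.+1) (A%:R - B%:R + 2 * r%:R) *
      powc w [:: (A + r)%N, (B - r)%N & rho].
Proof.
rewrite split_sum.
have -> : \sum_(1 <= r < B.+1) (A%:R - B%:R + 2 * r%:R) *
      powc w [:: (A + r)%N, (B - r)%N & rho] =
   \sum_(0 <= t < B) (\sum_(0 <= s < A + B - t) Z s t - \sum_(A.+1 <= s < A + B - t) Z s t).
  rewrite sumrB.
  have -> : \sum_(0 <= t < B) \sum_(A.+1 <= s < A + B - t) Z s t =
     \sum_(1 <= r < B.+1) \sum_(0 <= t < B - r) Z (A + r)%N t.
    under [RHS]eq_bigr => r _.
      rewrite (@big_nat_widen _ _ _ _ (B - r) B) /=; last by lia.
      rewrite big_mkcond; over.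
    rewrite exchange_big_nat /=; apply: eq_bigr => t _.
    rewrite -big_mkcond /=.
    rewrite [RHS](eq_bigl (fun r => (r < B - t)%N)) => [|r]; last by lia.
    rewrite -[RHS](@big_nat_widen _ _ _ 1 (B - t) B.+1 xpredT) /=; last by lia.
    rewrite -[A.+1]add1n big_addn; apply: congr_big_nat => //; first by lia.
    by move=> r _; rewrite addnC.
  rewrite -(sum_subl B (fun r => \sum_(0 <= t < B - r) Z (A + r)%N t)).
  rewrite -(sum_subl B (fun r => (A%:R - B%:R + 2 * r%:R) *
      powc w [:: (A + r)%N, (B - r)%N & rho])) -sumrB.
  rewrite big_nat [RHS]big_nat; apply: eq_bigr => t /andP[_ tB].
  have -> : (A + B - t = A + (B - t))%N by lia.
  have -> : (B - (B - t) = t)%N by lia.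
  have e : (A + (B - t) + t = A + B)%N by lia.
  rewrite -(Zl e) -(Zr e) -mulrBl; congr (_ * _).
  by rewrite natrD natrB ?(ltnW tB) //; ring.
rewrite (@Zr A B) // -sumrN -big_split /= big_nat [RHS]big_nat; apply: eq_bigr => t /andP[_ tB].
rewrite (@big_cat_nat _ _ _ A.+1 0 (A + B - t)) //=; last by lia.
rewrite addrK big_nat_recr //=.
by rewrite addrC addrK.
Qed.
End PairIdentity.

Lemma powc_cons2 p q w kap : powc (p :: q :: w) kap =
  spick (fun y v => ((p + q <= y)%N)%:R * powc w ((y - (p + q))%N :: v)) kap +
  spick (fun y v => spick (fun z u =>
    ((p <= y)%N)%:R * ((q <= z)%N%:R *
       powc w ((z - q)%N :: (y - p)%N :: u))) v) kap.
Proof.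
rewrite -spickD /=; apply: eq_spickT => y v; rewrite mulrDr; congr (_ + _).
  rewrite mulrA -natrM mulnb subnDA.
  by have -> : ((p <= y)%N && (q <= y - p)%N) = (p + q <= y)%N by lia.
by rewrite -spickZ.
Qed.

(** The subtracted [sumn] counts each entry once for every earlier position, which makes it a sum
    over pairs. In this shape it absorbs the diagonal term [- B] of [powc_pair]. *)
Lemma eigv_pair kap (c : R) :
  spick (fun y _ => alpha * (y%:R * (y%:R - 1)) / 2 * c) kap +
    spair (fun _ b _ => - (b%:R * c)) kap = eigv kap * c.
Proof.
elim: kap => [|k kap IH] /=; first by rewrite addr0 mul0r.
rewrite addrACA addrA -addrA IH; have -> : spick (fun y _ => - (y%:R * c)) kap = - (sumn kap)%:R * c.
  elim: (kap) => [|y s IHs] /=; first by rewrite oppr0 mul0r.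
  by rewrite IHs natrD; ring.
by ring.
Qed.

(** Regroup the operator as [alpha] times (diagonal plus join) plus (cut minus diagonal). The first
    group is [sum_i x_i^2 d^2/dx_i^2] and gives the [alpha] part of the eigenvalue. In the second,
    cuts with both pieces in one variable cancel the diagonal, and cuts across two variables are
    given by [powc_pair]. *)
Lemma lapb_powc kap w :
  lapb (fun w => powc w kap) w = eigv kap * powc w kap + raise (powc w) kap.
Proof.
pose sq := spick (fun x v => (x%:R * (x%:R - 1)) * powc (x :: v) kap) w.
have diag : sq + spick (fun x v => x%:R * spick (fun y u =>
    y%:R * powc ((x + y)%N :: u) kap) v) w =
    spick (fun y _ => y%:R * (y%:R - 1) * powc w kap) kap.
  have -> : spick (fun y _ => y%:R * (y%:R - 1) * powc w kap) kap =
    spick (fun y u => y%:R * (y%:R - 1) * powc w (y :: u)) kap.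
    by apply: eq_spick => y u yu; rewrite (powc_symr R w yu).
  rewrite /sq -spickD.
  have -> : spick (fun y u => y%:R * (y%:R - 1) * powc w (y :: u)) kap =
   spick (fun y u => spick (fun x v => x%:R * (x%:R - 1) * ((x <= y)%:R *
      powc v ((y - x)%N :: u)) +
      x%:R * spick (fun z t => z%:R * ((x + z <= y)%N%:R *
        powc t ((y - (x + z))%N :: u))) v) w) kap.
    apply: eq_spickT => y u; rewrite [y%:R * _]mulrC -mulrA powc_euler -spickZ.
    apply: eq_spickT => x v.
    have [xy|xy] := leqP x y; last first.
      rewrite !mul0r !mulr0 add0r (@eq_spickT _ _ (fun _ _ => 0)) ?spick0 ?mulr0 //.
      by move=> z t; rewrite leqNgt ltn_addr // mul0r mulr0.
    have -> : spick (fun z t => z%:R * ((x + z <= y)%N%:R * powc t ((y - (x + z))%N :: u))) v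
      = (y - x)%:R * powc v ((y - x)%N :: u).
      rewrite powc_euler; apply: eq_spickT => z t.
      by rewrite leq_subRL // subnDA.
    by rewrite natrB // !mul1r; ring.
  rewrite [RHS]spick_exch; apply: eq_spickT => x v.
  rewrite spickD !spickZ; congr (_ + _ * _).
  by rewrite spick_exch; apply: eq_spickT => z t; rewrite spickZ.
have split : spick (fun x v => x%:R * \sum_(1 <= a < x) powc [:: a, (x - a)%N & v] kap) w
   - sq = 2 * spair (fun a b u => - (b%:R * powc w [:: a, b & u]) +
      \sum_(1 <= r < b.+1) (a%:R - b%:R + 2 * r%:R) *
      powc w [:: (a + r)%N, (b - r)%N & u]) kap.
  rewrite (@eq_spair _ _ (fun a b u => spick (fun x v => x%:R * \sum_(1 <= c < x)
      ((c <= a)%:R * ((x - c <= b)%:R * powc v [:: (b - (x - c))%N, (a - c)%N & u]))) w)); last first.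
    by move=> a b u _; rewrite powc_pair.
  rewrite -spick_pair => [|a b u]; last first.
    apply: eq_spickT => x v; congr (_ * _); rewrite big_nat_rev /=.
    rewrite big_nat [RHS]big_nat; apply: eq_bigr => c /andP[c0 cx].
    have -> : (1 + x - c.+1 = x - c)%N by lia.
    have -> : (x - (x - c) = c)%N by lia.
    rewrite mulrCA; congr (_ * (_ * _)); apply: powc_symr.
    by rewrite (perm_catCA [:: _] [:: _] u).
  under [RHS]eq_spickT => y v do rewrite spick_exch.
  rewrite [RHS]spick_exch /sq -spickB; apply: eq_spickT => [] [|x] v.
    rewrite !mul0r subr0 -[LHS](spick0 R kap); apply: eq_spickT => y u.
    by rewrite -[LHS](spick0 R u); apply: eq_spickT => z t; rewrite mul0r.
  rewrite -mulrA -mulrBr; under [RHS]eq_spickT => y u do rewrite spickZ.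
  rewrite spickZ; congr (_ * _).
  under [RHS]eq_spickT => y u do rewrite spick_sum.
  rewrite spick_sum; under eq_bigr => c _ do rewrite powc_cons2.
  (* A letter has one cut fewer than its size, and cuts into a single variable all contribute alike:
     together they equal [sq]. *)
  rewrite big_split /= addrAC [X in X + _ = _](_ : _ = 0) ?add0r //.
  apply/eqP; rewrite subr_eq0; apply/eqP.
  rewrite (eq_big_nat _ _ (F2 := fun=> spick (fun y u =>
     (x.+1 <= y)%:R * powc v ((y - x.+1)%N :: u)) kap)) => [|c /andP[_ cx]].
    by rewrite sumr_const_nat subn1 /= -natr1 addrK mulr_natl.
  by rewrite subnKC // ltnW.
rewrite /lapb 2!spickD.
have -> : raise (powc w) kap = spair (fun a b u => - (b%:R * powc w [:: a, b & u]) +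
      \sum_(1 <= r < b.+1) (a%:R - b%:R + 2 * r%:R) *
      powc w [:: (a + r)%N, (b - r)%N & u]) kap - 
      spair (fun _ b _ => - (b%:R * powc w kap)) kap.
  apply/eqP; rewrite eq_sym subr_eq addrC; apply/eqP.
  rewrite spairD; congr (_ + _); apply: eq_spair => a b u abu.
  by rewrite (powc_symr R w abu).
rewrite -(eigv_pair kap (powc w kap)).
have -> : spick (fun x v => (alpha - 1) * (x%:R * (x%:R - 1)) * powc (x :: v) kap) w
    = (alpha - 1) * sq.
  by rewrite /sq -spickZ; apply: eq_spickT => x v; rewrite !mulrA.
have -> : spick (fun x v => alpha * (x%:R * spick (fun y u =>
    y%:R * powc ((x + y)%N :: u) kap) v)) w =
  alpha * (spick (fun y _ => y%:R * (y%:R - 1) * powc w kap) kap - sq).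
  by rewrite -diag addrC addKr spickZ.
have -> : spick (fun y _ => alpha * (y%:R * (y%:R - 1)) / 2 * powc w kap) kap =
  alpha / 2 * spick (fun y _ => y%:R * (y%:R - 1) * powc w kap) kap.
  by rewrite -spickZ; apply: eq_spickT => y _; ring.
move: split => /eqP; rewrite subr_eq => /eqP ->.
by field.
Qed.
End LaplaceBeltrami.

(** * Partitions, sorted representatives of words, and [z_lambda] *)

Lemma geq_total : total geq. Proof. by move=> m n; rewrite /= leq_total. Qed.
Lemma geq_trans : transitive geq.
Proof. by move=> m n p /= nm mp; apply: leq_trans mp nm. Qed.
Lemma geq_anti : antisymmetric geq.
Proof. by move=> m n /= /anti_leq. Qed.

Lemma mem_parts_bnd fuel k n s : (n <= fuel)%N ->
  (s \in parts_bnd fuel k n) =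
  [&& path geq k s, all (fun x => 0 < x)%N s & sumn s == n].
Proof.
elim: fuel k n s => [|fuel IH] k n s nf.
  rewrite leqn0 in nf; rewrite (eqP nf) /= inE.
  by case: s => [|[|x] s] //=; rewrite ?andbF.
rewrite /=; case: (eqVneq n 0%N) => [->|n0].
  by rewrite inE; case: s => [|[|x] s] //=; rewrite ?andbF.
apply/flattenP/idP => [[t /mapP[i]]|].
  rewrite mem_iota => /andP[i0 ik] -> /mapP[p].
  rewrite IH; last by lia.
  by move=> /and3P[pp ap /eqP sp] -> /=; rewrite pp ap sp; lia.
case: s => [|i p] /=; first by move=> /eqP e; rewrite e eqxx in n0.
move=> /and3P[/andP[ik pp] /andP[i0 ap] /eqP sp].
exists [seq i :: q | q <- parts_bnd fuel i (n - i)].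
  by apply: map_f; rewrite mem_iota; lia.
by apply: map_f; rewrite IH ?pp ?ap /=; lia.
Qed.

Lemma mem_partitions n s : (s \in partitions n) = is_partition n s.
Proof.
rewrite /partitions mem_parts_bnd // /is_partition.
case: s => [|x s] //=; case: (path geq x s); rewrite ?andbF //=.
by apply/idP/idP => [/and3P[_ -> ->]//|/andP[-> /eqP sn]]; rewrite sn eqxx; lia.
Qed.

Lemma partitions_uniq n : uniq (partitions n).
Proof.
rewrite /partitions; suff H f k m : uniq (parts_bnd f k m) by exact: H.
elim: f k m => [|f IH] k m /=; first by case: ifP.
case: ifP => // _.
apply: (@allpairs_uniq_dep _ _ _ (fun i p => i :: p) (iota 1 (minn k m))
   (fun i => parts_bnd f i (m - i))).
- exact: iota_uniq.
- by move=> i _; apply: IH.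
- by move=> [i p] [j q] _ _ /= [-> ->].
Qed.

Lemma partP n s : reflect [/\ sorted geq s, 0%N \notin s & sumn s = n]
  (s \in partitions n).
Proof.
rewrite mem_partitions /is_partition.
have -> : all (fun x => 0 < x)%N s = (0%N \notin s).
  by apply/allP/idP => [h|s0 x xs]; [apply/negP => /h | case: x xs => // xs; rewrite xs in s0].
by apply: (iffP and3P) => [[-> -> /eqP]|[-> -> ->]].
Qed.

Lemma part_perm_eq n m s t : s \in partitions n -> t \in partitions m ->
  perm_eq s t -> s = t.
Proof.
by move=> /partP[ss _ _] /partP[st _ _]; apply: (sorted_eq geq_trans geq_anti).
Qed.

Lemma normp_perm s t : perm_eq s t -> normp s = normp t.
Proof.
move=> st; apply/(perm_sortP geq_total geq_trans geq_anti).
exact: perm_filter.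
Qed.

Lemma perm_normp s : 0%N \notin s -> perm_eq (normp s) s.
Proof.
move=> s0; rewrite perm_sort; suff -> : [seq x <- s | x != 0%N] = s by [].
by apply/all_filterP/allP => x xs; apply: contraNneq s0 => <-.
Qed.

Lemma normp_partition s : normp s \in partitions (sumn s).
Proof.
apply/partP; split; first exact: sort_sorted geq_total _.
  by rewrite mem_sort mem_filter eqxx.
rewrite (perm_sumn (permEl (perm_sort _ _))) !sumnE big_filter.
by rewrite [RHS](bigID (fun x => x != 0%N)) /= [X in (_ + X)%N]big1 ?addn0 // => x; rewrite negbK => /eqP.
Qed.

Lemma normp_id n s : s \in partitions n -> normp s = s.
Proof.
move=> sn; have [_ s0 _] := partP _ _ sn.
exact: part_perm_eq (normp_partition s) sn (perm_normp s0).
Qed.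

Lemma zeeE (s r : seq nat) : uniq r -> {subset s <= r} ->
  zee s = (\prod_(i <- r) (i ^ mult i s * (mult i s)`!))%N.
Proof.
move=> ur sr; rewrite [RHS](bigID (fun i => i \in s)) /= mulnC big1 ?mul1n => [|i]; last first.
  by rewrite /mult => /count_memPn ->.
rewrite -big_filter; apply: perm_big; apply: uniq_perm; rewrite ?undup_uniq ?filter_uniq //.
by move=> i; rewrite mem_undup mem_filter; case: (boolP (i \in s)) => // /sr ->.
Qed.

Lemma zee_perm s t : perm_eq s t -> zee s = zee t.
Proof.
move=> st; rewrite (@zeeE t (undup s)) ?undup_uniq //; last first.
  by move=> i; rewrite mem_undup (perm_mem st).
by apply: eq_bigr => i _; rewrite /mult (permP st).
Qed.

Lemma zee_cons k v : zee (k :: v) = (k * (mult k v).+1 * zee v)%N.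
Proof.
have ur := undup_uniq (k :: v).
rewrite (@zeeE v (undup (k :: v))) // => [|i]; last first.
  by rewrite mem_undup inE => ->; rewrite orbT.
have kr : k \in undup (k :: v) by rewrite mem_undup mem_head.
rewrite /zee !(bigD1_seq k) //= {1 3}/mult /= eqxx add1n factS expnS.
rewrite (eq_bigr (fun i => i ^ mult i v * (mult i v)`!)%N) => [|i ik]; last first.
  by rewrite /mult /= eq_sym (negbTE ik).
rewrite -/(mult k v); nia.
Qed.

Lemma zee_gt0 s : 0%N \notin s -> (0 < zee s)%N.
Proof.
elim: s => [|k s IH]; first by rewrite /zee big_nil.
rewrite inE negb_or => /andP[k0 s0]; rewrite zee_cons !muln_gt0 IH // lt0n eq_sym k0.
by [].
Qed.

Lemma stable_normp (R : comNzRingType) (F : seq nat -> R) kap : symf F -> (forall t, F (0%N :: t) = F t) ->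
  F (normp kap) = F kap.
Proof.
move=> sF F0; rewrite /normp (sF _ _ (permEl (perm_sort _ _))).
have -> : F kap = F ([seq x <- kap | x != 0%N] ++ [seq x <- kap | ~~ (x != 0%N)]).
  by apply: sF; rewrite perm_sym; apply: permEl (perm_filterC _ _).
have : all (pred1 0%N) [seq x <- kap | ~~ (x != 0%N)].
  by apply/allP => x; rewrite mem_filter negbK => /andP[].
elim: [seq x <- kap | ~~ (x != 0%N)] => [|x s IH] /=; first by rewrite cats0.
case/andP=> /eqP -> /IH ->; rewrite -F0; apply: sF.
by rewrite perm_sym (perm_catCA _ [:: 0%N]).
Qed.

Lemma path_geqS a s : path geq a s -> path geq a.+1 s.
Proof. by case: s => //= z s /andP[/= za ->]; rewrite andbT /= leqW. Qed.

(** * The scalar product on functionals and its adjoint pairs of operators *)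

Section InnerProduct.
Variables (R : realFieldType) (alpha : R).
Hypothesis alpha_gt0 : 0 < alpha.
Implicit Types (w v u kap : seq nat) (phi psi : seq nat -> R).

Notation lapb := (laplace_beltrami alpha).

(** Recovering [f] from its pairings with the [p_lam] divides by their squared norms, so the scalar
    product of two functionals carries inverse norms. *)
Definition zweight (lam : seq nat) : R := (alpha ^+ size lam * (zee lam)%:R)^-1.
Notation weight := zweight.

Definition jack_iprod n phi psi : R :=
  \sum_(lam <- partitions n) weight lam * (phi lam * psi lam).
Notation iprod := jack_iprod.

Lemma weight_perm : symf weight.
Proof. by move=> s t st; rewrite /weight (perm_size st) (zee_perm st). Qed.

Lemma weight_gt0 s : 0%N \notin s -> 0 < weight s.
Proof.
by move=> /zee_gt0 s0; rewrite invr_gt0 mulr_gt0 ?exprn_gt0 // ltr0n.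
Qed.

Lemma weight_cons k v : (0 < k)%N -> 
  weight (k :: v) * (k%:R * (count_mem k v).+1%:R) = alpha^-1 * weight v.
Proof.
move=> k0; have k0' : k%:R != 0 :> R by rewrite pnatr_eq0 -lt0n.
have m0 : (mult k v).+1%:R != 0 :> R by rewrite pnatr_eq0.
rewrite /weight zee_cons /= exprS !natrM !invfM -/(mult k v).
transitivity (alpha^-1 * ((alpha ^+ size v)^-1 * (zee v)%:R^-1) *
  ((k%:R^-1 * k%:R) * ((mult k v).+1%:R^-1 * (mult k v).+1%:R))); first by ring.
by rewrite !mulVf // !mulr1.
Qed.

Lemma part_rem n k lam : lam \in partitions n -> k \in lam ->
  rem k lam \in partitions (n - k).
Proof.
move=> /partP[sl l0 sn] kl; apply/partP; split.
- exact: subseq_sorted geq_trans _ _ (rem_subseq _ _) sl.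
- by apply: contra l0; apply: mem_rem.
- by rewrite -sn (perm_sumn (perm_to_rem kl)) /= addKn.
Qed.

Lemma part_le n k lam : lam \in partitions n -> k \in lam -> (0 < k <= n)%N.
Proof.
move=> /partP[_ l0 sn] kl; rewrite -sn (perm_sumn (perm_to_rem kl)) /= leq_addr.
by rewrite andbT lt0n; apply: contraNneq l0 => <-.
Qed.

(* Removing a part [k] is a bijection onto the partitions of [n - k], and
   [k * mult k lam * weight lam = alpha^-1 * weight (lam minus k)]. *)
Lemma sum_weight_spick n (H : nat -> seq nat -> R) : (forall k, symf (H k)) ->
  \sum_(lam <- partitions n) weight lam * spick (fun x v => x%:R * H x v) lam =
  alpha^-1 * \sum_(1 <= k < n.+1) \sum_(mu <- partitions (n - k)) weight mu * H k mu.
Proof.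
move=> sH.
have -> : \sum_(lam <- partitions n) weight lam * spick (fun x v => x%:R * H x v) lam =
  \sum_(lam <- partitions n) \sum_(1 <= k < n.+1 | k \in lam)
     weight lam * (k%:R * (count_mem k lam)%:R) * H k (rem k lam).
  rewrite big_seq [RHS]big_seq; apply: eq_bigr => lam ln.
  rewrite spickE => [|x v v' vv']; last by rewrite (sH x _ _ vv').
  rewrite mulr_sumr [RHS]big_mkcond /=.
  have -> : \sum_(x <- lam) weight lam * (x%:R * H x (rem x lam)) =
    \sum_(x <- lam) \sum_(1 <= k < n.+1) (x == k)%:R * (weight lam * (k%:R * H k (rem k lam))).
    rewrite big_seq [RHS]big_seq; apply: eq_bigr => x xl.
    have /andP[x0 xn] := part_le ln xl.
    rewrite (bigD1_seq x) ?mem_index_iota ?iota_uniq ?x0 ?ltnS //= eqxx mul1r.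
    by rewrite big1 ?addr0 // => k; rewrite eq_sym => /negbTE ->; rewrite mul0r.
  rewrite exchange_big /=; apply: eq_bigr => k _.
  rewrite -mulr_suml.
  have -> : \sum_(x <- lam) (x == k)%:R = (count_mem k lam)%:R :> R.
    by rewrite -sum1_count natr_sum [RHS]big_mkcond; apply: eq_bigr => x _ /=; case: eqP.
  case: ifP => [_|/negbT /count_memPn ->]; last by rewrite mul0r.
  by ring.
rewrite (exchange_big_dep xpredT) //= mulr_sumr big_nat [RHS]big_nat.
apply: eq_bigr => k /andP[k0 kn]; rewrite mulr_sumr.
transitivity (\sum_(mu <- [seq rem k lam | lam <- partitions n & k \in lam])
   alpha^-1 * (weight mu * H k mu)).
  rewrite big_map big_filter big_seq_cond [RHS]big_seq_cond.
  apply: eq_bigr => lam /andP[_ kl].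
  rewrite (weight_perm (perm_to_rem kl)) (permP (perm_to_rem kl)) /= eqxx add1n.
  by rewrite weight_cons // mulrA.
apply: perm_big; apply: uniq_perm; rewrite ?partitions_uniq //.
  rewrite map_inj_in_uniq ?filter_uniq ?partitions_uniq // => l1 l2.
  rewrite !mem_filter => /andP[k1 p1] /andP[k2 p2] e.
  apply: (part_perm_eq p1 p2).
  by rewrite (permPl (perm_to_rem k1)) e perm_sym perm_to_rem.
move=> mu; apply/mapP/idP => [[lam]|mun].
  by rewrite mem_filter => /andP[kl ln] ->; apply: part_rem.
have [smu mu0 mus] := partP _ _ mun.
have kmu0 : 0%N \notin k :: mu by rewrite inE negb_or mu0 andbT neq_ltn k0.
have pk := perm_normp kmu0.
have kin : k \in normp (k :: mu) by rewrite (perm_mem pk) mem_head.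
have pn : normp (k :: mu) \in partitions n.
  by have := normp_partition (k :: mu); rewrite /= mus subnKC.
exists (normp (k :: mu)); first by rewrite mem_filter kin.
apply: part_perm_eq mun (part_rem pn kin) _.
by rewrite -(perm_cons k) -(permPr (perm_to_rem kin)) perm_sym.
Qed.

Lemma iprodC n phi psi : iprod n phi psi = iprod n psi phi.
Proof. by apply: eq_bigr => lam _; rewrite [phi _ * _]mulrC. Qed.

Lemma eq_iprod n phi phi' psi psi' :
  {in partitions n, phi =1 phi'} -> {in partitions n, psi =1 psi'} ->
  iprod n phi psi = iprod n phi' psi'.
Proof.
move=> e1 e2; rewrite /iprod big_seq [RHS]big_seq.
by apply: eq_bigr => lam ln; rewrite e1 // e2.
Qed.

Lemma iprodZl n c phi psi : iprod n (fun w => c * phi w) psi = c * iprod n phi psi.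
Proof. by rewrite mulr_sumr; apply: eq_bigr => lam _; ring. Qed.

Lemma iprodZr n c phi psi : iprod n phi (fun w => c * psi w) = c * iprod n phi psi.
Proof. by rewrite iprodC iprodZl iprodC. Qed.

Lemma iprodDl n phi phi' psi :
  iprod n (fun w => phi w + phi' w) psi = iprod n phi psi + iprod n phi' psi.
Proof. by rewrite -big_split; apply: eq_bigr => lam _ /=; ring. Qed.

Lemma iprodDr n phi psi psi' :
  iprod n phi (fun w => psi w + psi' w) = iprod n phi psi + iprod n phi psi'.
Proof. by rewrite ![iprod n phi _]iprodC iprodDl. Qed.

Lemma iprod_suml (I : Type) (r : seq I) (P : pred I) n (F : I -> seq nat -> R) psi :
  iprod n (fun w => \sum_(i <- r | P i) F i w) psi =
  \sum_(i <- r | P i) iprod n (F i) psi.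
Proof.
rewrite /iprod exchange_big /=; apply: eq_bigr => lam _.
by rewrite mulr_suml mulr_sumr.
Qed.

Lemma iprod_sumr (I : Type) (r : seq I) (P : pred I) n (F : I -> seq nat -> R) psi :
  iprod n psi (fun w => \sum_(i <- r | P i) F i w) =
  \sum_(i <- r | P i) iprod n psi (F i).
Proof. by rewrite iprodC iprod_suml; apply: eq_bigr => i _; rewrite iprodC. Qed.

(* [add1] is adjoint to the multiplication by [p_1], which is [alpha * rem1]. *)
Definition add1 phi w : R := phi (1%N :: w).
Definition rem1 phi w : R := spick (fun x v => (x == 1%N)%:R * phi v) w.
(** [downop] encodes the action of [sum_i i p_(i+1) d/dp_i] on [f], and [upop] that of its adjoint.
    Both preserve the number of letters, so no [alpha] appears in their adjunction. *)
Definition upop phi w : R := spick (fun x v => x%:R * phi (x.+1 :: v)) w.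
Definition downop phi w : R :=
  spick (fun x v => x%:R * ((1 < x)%N%:R * phi (x.-1 :: v))) w.

Lemma add1_sym phi : symf phi -> symf (add1 phi).
Proof. by move=> sp v v' vv'; apply: sp; rewrite perm_cons. Qed.

Lemma rem1_sym phi : symf phi -> symf (rem1 phi).
Proof.
move=> sp v v' vv'; apply: spick_perm vv' => x u u' uu'.
by rewrite (sp _ _ uu').
Qed.

Lemma lapb_sym phi : symf phi -> symf (lapb phi).
Proof.
move=> sp v v' vv'; congr (_ * _); apply: spick_perm vv' => x u u' uu'.
rewrite (sp (x :: u) (x :: u')) ?perm_cons //; congr (_ + _ * _ + _ * (_ * _)).
  by apply: eq_bigr => a _; apply: sp; rewrite !perm_cons.
apply: spick_perm uu' => y t t' tt'.
by rewrite (sp ((x + y)%N :: t) ((x + y)%N :: t')) // perm_cons.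
Qed.

Lemma iprod_spick n phi (G : nat -> seq nat -> R) : symf phi -> (forall k, symf (G k)) ->
  iprod n phi (spick (fun x v => x%:R * G x v)) =
  alpha^-1 * \sum_(1 <= k < n.+1) \sum_(mu <- partitions (n - k))
     weight mu * (phi (k :: mu) * G k mu).
Proof.
move=> sp sG; rewrite -(sum_weight_spick n (H := fun k mu => phi (k :: mu) * G k mu)).
  apply: eq_bigr => lam _; rewrite -spickZ; congr (_ * _).
  by apply: eq_spick => x v xv; rewrite (sp _ _ xv); ring.
by move=> k v v' vv'; rewrite (sp (k :: v) (k :: v')) ?perm_cons // (sG k _ _ vv').
Qed.

Lemma iprod_add1 n phi psi : symf phi -> symf psi ->
  iprod n (add1 phi) psi = alpha * iprod n.+1 phi (rem1 psi).
Proof.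
move=> sp sps.
rewrite (@eq_iprod _ phi phi (rem1 psi)
    (spick (fun x v => x%:R * ((x == 1%N)%:R * psi v)))) //; last first.
  move=> lam _; apply: eq_spickT => x v.
  by case: (eqVneq x 1%N) => [->|_]; rewrite ?mul1r // !mul0r mulr0.
rewrite iprod_spick // => [|k v v' vv']; last by rewrite (sps _ _ vv').
rewrite mulrA divff ?gt_eqF // mul1r big_ltn // [X in _ + X]big_nat.
rewrite [X in _ + X]big1 ?addr0.
  by rewrite subn1 eqxx; apply: eq_bigr => mu _; rewrite mul1r.
move=> k /andP[k1 _]; rewrite big1 // => mu _.
by rewrite [k == 1%N]gtn_eqF // mul0r !mulr0.
Qed.

Lemma iprod_upop n phi psi : symf phi -> symf psi ->
  iprod n (upop phi) psi = iprod n.+1 phi (downop psi).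
Proof.
move=> sp sps; rewrite iprodC !iprod_spick //.
- congr (_ * _); rewrite [RHS]big_ltn // [X in X + _]big1 ?add0r.
    rewrite [RHS]big_add1 /= big_nat [RHS]big_nat; apply: eq_bigr => k /andP[k0 kn].
    by rewrite subSS; apply: eq_bigr => mu _; rewrite ltnS k0 mul1r [psi _ * _]mulrC.
  by move=> mu _; rewrite mul0r !mulr0.
- by move=> k v v' vv'; rewrite (sps (k.-1 :: v) (k.-1 :: v')) // perm_cons.
- by move=> k v v' vv'; apply: sp; rewrite perm_cons.
Qed.

Lemma sum_triangle n (f : nat -> nat -> R) :
  \sum_(1 <= k < n.+1) \sum_(1 <= a < k) f a (k - a)%N =
  \sum_(1 <= a < n.+1) \sum_(1 <= l < (n - a).+1) f a l.
Proof.
transitivity (\sum_(1 <= k < n.+1) \sum_(1 <= a < n.+1 | (a < k)%N) f a (k - a)%N).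
  rewrite big_nat [RHS]big_nat; apply: eq_bigr => k /andP[_ kn].
  by rewrite (@big_nat_widen _ _ _ 1 k n.+1) //; lia.
rewrite (exchange_big_dep_nat xpredT) //= big_nat [RHS]big_nat.
apply: eq_bigr => a /andP[a0 an].
rewrite -(@big_nat_widenl _ _ _ a.+1 1 n.+1 xpredT) // -add1n big_addn subSn //.
by apply: eq_bigr => l _; rewrite addnK.
Qed.

(** Cutting and joining are adjoint up to the factor [alpha] ([sj]), which is exactly the
    coefficient of the joining term; the remaining term multiplies each [p_w] by a scalar. *)
Lemma iprod_lapb n phi psi : symf phi -> symf psi ->
  iprod n (lapb phi) psi = iprod n phi (lapb psi).
Proof.
pose split phi w := spick (fun x v => x%:R * \sum_(1 <= a < x) phi [:: a, (x - a)%N & v]) w.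
pose join phi w := spick (fun x v => x%:R * spick (fun y u => y%:R * phi ((x + y)%N :: u)) v) w.
pose dg w : R := spick (fun x _ => x%:R * (x%:R - 1)) w.
have E f w : symf f -> lapb f w = 2^-1 * ((alpha - 1) * (dg w * f w) + split f w + alpha * join f w).
  move=> sf; rewrite /laplace_beltrami !spickD spickZ; congr (_ * (_ + _ + _)).
  rewrite -spickZr -spickZ; apply: eq_spick => x v xv.
  by rewrite (sf _ _ xv) mulrA.
have sj f g : symf f -> symf g -> iprod n f (split g) = alpha * iprod n (join f) g.
  move=> sf sg; rewrite [iprod n (join f) g]iprodC !iprod_spick //; first last.
  - by move=> k v v' vv'; apply: eq_bigr => a _; apply: sg; rewrite !perm_cons.
  - move=> k v v' vv'; apply: spick_perm vv' => y u u' uu'.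
    by rewrite (sf ((k + y)%N :: u) ((k + y)%N :: u')) // perm_cons.
  rewrite [RHS]mulrA divff ?gt_eqF // mul1r.
  transitivity (alpha^-1 * \sum_(1 <= a < n.+1) \sum_(1 <= l < (n - a).+1)
     \sum_(mu <- partitions (n - a - l)) 
        weight mu * (g [:: a, l & mu] * f ((a + l)%N :: mu))).
    rewrite -(sum_triangle n (fun a l => \sum_(mu <- partitions (n - a - l)) 
        weight mu * (g [:: a, l & mu] * f ((a + l)%N :: mu)))); congr (_ * _).
    rewrite big_nat [RHS]big_nat; apply: eq_bigr => k /andP[_ kn].
    rewrite [RHS](eq_big_nat _ _ (F2 := fun a => \sum_(mu <- partitions (n - k))
        weight mu * (g [:: a, (k - a)%N & mu] * f (k :: mu)))).
      rewrite exchange_big /=; apply: eq_bigr => mu _.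
      by rewrite !mulr_sumr; apply: eq_bigr => a _; ring.
    move=> a /andP[_ ak]; rewrite subnKC 1?ltnW // -subnDA subnKC 1?ltnW //.
  rewrite mulr_sumr; apply: eq_bigr => k _.
  rewrite -[RHS]/(iprod (n - k) (fun mu => g (k :: mu)) (spick (fun y u => y%:R * f ((k + y)%N :: u)))).
  rewrite iprod_spick //; first by move=> v v' vv'; apply: sg; rewrite perm_cons.
  by move=> y v v' vv'; apply: sf; rewrite perm_cons.
move=> sp sq.
rewrite (eq_iprod (fun w _ => E phi w sp) (fun w _ => erefl (psi w))).
rewrite (eq_iprod (fun w _ => erefl (phi w)) (fun w _ => E psi w sq)).
rewrite iprodZl iprodZr !iprodDl !iprodDr !iprodZl !iprodZr sj //.
rewrite [iprod n (split phi) psi]iprodC sj // [iprod n (join psi) _]iprodC.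
have -> : iprod n (fun w => dg w * phi w) psi = iprod n phi (fun w => dg w * psi w).
  by apply: eq_bigr => lam _; ring.
by congr (_ * _); rewrite -!addrA; congr (_ + _); rewrite addrC.
Qed.
End InnerProduct.

(** * Linear systems triangular for a numerical measure *)

Section Triangular.
Variables (R : fieldType) (T : eqType) (X : seq T) (A : T -> T -> R).
Variable meas : T -> nat.
Hypothesis X_uniq : uniq X.
Hypothesis A_diag : {in X, forall x, A x x != 0}.
Hypothesis A_tri : {in X &, forall x y, A x y != 0 -> (y == x) || (meas y < meas x)%N}.

(** Back substitution from the largest measure down: besides its own equation, an unknown enters
    only equations of smaller measure, so correcting by the residual at one level keeps the levels
    above it. *)
Lemma tri_solve (H : T -> R) :
  exists c : T -> R, {in X, forall y, H y = \sum_(x <- X) c x * A x y}.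
Proof.
pose M := (\sum_(x <- X) meas x).+1.
have ltM x : x \in X -> (meas x < M)%N.
  by move=> xX; rewrite ltnS (bigD1_seq x) //= leq_addr.
suff /(_ M) [c cP] : forall d, exists c : T -> R,
    {in X, forall y, (M - d <= meas y)%N -> H y = \sum_(x <- X) c x * A x y}.
  by exists c => y yX; apply: cP; rewrite ?subnn.
elim=> [|d [c cP]].
  by exists (fun=> 0) => y /ltM; rewrite subn0 ltnNge => /negbTE ->.
pose r y := H y - \sum_(x <- X) c x * A x y.
have [dM|Md] := ltnP d M; last first.
  by exists c => y yX _; apply: cP => //; rewrite (eqP (_ : M - d == 0)%N) // subn_eq0.
exists (fun x => c x + (if meas x == (M - d.+1)%N then r x / A x x else 0)) => y yX ty.
under eq_bigr => x _ do rewrite mulrDl.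
rewrite big_split /=; have [e|ne] := eqVneq (meas y) (M - d.+1)%N.
  rewrite [X in _ + X](bigD1_seq y) //= e eqxx divfK ?A_diag //.
    rewrite [X in _ + (_ + X)]big_seq_cond [X in _ + (_ + X)]big1.
      by rewrite addr0 addrC subrK.
    move=> x /andP[xX xy]; case: eqP => [ex|_]; last by rewrite mul0r.
    have [->|nz] := eqVneq (A x y) 0; first by rewrite mulr0.
    by have := A_tri xX yX nz; rewrite eq_sym (negbTE xy) e ex ltnn.
rewrite [X in _ + X]big_seq [X in _ + X]big1 ?addr0.
  by apply: cP => //; lia.
move=> x xX; case: eqP => [ex|_]; last by rewrite mul0r.
have [->|nz] := eqVneq (A x y) 0; first by rewrite mulr0.
have /orP[/eqP e|lt] := A_tri xX yX nz; first by rewrite e ex eqxx in ne.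
by lia.
Qed.

(** If [c y] is nonzero, either some other [x] with [c x] nonzero enters the equation of [y], and
    [S] passes from [x] to [y], or the equation has the single term [c y * A y y] and [H y] is
    nonzero. *)
Lemma tri_supp (S : T -> Prop) (H c : T -> R) :
  {in X, forall y, H y = \sum_(x <- X) c x * A x y} ->
  {in X, forall y, H y != 0 -> S y} ->
  {in X &, forall x y, A x y != 0 -> S x -> S y} ->
  {in X, forall x, c x != 0 -> S x}.
Proof.
move=> HE HS SA.
pose M := (\sum_(x <- X) meas x).+1.
have ltM x : x \in X -> (meas x < M)%N.
  by move=> xX; rewrite ltnS (bigD1_seq x) //= leq_addr.
suff H0 d : {in X, forall y, (M - d <= meas y)%N -> c y != 0 -> S y}.
  by move=> y yX; apply: (H0 M); rewrite ?subnn.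
elim: d => [|d IH] y yX ty cy.
  by have := ltM y yX; rewrite subn0 in ty; lia.
have [/hasP[x xX /and3P[xy cx Axy]]|/hasPn none] :=
    boolP (has (fun x => [&& x != y, c x != 0 & A x y != 0]) X).
  apply: (SA _ _ xX yX Axy); apply: IH => //.
  by have := A_tri xX yX Axy; rewrite eq_sym (negbTE xy) /=; lia.
apply: HS => //; rewrite HE // (bigD1_seq y) //= big_seq_cond big1 ?addr0.
  by rewrite mulf_neq0 ?A_diag.
move=> x /andP[xX xy]; move: (none x xX); rewrite xy /= negb_and !negbK.
by case/orP => /eqP ->; rewrite ?mul0r ?mulr0.
Qed.

Lemma tri_inj (c : T -> R) :
  {in X, forall y, \sum_(x <- X) c x * A x y = 0} -> {in X, forall x, c x = 0}.
Proof.
move=> c0 x xX; apply/eqP/negP => /negP cx.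
have H : {in X, forall y, (fun=> 0) y = \sum_(x <- X) c x * A x y} by move=> y /c0 ->.
apply: (@tri_supp (fun=> False) _ _ H _ _ x xX cx) => // y _.
by rewrite eqxx.
Qed.

Lemma tri_inj2 (c c' : T -> R) :
  {in X, forall y, \sum_(x <- X) c x * A x y = \sum_(x <- X) c' x * A x y} ->
  {in X, c =1 c'}.
Proof.
move=> cc' x xX; apply/eqP; rewrite -subr_eq0; apply/eqP.
apply: (@tri_inj (fun x => c x - c' x)) xX => y yX.
under eq_bigr => z _ do rewrite mulrBl.
by rewrite sumrB cc' // subrr.
Qed.
End Triangular.

(** * Dominance order through excesses over a threshold *)

Section Dominance.
Local Open Scope nat_scope.
Implicit Types (s t : seq nat).

(** With truncated subtraction, this is the number of boxes in the columns beyond [c]. *)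
Definition cvx (c : nat) s := \sum_(x <- s) (x - c).
(* Dominance, in a form that ignores zeros and the order of the parts. *)
Definition domi s t := sumn s = sumn t /\ forall c, cvx c s <= cvx c t.
(** For a partition, [quad] and [nstat] are the classical [n(lambda')] and [n(lambda)]. The former
    ignores the order of the parts, the latter depends on it. *)
Definition quad s := \sum_(x <- s) 'C(x, 2).
Fixpoint nstat s := if s is k :: s' then nstat s' + sumn s' else 0.

Lemma domi_trans s t r : domi s t -> domi t r -> domi s r.
Proof. by move=> [e1 d1] [e2 d2]; split=> [|c]; [rewrite e1 | exact: leq_trans (d2 c)]. Qed.

Lemma cvx_perm c s t : perm_eq s t -> cvx c s = cvx c t.
Proof. exact: perm_big. Qed.

Lemma quad_perm s t : perm_eq s t -> quad s = quad t.
Proof. exact: perm_big. Qed.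

Lemma domi_perm s t : perm_eq s t -> domi s t.
Proof. by move=> st; split=> [|c]; rewrite ?(perm_sumn st) // (cvx_perm c st). Qed.

Lemma cvx_cons c x s : cvx c (x :: s) = x - c + cvx c s.
Proof. exact: big_cons. Qed.

Lemma cvx0 s : cvx 0 s = sumn s.
Proof. by rewrite sumnE; apply: eq_bigr => x _; rewrite subn0. Qed.

Lemma cvx_normp c s : cvx c (normp s) = cvx c s.
Proof.
rewrite /normp (cvx_perm c (permEl (perm_sort _ _))) /cvx big_filter.
by rewrite [RHS](bigID (fun x => x != 0)) /= [X in _ + X]big1 ?addn0 // => x; rewrite negbK => /eqP ->.
Qed.

Lemma sumn_normp s : sumn (normp s) = sumn s.
Proof. by rewrite -!cvx0 cvx_normp. Qed.

Lemma domi_normp s : domi s (normp s) /\ domi (normp s) s.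
Proof. by split; split=> [|c]; rewrite ?sumn_normp ?cvx_normp. Qed.

Lemma quad_cvx M s : sumn s <= M -> quad s = \sum_(1 <= c < M.+1) cvx c s.
Proof.
move=> sM; rewrite /cvx exchange_big /=; apply: eq_big_seq => x xs.
have xM : x <= M by rewrite (leq_trans _ sM) // (perm_sumn (perm_to_rem xs)) leq_addr.
elim: M {sM} xM => [|M IH] xM; first by rewrite (eqP (_ : x == 0)) ?big_geq // -leqn0.
rewrite big_nat_recr //=; have [xM'|] := leqP x M.
  by rewrite -IH // (eqP (_ : x - M.+1 == 0)) ?addn0 // subn_eq0.
move=> Mx; have {xM Mx} -> : x = M.+1 by lia.
rewrite subnn addn0 -bin2_sum [LHS]big_ltn // add0n [RHS]big_nat_rev /=.
by apply: eq_big_nat => i /andP[_ iM]; lia.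
Qed.

Lemma take_le_cvx c k s : sumn (take k s) <= k * c + cvx c s.
Proof.
elim: s k => [|x s IH] [|k] //=; rewrite cvx_cons mulSn.
by have := IH k; lia.
Qed.

(** The threshold equal to the part of index [k] makes the bound [take_le_cvx] an equality; partial
    sums and excesses are dual in this sense. *)
Lemma take_cvx s k : sorted geq s ->
  sumn (take k s) = k * nth 0 s k + cvx (nth 0 s k) s.
Proof.
elim: s k => [|x s IH] [|k] //=; rewrite ?mul0n ?muln0 ?/cvx ?big_nil //.
  move=> xs; rewrite big1_seq // => y /= ys; apply/eqP; rewrite subn_eq0.
  move: ys; rewrite inE => /predU1P[->//|ys].
  by move: xs; rewrite (path_sortedE geq_trans) => /andP[/allP/(_ _ ys)].
rewrite (path_sortedE geq_trans) => /andP[/allP xs ss].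
rewrite big_cons -/(cvx _ s) (IH k ss) mulSn.
have : nth 0 s k <= x.
  by have [ks|/(nth_default 0) ->//] := ltnP k (size s); apply: xs; rewrite mem_nth.
by lia.
Qed.

Lemma domi_take s t k : sorted geq t -> domi s t ->
  sumn (take k s) <= sumn (take k t).
Proof.
move=> st [_ dst]; rewrite (take_cvx k st).
by apply: leq_trans (take_le_cvx (nth 0 t k) k s) _; rewrite leq_add2l.
Qed.

Lemma domi_drop s t k : sorted geq t -> domi s t ->
  sumn (drop k t) <= sumn (drop k s).
Proof.
move=> st dst; have := domi_take k st dst; case: dst.
rewrite -{1}(cat_take_drop k s) -{1}(cat_take_drop k t) !sumn_cat; lia.
Qed.

Lemma take_domi s t : sorted geq s -> sumn s = sumn t ->
  (forall k, sumn (take k s) <= sumn (take k t)) -> domi s t.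
Proof.
move=> ss est st; split=> // c.
(* As [s] is sorted, [k] counts the parts larger than [c], the number for which [take_le_cvx] is
   sharp. *)
pose k := find (fun x => x <= c) s.
suff : k * c + cvx c s <= sumn (take k s).
  have := st k; have := take_le_cvx c k t; lia.
rewrite /k; elim: s ss {est st k} => [|x s IH] /=; first by rewrite /cvx big_nil.
rewrite (path_sortedE geq_trans) => /andP[/allP xs ss].
rewrite cvx_cons; case: (leqP x c) => [xc|cx] /=; last by rewrite mulSn; have := IH ss; lia.
rewrite mul0n add0n /cvx big1_seq ?addn0 => [|y /= ys]; first by lia.
by have := xs _ ys; rewrite /= ; lia.
Qed.

Lemma nstat_drop M s : size s <= M -> nstat s = \sum_(1 <= k < M) sumn (drop k s).
Proof.
elim: s M => [|x s IH] M /=; first by rewrite big1.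
case: M => // M sM; rewrite big_add1 /= (IH M sM).
case: M sM => [|M] sM; first by case: s sM {IH} => // _; rewrite !big_geq.
by rewrite [RHS]big_ltn // drop0 addnC.
Qed.

Lemma domi_nstat s t : sorted geq t -> domi s t -> nstat t <= nstat s.
Proof.
move=> st dst; rewrite (@nstat_drop (size s + size t) s) ?leq_addr //.
rewrite (@nstat_drop (size s + size t) t) ?leq_addl //.
by apply: leq_sum => k _; apply: domi_drop.
Qed.

Lemma domi_quad s t : domi s t -> quad s <= quad t.
Proof.
move=> [e d]; rewrite (@quad_cvx (sumn t)) ?e // (@quad_cvx (sumn t) t) //.
by apply: leq_sum.
Qed.

(** By [quad_cvx], equality of [quad] forces equality of every excess, and second differences of the
    excesses are the multiplicities of the positive parts. *)
Lemma domi_quad_eq s t : domi s t -> quad t <= quad s -> normp s = normp t.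
Proof.
move=> [e d] qts; suff ce c : cvx c s = cvx c t.
  apply/(perm_sortP geq_total geq_trans geq_anti)/allP => x _ /=; apply/eqP.
  rewrite !count_filter.
  case: x => [|x].
    have z r : count (predI (pred1 0) (fun x => x != 0)) r = 0.
      by elim: r => //= y r ->; case: y.
    by rewrite !z.
  have cnt r : count (predI (pred1 x.+1) (fun x => x != 0)) r + cvx x.+1 r + cvx x.+1 r = cvx x r + cvx x.+2 r.
    elim: r => [|y r IH]; first by rewrite /cvx !big_nil.
    by rewrite /= !cvx_cons; move: IH; case: (eqVneq y x.+1) => /=; lia.
  by have := cnt s; rewrite !ce -(cnt t) => /addIn/addIn.
case: c => [|c]; first by rewrite !cvx0.
have [cM|Mc] := ltnP c (sumn t); last first.
  suff z r : sumn r <= c.+1 -> cvx c.+1 r = 0 by rewrite !z ?e // leqW.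
  move=> rc; rewrite /cvx big1_seq // => y /= yr; apply/eqP; rewrite subn_eq0.
  by apply: leq_trans rc; rewrite (perm_sumn (perm_to_rem yr)) leq_addr.
apply/eqP; rewrite eqn_leq d /=; move: qts.
rewrite (@quad_cvx (sumn t)) // (@quad_cvx (sumn t) s) ?e //.
rewrite (bigD1_seq c.+1) ?mem_index_iota ?iota_uniq //=.
rewrite [X in _ <= X](bigD1_seq c.+1) ?mem_index_iota ?iota_uniq //=.
have : \sum_(1 <= i < (sumn t).+1 | i != c.+1) cvx i s <= \sum_(1 <= i < (sumn t).+1 | i != c.+1) cvx i t.
  by apply: leq_sum.
by lia.
Qed.

End Dominance.

(** * Monomial coefficients of a functional and the commutator with [p_1] *)

Section MonomialCoefficients.
Variables (R : realFieldType) (alpha : R).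
Hypothesis alpha_gt0 : 0 < alpha.
Implicit Types (w v u kap : seq nat) (phi psi : seq nat -> R).

Notation lapb := (laplace_beltrami alpha).
Notation eigv := (eigv alpha).
Notation iprod := (jack_iprod alpha).
Notation weight := (zweight alpha).
Notation powc := (@powc R).

(* The coefficient of [m_kap] in the symmetric function encoded by [phi]. *)
Definition mono_coef n phi kap : R := iprod n phi (fun w => powc w kap).
Notation mcf := mono_coef.

Lemma mcf_sym n phi : symf (mcf n phi).
Proof. by move=> s t st; apply: eq_iprod => // w _; apply: powc_symr. Qed.

Lemma part_n0 n lam : lam \in partitions n -> 0%N \notin lam.
Proof. by case/partP. Qed.

Lemma part_sumn n lam : lam \in partitions n -> sumn lam = n.
Proof. by case/partP. Qed.

Lemma part_sorted n lam : lam \in partitions n -> sorted geq lam.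
Proof. by case/partP. Qed.

Lemma mcf_cons0 n phi kap : mcf n phi (0%N :: kap) = mcf n phi kap.
Proof.
by apply: eq_iprod => // w /part_n0; apply: powc_rcons0.
Qed.

Lemma mcf_normp n phi kap : mcf n phi (normp kap) = mcf n phi kap.
Proof. by apply: stable_normp; [apply: mcf_sym | move=> t; apply: mcf_cons0]. Qed.
Lemma mcf_sumn n phi kap : mcf n phi kap != 0 -> sumn kap = n.
Proof.
move=> h; apply/eqP; apply: contraNT h => ne; apply/eqP.
rewrite /mcf /iprod big_seq big1 // => lam /part_sumn ln.
have [->|/powc_sumn e] := eqVneq (powc lam kap) 0; first by rewrite !mulr0.
by rewrite e ln eqxx in ne.
Qed.

Lemma mcf_lapb n phi kap : symf phi ->
  mcf n (lapb phi) kap = eigv kap * mcf n phi kap + raise (mcf n phi) kap.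
Proof.
move=> sp; rewrite /mcf iprod_lapb //; last exact: powc_syml.
rewrite (eq_iprod alpha (fun w _ => erefl (phi w)) (fun w _ => lapb_powc alpha kap w)).
rewrite iprodDr iprodZr; congr (_ + _).
rewrite /iprod /raise; under eq_bigr => lam _ do rewrite -!spairZ.
rewrite -spair_sum; apply: eq_spair => a b u _.
under eq_bigr => lam _ do rewrite !mulr_sumr.
rewrite exchange_big /=; apply: eq_bigr => r _; rewrite mulr_sumr.
by apply: eq_bigr => lam _; ring.
Qed.

Lemma mcf_rem1 n phi kap : symf phi ->
  alpha * mcf n.+1 (rem1 phi) kap =
  spick (fun y v => (0 < y)%:R * mcf n phi (y.-1 :: v)) kap.
Proof.
move=> sp; rewrite /mcf iprodC -iprod_add1 //; last exact: powc_syml.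
rewrite iprodC /iprod /add1 /=.
under [RHS]eq_spickT => y v do rewrite mulr_sumr.
rewrite spick_sum; apply: eq_bigr => lam _.
rewrite -!spickZ; apply: eq_spickT => y v; rewrite subn1; ring.
Qed.

(** The adjoint of [p_1] is [alpha d/dp_1], and since [p_k] of the variables [t, x] is
    [t^k + p_k(x)], this derivative extracts the coefficient of [t^1]. *)
Lemma mcf_add1 n phi kap : symf phi ->
  mcf n (add1 phi) kap = alpha * mcf n.+1 phi (1%N :: kap).
Proof.
move=> sp; rewrite /mcf iprod_add1 //; last exact: powc_syml.
congr (_ * _); apply: eq_iprod => // lam ln.
have := powc_euler R lam 1 kap; rewrite mul1r => ->.
apply: eq_spick => x v xv; case: x xv => [|[|x]] xv; rewrite ?mul0r ?mulr0 //.
rewrite mul1r subnn powc_rcons0; first by rewrite !mul1r.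
apply: contra (part_n0 ln) => v0.
by rewrite -(perm_mem xv) inE v0 orbT.
Qed.

(** In the variables, [sum_i i p_(i+1) d/dp_i] is [sum_j x_j^2 d/dx_j]. *)
Lemma mcf_downop n phi kap : symf phi ->
  mcf n.+1 (downop phi) kap =
  spick (fun y v => (0 < y)%:R * (y.-1%:R * mcf n phi (y.-1 :: v))) kap.
Proof.
move=> sp; rewrite /mcf iprodC -iprod_upop //; last exact: powc_syml.
rewrite iprodC /iprod /upop /=.
under [RHS]eq_spickT => y v do rewrite !mulr_sumr.
rewrite spick_sum; apply: eq_bigr => lam _.
under [X in _ * (_ * X) = _]eq_spickT => x v do rewrite -spickZ.
rewrite spick_exch -!spickZ; apply: eq_spickT => y v.
case: y => [|y].
  rewrite mul0r (@eq_spickT _ _ (fun _ _ => 0)) ?spick0 ?mulr0 // => x u.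
  by rewrite mul0r mulr0.
rewrite [X in _ * (_ * X)](_ : _ = y%:R * powc lam (y :: v)).
  by rewrite mul1r /=; ring.
by rewrite powc_euler; apply: eq_spickT.
Qed.

Lemma iprod_eq0 n phi : (forall psi, symf psi -> iprod n phi psi = 0) ->
  {in partitions n, forall lam, phi lam = 0}.
Proof.
move=> h lam ln; have := h (fun w => (perm_eq w lam)%:R).
have sd : symf (fun w => (perm_eq w lam)%:R : R) by move=> v v' /permPl ->.
move/(_ sd); rewrite /iprod (bigD1_seq lam) ?partitions_uniq //= perm_refl mulr1.
rewrite big_seq_cond big1 ?addr0 => [/eqP|mu /andP[mn ml]].
  by rewrite mulf_eq0 gt_eqF ?weight_gt0 ?(part_n0 ln) //= => /eqP.
case: (boolP (perm_eq mu lam)) => [/(part_perm_eq mn ln) e|_].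
  by rewrite e eqxx in ml.
by rewrite !mulr0.
Qed.

(** A letter 1 cannot be cut and has no diagonal term, so it is only joined to another letter [x],
    giving [x + 1]; the two orders of the pair compensate the factor [1/2]. *)
Lemma add1_lapb phi w : symf phi ->
  add1 (lapb phi) w = lapb (add1 phi) w + alpha * upop phi w.
Proof.
move=> sp; rewrite /add1 /laplace_beltrami /=.
pose body x v := (alpha - 1) * (x%:R * (x%:R - 1)) * phi [:: 1%N, x & v] +
   x%:R * (\sum_(1 <= a < x) phi [:: 1%N, a, (x - a)%N & v]) +
   alpha * (x%:R * spick (fun y u => y%:R * phi [:: 1%N, (x + y)%N & u]) v).
rewrite [X in _ + X](@eq_spickT _ _ (fun x v => body x v + alpha * (x%:R * phi (x.+1 :: v)))).
  rewrite spickD spickZ -/(upop phi w) subrr big_geq // -/body.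
  by field.
move=> x v; rewrite /body addn1.
rewrite (sp [:: x, 1%N & v] [:: 1%N, x & v]) ?(perm_catCA [:: x] [:: 1%N]) //.
have -> : \sum_(1 <= a < x) phi [:: a, (x - a)%N, 1%N & v] =
    \sum_(1 <= a < x) phi [:: 1%N, a, (x - a)%N & v].
  by apply: eq_bigr => a _; apply: sp; rewrite (perm_catCA [:: a; (x - a)%N] [:: 1%N]).
have -> : spick (fun y u => y%:R * phi [:: (x + y)%N, 1%N & u]) v =
    spick (fun y u => y%:R * phi [:: 1%N, (x + y)%N & u]) v.
  apply: eq_spickT => y u; congr (_ * _); apply: sp.
  by rewrite (perm_catCA [:: (x + y)%N] [:: 1%N]).
by ring.
Qed.

(** The adjoint of [add1_lapb]; nondegeneracy of the pairing makes it an identity of values at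
    partitions. *)
Lemma downopE n phi : symf phi ->
  {in partitions n.+1, forall lam,
     downop phi lam = lapb (rem1 phi) lam - rem1 (lapb phi) lam}.
Proof.
move=> sp lam ln; apply/eqP; rewrite eq_sym -subr_eq0; apply/eqP.
move: lam ln; apply: (@iprod_eq0 n.+1 (fun w => lapb (rem1 phi) w - rem1 (lapb phi) w - downop phi w)) => psi sps.
have E w : lapb (rem1 phi) w - rem1 (lapb phi) w - downop phi w =
   (lapb (rem1 phi) w + -1 * rem1 (lapb phi) w) + -1 * downop phi w by ring.
rewrite (eq_iprod alpha (fun w _ => E w) (fun w _ => erefl (psi w))).
rewrite 2!iprodDl !(iprodZl _ _ (-1)) iprod_lapb //; last exact: rem1_sym.
have step f g : symf f -> symf g -> alpha * iprod n.+1 (rem1 f) g = iprod n f (add1 g).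
  by move=> sf sg; rewrite iprodC -iprod_add1 // iprodC.
apply: (mulfI (lt0r_neq0 alpha_gt0)); rewrite mulr0 !mulrDr.
rewrite (mulrCA alpha (-1)) (mulrCA alpha (-1)) !step ?lapb_sym //; [|exact: lapb_sym..].
rewrite (eq_iprod alpha (fun w _ => erefl (phi w)) (fun w _ => add1_lapb w sps)).
rewrite iprodDr iprodZr iprod_lapb //; last exact: add1_sym.
rewrite [iprod n.+1 _ psi]iprodC -iprod_upop // [iprod n (upop psi) _]iprodC.
by ring.
Qed.

Lemma spick_neq0 (G : nat -> seq nat -> R) w :
  spick G w != 0 -> exists x v, perm_eq (x :: v) w /\ G x v != 0.
Proof.
elim: w G => [|k w IH] G /=; first by rewrite eqxx.
have [e|ne] := eqVneq (G k w) 0; last by exists k, w.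
rewrite e add0r => /IH[x [v [xv Gx]]]; exists x, (k :: v); split=> //.
by rewrite (perm_catCA [:: x] [:: k]) /= perm_cons.
Qed.

(** Each nonzero exponent is a sum of one or more letters of [w], and each letter is used once. This
    makes the matrix of the [powc] triangular for the number of parts. *)
Lemma powc_size w kap : 0%N \notin w -> powc w kap != 0 ->
  let nz := [seq x <- kap | x != 0%N] in
  (size nz <= size w)%N /\ (size nz = size w -> perm_eq nz w).
Proof.
elim: w kap => [|k w IH] kap.
  rewrite /= pnatr_eq0 eqb0 negbK => _ /allP all0.
  rewrite (eqP (_ : [seq x <- kap | x != 0%N] == [::])) //.
  by rewrite -size_eq0 size_filter -leqn0 leqNgt -has_count; apply/hasPn => x /all0 /eqP ->.
rewrite inE negb_or => /andP[k0 w0] /= /spick_neq0[y [v [yv]]].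
rewrite mulf_eq0 negb_or pnatr_eq0 eqb0 negbK => /andP[ky] /(IH _ w0)[].
have pf := perm_filter (fun x => x != 0%N) yv.
rewrite -(perm_size pf) -(permPl pf) /=.
have y0 : y != 0%N by lia.
rewrite y0 /=; case: eqVneq => [yk|yk] /= h1 h2; last by split; lia.
split=> [|e]; first by lia.
have <- : y = k by lia.
by rewrite perm_cons h2 //; lia.
Qed.

Lemma spick_ge0 (G : nat -> seq nat -> R) w :
  (forall x v, 0 <= G x v) -> 0 <= spick G w.
Proof.
elim: w G => [|k w IH] G G0 //=; by rewrite addr_ge0 ?G0 ?IH // => x v.
Qed.

Lemma powc_ge0 w kap : 0 <= powc w kap.
Proof.
elim: w kap => [|k w IH] kap /=; first exact: ler0n.
by apply: spick_ge0 => x v; rewrite mulr_ge0 ?ler0n.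
Qed.

Lemma powc_self w : 0%N \notin w -> 0 < powc w w.
Proof.
elim: w => [|k w IH] //; rewrite inE negb_or => /andP[_ w0] /=.
rewrite leqnn mul1r subnn powc_rcons0 // ltr_wpDr ?IH //.
by apply: spick_ge0 => x v; rewrite mulr_ge0 ?ler0n // powc_ge0.
Qed.

Lemma filter_n0 s : 0%N \notin s -> [seq x <- s | x != 0%N] = s.
Proof.
by move=> s0; apply/all_filterP/allP => x xs; apply: contraNneq s0 => <-.
Qed.

Lemma powc_tri n : {in partitions n &, forall x y,
  powc x y != 0 -> (y == x) || (size y < size x)%N}.
Proof.
move=> x y xn yn /(powc_size (part_n0 xn)) /=.
rewrite filter_n0 ?(part_n0 yn) // leq_eqVlt => -[/orP[/eqP e|->] h].
  by rewrite (part_perm_eq yn xn (h e)) eqxx.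
by rewrite orbT.
Qed.

Lemma powc_diag n : {in partitions n, forall x, powc x x != 0}.
Proof. by move=> x xn; rewrite gt_eqF // powc_self ?(part_n0 xn). Qed.

Lemma mcf_realize n (H : seq nat -> R) :
  exists2 phi, symf phi & {in partitions n, forall kap, mcf n phi kap = H kap}.
Proof.
have [c cP] := tri_solve (partitions_uniq n) (@powc_diag n) (@powc_tri n) H.
exists (fun w => c (normp w) / weight (normp w)).
  by move=> v v' /normp_perm ->.
move=> kap kn; rewrite cP //; apply: eq_big_seq => lam ln.
rewrite (normp_id ln) mulrA mulrCA divff ?mulr1 //.
by rewrite gt_eqF // weight_gt0 ?(part_n0 ln).
Qed.

Lemma mcf_inj n phi : {in partitions n, forall kap, mcf n phi kap = 0} ->
  {in partitions n, forall lam, phi lam = 0}.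
Proof.
move=> h lam ln.
have := @tri_inj _ _ _ _ _ (partitions_uniq n) (@powc_diag n) (@powc_tri n)
  (fun lam => weight lam * phi lam) _ lam ln.
have hw : {in partitions n, forall y,
  \sum_(x <- partitions n) weight x * phi x * powc x y = 0}.
  move=> y yn; rewrite -[RHS](h y yn); apply: eq_bigr => x _.
  by rewrite mulrA.
move=> /(_ hw) /eqP; rewrite mulf_eq0 gt_eqF ?weight_gt0 ?(part_n0 ln) //=.
by move/eqP.
Qed.

Lemma mcf_inj2 n phi psi :
  {in partitions n, forall kap, mcf n phi kap = mcf n psi kap} ->
  {in partitions n, phi =1 psi}.
Proof.
move=> h lam ln; apply/eqP; rewrite -subr_eq0; apply/eqP.
apply: (@mcf_inj n (fun w => phi w - psi w)) ln => kap kn.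
have E w : phi w - psi w = phi w + -1 * psi w by ring.
rewrite /mcf (eq_iprod alpha (fun w _ => E w) (fun w _ => erefl (powc w kap))).
by rewrite iprodDl iprodZl -/(mcf n phi kap) -/(mcf n psi kap) h //; ring.
Qed.

End MonomialCoefficients.

(** * Existence of dominance-triangular eigenfunctions *)

Section JackBasis.
Variables (R : realFieldType) (alpha : R).
Implicit Types (w v u kap lam gam del : seq nat) (phi psi F : seq nat -> R).

Notation lapb := (laplace_beltrami alpha).
Notation eigv := (eigv alpha).
Notation mcf := (mono_coef alpha).

Lemma eigvE kap : eigv kap = alpha * (quad kap)%:R - (nstat kap)%:R.
Proof.
elim: kap => [|k kap IH] /=; first by rewrite /quad big_nil; ring.
rewrite IH /quad big_cons -/(quad kap) !natrD.
have -> : (k%:R * (k%:R - 1)) = 2 * 'C(k, 2)%:R :> R.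
  elim: k => [|k IHk]; first by rewrite mul0r mulr0.
  by rewrite binS bin1 natrD [RHS]mulrDr -IHk -natr1; ring.
by field.
Qed.

Lemma quad_normp s : quad (normp s) = quad s.
Proof.
rewrite /normp (quad_perm (permEl (perm_sort _ _))) /quad big_filter.
rewrite [RHS](bigID (fun x => x != 0%N)) /= [X in (_ + X)%N]big1 ?addn0 // => x.
by rewrite negbK => /eqP ->.
Qed.

Lemma domi_quad_lt s t : domi s t -> normp s <> normp t -> (quad s < quad t)%N.
Proof.
by move=> d ne; rewrite ltnNge; apply/negP => /(domi_quad_eq d).
Qed.

Lemma sorted_pair (G H : nat -> nat -> seq nat -> R) w : sorted geq w ->
  (forall a b u, perm_eq [:: a, b & u] w -> (b <= a)%N -> G a b u = H a b u) ->
  spair G w = spair H w.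
Proof.
elim: w G H => //= k w IH G H kw eqGH.
have := kw; rewrite (path_sortedE geq_trans) => /andP[/allP kle sw]; congr (_ + _).
  apply: eq_spick => x v xv; apply: eqGH; rewrite ?perm_cons //.
  by apply: kle; rewrite -(perm_mem xv) mem_head.
apply: IH => // a b u abu; apply: eqGH.
rewrite -(perm_cons k) in abu; rewrite -(permPr abu).
by rewrite (perm_catCA [:: a; b] [:: k] u).
Qed.

Lemma raise_domi a b u r : (b <= a)%N -> (r <= b)%N ->
  domi [:: a, b & u] [:: (a + r)%N, (b - r)%N & u].
Proof.
move=> ba rb; split=> [|c]; first by rewrite /=; lia.
by rewrite !cvx_cons; lia.
Qed.

Lemma bin2D m p : ('C(m + p, 2) = 'C(m, 2) + 'C(p, 2) + m * p)%N.
Proof.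
elim: p => [|p IH]; first by rewrite addn0 muln0 !addn0.
by rewrite addnS !binS !bin1 IH; nia.
Qed.

Lemma bin2_raise a b r : (b <= a)%N -> (0 < r <= b)%N ->
  ('C(a, 2) + 'C(b, 2) < 'C(a + r, 2) + 'C(b - r, 2))%N.
Proof.
move=> ba /andP[r0 rb]; have {1}-> : b = (b - r + r)%N by lia.
by rewrite !bin2D; nia.
Qed.

Lemma raise_quad a b u r : (b <= a)%N -> (0 < r <= b)%N ->
  (quad [:: a, b & u] < quad [:: (a + r)%N, (b - r)%N & u])%N.
Proof.
by move=> ba rb; rewrite /quad !big_cons !addnA ltn_add2r; apply: bin2_raise.
Qed.

Lemma raise_eq0 F kap : sorted geq kap ->
  (forall t, size t = size kap -> domi kap t -> (quad kap < quad t)%N -> F t = 0) ->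
  raise F kap = 0.
Proof.
move=> sk F0; rewrite -[RHS](spair0 R kap); apply: sorted_pair => // a b u abu ba.
rewrite big_nat big1 // => r /andP[r0 rb]; rewrite F0 ?mulr0 //.
- by rewrite -(perm_size abu).
- apply: domi_trans (domi_perm _) (raise_domi _ ba _); last exact: rb.
  by rewrite perm_sym.
- by rewrite -(quad_perm abu); apply: raise_quad; rewrite ?r0.
Qed.

Lemma eq_raise F F' kap : 
  (forall t, size t = size kap -> sumn t = sumn kap -> F t = F' t) ->
  raise F kap = raise F' kap.
Proof.
move=> FF; apply: eq_spair => a b u abu.
rewrite big_nat [RHS]big_nat; apply: eq_bigr => r /andP[r0 rb].
rewrite FF // -?(perm_size abu) -?(perm_sumn abu) //=; lia.
Qed.

Hypothesis alpha_gt0 : 0 < alpha.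

(** Going up in dominance, [quad] increases strictly and [nstat] does not increase. Incomparable
    partitions can still have equal eigenvalues. *)
Lemma eigv_lt kap gam : sorted geq gam -> domi kap gam -> normp kap <> normp gam ->
  eigv kap < eigv gam.
Proof.
move=> sg d ne; rewrite !eigvE; apply: ltr_leD.
  by rewrite ltr_pM2l // ltr_nat domi_quad_lt.
by rewrite lerN2 ler_nat domi_nstat.
Qed.

(** [raise] only involves words of larger [quad]. Once [F] vanishes on those, the equation reads
    [(eigv gam - eigv kap) * F kap = 0], and the factor is nonzero because [kap] lies strictly below
    [gam]. *)
Lemma raise_uniq N gam F : sorted geq gam -> symf F ->
  (forall kap, size kap = N -> sumn kap = sumn gam -> sorted geq kap ->
     (eigv gam - eigv kap) * F kap = raise F kap) ->
  (forall kap, size kap = N -> sumn kap = sumn gam -> F kap != 0 -> domi kap gam) ->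
  (forall kap, size kap = N -> normp kap = normp gam -> F kap = 0) ->
  forall kap, size kap = N -> sumn kap = sumn gam -> F kap = 0.
Proof.
move=> sg sF Feq Fd F0 kap.
have [m] := ubnP (quad gam - quad kap)%N; elim: m kap => // m IH kap lem szk smk.
have pk := permEl (perm_sort geq kap); rewrite -(sF _ _ pk).
move: (sort geq kap) (sort_sorted geq_total kap) pk => s ss pk.
rewrite -(quad_perm pk) in lem; rewrite -(perm_size pk) in szk.
rewrite -(perm_sumn pk) in smk.
have [//|Fs] := eqVneq (F s) 0; apply/eqP.
have ds := Fd _ szk smk Fs.
have [e|/eqP ne] := eqVneq (normp s) (normp gam); first by rewrite F0.
have := Feq _ szk smk ss; rewrite raise_eq0 //.
  move/eqP; rewrite mulf_eq0 => /orP[|//].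
  by rewrite subr_eq0 eq_sym lt_eqF // eigv_lt.
move=> t st [smt _] qt; apply: IH; rewrite ?st // -?smt //.
by have := domi_quad_lt ds ne; lia.
Qed.

(* The monic Jack function [P_gam], by its eigenvalue equation and triangularity. *)
Definition jackf n gam phi : Prop :=
  [/\ symf phi, {in partitions n, forall lam, lapb phi lam = eigv gam * phi lam},
      forall kap, mcf n phi kap != 0 -> domi kap gam & mcf n phi gam = 1].

Lemma jackf_raise n gam phi kap : jackf n gam phi ->
  (eigv gam - eigv kap) * mcf n phi kap = raise (mcf n phi) kap.
Proof.
case=> sp ep _ _; have := mcf_lapb alpha_gt0 n kap sp.
rewrite [LHS](_ : _ = eigv gam * mcf n phi kap).
  by move=> e; rewrite mulrBl e; ring.
rewrite /mono_coef -iprodZl; exact: eq_iprod.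
Qed.

Lemma domi_part_lt n m kap gam : kap \in partitions n -> gam \in partitions m ->
  domi kap gam -> kap != gam -> (quad kap < quad gam)%N.
Proof.
move=> kn gn d; apply: contraNltn => q; apply/eqP.
by have := domi_quad_eq d q; rewrite (normp_id kn) (normp_id gn).
Qed.

Lemma raise_sum (I : Type) (r : seq I) (P : pred I) (F : I -> seq nat -> R) kap :
  raise (fun t => \sum_(i <- r | P i) F i t) kap = \sum_(i <- r | P i) raise (F i) kap.
Proof.
rewrite /raise -spair_sum; apply: eq_spair => a b u _.
rewrite exchange_big /=; apply: eq_bigr => q _.
by rewrite mulr_sumr.
Qed.

Lemma raiseZ c F kap : raise (fun t => c * F t) kap = c * raise F kap.
Proof.
rewrite /raise -spairZ; apply: eq_spair => a b u _.
by rewrite mulr_sumr; apply: eq_bigr => r _; ring.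
Qed.

Lemma raiseD F G kap : raise (fun t => F t + G t) kap = raise F kap + raise G kap.
Proof.
rewrite /raise -spairD; apply: eq_spair => a b u _.
by rewrite -big_split /=; apply: eq_bigr => r _; ring.
Qed.

Definition domb s t := (sumn s == sumn t) &&
  all (fun c => cvx c s <= cvx c t)%N (iota 0 (sumn s)).

Lemma dombP s t : reflect (domi s t) (domb s t).
Proof.
apply: (iffP andP) => [[/eqP e /allP d]|[e d]]; last first.
  by split; [exact/eqP | apply/allP => c _].
split=> // c; have [cs|sc] := ltnP c (sumn s); first by apply: d; rewrite mem_iota.
rewrite /cvx big1_seq // => x /= xs; apply/eqP; rewrite subn_eq0.
by apply: leq_trans sc; rewrite (perm_sumn (perm_to_rem xs)) leq_addr.
Qed.

Lemma jackf_exists n gam : gam \in partitions n -> exists phi, jackf n gam phi.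
Proof.
move=> gn.
pose X := [seq x <- partitions n | domb x gam && (x != gam)].
pose dl (x t : seq nat) : R := (normp t == x)%:R.
pose A (x y : seq nat) := (eigv gam - eigv y) * (x == y)%:R - raise (dl x) y.
have uX : uniq X by rewrite filter_uniq ?partitions_uniq.
have XP x : x \in X -> [/\ x \in partitions n, domi x gam & x != gam].
  by rewrite mem_filter => /andP[/andP[/dombP ? ?] ?].
have dl_neq0 x y : x \in partitions n -> y \in partitions n -> raise (dl x) y != 0 ->
    domi y x /\ (quad y < quad x)%N.
  move=> xn yn; have [/andP[/dombP ? ?] //|no] := boolP (domb y x && (quad y < quad x)%N).
  rewrite raise_eq0 ?eqxx //; first exact: part_sorted yn.
  move=> t _ dt qt; rewrite /dl; case: eqP => // e; case/negP: no; apply/andP; split.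
    by apply/dombP; apply: domi_trans dt _; rewrite -e; case: (domi_normp t).
  by rewrite -e quad_normp.
have Xlt x : x \in X -> (quad x < quad gam)%N.
  by case/XP => xn d ne; apply: domi_part_lt xn gn d ne.
have A_diag : {in X, forall x, A x x != 0}.
  move=> x xX; have [xn d ne] := XP _ xX.
  rewrite /A eqxx mulr1; have [->|/(dl_neq0 _ _ xn xn)[_]] := eqVneq (raise (dl x) x) 0; last by rewrite ltnn.
  rewrite subr0 subr_eq0 gt_eqF // eigv_lt ?(part_sorted gn) //.
  by rewrite (normp_id xn) (normp_id gn); apply/eqP.
have A_tri : {in X &, forall x y, A x y != 0 -> (y == x) || (quad y < quad x)%N}.
  move=> x y /XP[xn _ _] /XP[yn _ _]; rewrite /A.
  have [->|xy] := eqVneq x y; first by [].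
  rewrite mulr0 sub0r oppr_eq0 => /(dl_neq0 _ _ xn yn)[_ ->].
  by rewrite orbT.
have [c cP] := tri_solve uX A_diag A_tri (raise (dl gam)).
pose Hf t := dl gam t + \sum_(x <- X) c x * dl x t.
have [phi sp phiP] := mcf_realize alpha_gt0 n Hf.
have Hf_normp t : Hf (normp t) = Hf t.
  by rewrite /Hf /dl (normp_id (normp_partition t)).
have mcfE t : sumn t = n -> mcf n phi t = Hf t.
  by move=> tn; rewrite -mcf_normp phiP ?Hf_normp // -tn normp_partition.
have dl_part x y : y \in partitions n -> dl x y = (y == x)%:R.
  by move=> yn; rewrite /dl (normp_id yn).
have Hf_gam : Hf gam = 1.
  rewrite /Hf dl_part // eqxx big1_seq ?addr0 // => x /= /XP[_ _ ne].
  by rewrite dl_part // eq_sym (negbTE ne) mulr0.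
have HfX y : y \in partitions n -> Hf y != 0 -> y = gam \/ y \in X.
  move=> yn; have [//|yg] := eqVneq y gam; first by left.
  have [yX|yX] := boolP (y \in X); first by right.
  rewrite /Hf dl_part // (negbTE yg) add0r big1_seq ?eqxx // => x /= xX.
  by rewrite dl_part //; case: eqP => [e|]; rewrite ?mulr0 //; rewrite e xX in yX.
have key y : y \in partitions n -> (eigv gam - eigv y) * Hf y = raise Hf y.
  move=> yn; rewrite /Hf raiseD raise_sum.
  have [yX|yX] := boolP (y \in X).
    have [_ _ yg] := XP _ yX.
    rewrite cP // -big_split /= dl_part // (negbTE yg) add0r mulr_sumr.
    apply: eq_bigr => x _; rewrite raiseZ dl_part // /A eq_sym; ring.
  (* Outside [X], raising [y] reaches neither [gam] nor [X], so the right-hand side vanishes; on the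
     left either [y = gam] or [Hf y = 0]. *)
  have z x : x \in partitions n -> domi x gam -> raise (dl x) y = 0.
    move=> xn dx; apply/eqP; apply: contraNT yX => /(dl_neq0 _ _ xn yn)[dy qy].
    rewrite mem_filter yn andbT; apply/andP; split.
      by apply/dombP; apply: domi_trans dy dx.
    by apply: contraTneq qy => ->; rewrite -leqNgt; apply: domi_quad.
  rewrite z // add0r [RHS]big1_seq => [|x /= /XP[xn dx _]]; last by rewrite /= raiseZ z // mulr0.
  have [->|yg] := eqVneq y gam; first by rewrite subrr mul0r.
  rewrite -/(Hf y); have [->|/(HfX _ yn)[e|]] := eqVneq (Hf y) 0; first by rewrite mulr0.
    by rewrite e eqxx in yg.
  by rewrite (negbTE yX).
exists phi; split=> //.
- apply: (mcf_inj2 alpha_gt0) => kap kn.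
  rewrite (mcf_lapb alpha_gt0) // [RHS](_ : _ = eigv gam * mcf n phi kap); last first.
    by rewrite /mono_coef -iprodZl.
  rewrite (@eq_raise _ Hf) => [|t _ st]; last by rewrite mcfE // st (part_sumn kn).
  by rewrite -key // mcfE ?(part_sumn kn) //; ring.
- move=> kap h; have kn := mcf_sumn h.
  have nn : normp kap \in partitions n by rewrite -kn normp_partition.
  rewrite mcfE // -Hf_normp in h; apply: domi_trans (proj1 (domi_normp kap)) _.
  by have [->|/XP[]] := HfX _ nn h.
- by rewrite mcfE ?Hf_gam // (part_sumn gn).
Qed.
End JackBasis.

(** * Expansions in the eigenfunctions, and their uniqueness *)

Section JackExpansions.
Variables (R : realFieldType) (alpha : R).
Hypothesis alpha_gt0 : 0 < alpha.
Implicit Types (w v u kap lam gam del : seq nat) (phi psi F : seq nat -> R).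

Notation lapb := (laplace_beltrami alpha).
Notation eigv := (eigv alpha).
Notation mcf := (mono_coef alpha).
Notation jackf := (jackf alpha).

Lemma fin_choice (T : eqType) (U : Type) (u0 : U) (s : seq T) (Q : T -> U -> Prop) :
  {in s, forall x, exists y, Q x y} -> exists f, {in s, forall x, Q x (f x)}.
Proof.
elim: s => [|x s IH] h; first by exists (fun=> u0).
have [|f fP] := IH; first by move=> y ys; apply: h; rewrite inE ys orbT.
have [y Qy] := h x (mem_head _ _).
exists (fun z => if z == x then y else f z) => z; rewrite inE.
by have [->|_] := eqVneq z x => //= /fP.
Qed.

Definition jbasis n (P : seq nat -> seq nat -> R) :=
  {in partitions n, forall gam, jackf n gam (P gam)}.

Lemma jbasis_exists n : exists P, jbasis n P.
Proof. by apply: (fin_choice (fun=> 0)) => gam gn; apply: jackf_exists. Qed.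

Section Basis.
Variables (n : nat) (P : seq nat -> seq nat -> R).
Hypothesis Pn : jbasis n P.

Lemma jbasis_diag : {in partitions n, forall x, mcf n (P x) x != 0}.
Proof. by move=> x /Pn[_ _ _ ->]; exact: oner_neq0. Qed.

Lemma jbasis_tri : {in partitions n &, forall x y,
  mcf n (P x) y != 0 -> (y == x) || (quad y < quad x)%N}.
Proof.
move=> x y xn yn; have [_ _ d _] := Pn xn; move=> /d dyx.
by have [//|ne] := eqVneq y x; apply: domi_part_lt yn xn dyx ne.
Qed.

Lemma jbasis_expand (H : seq nat -> R) :
  exists c, {in partitions n, forall kap,
    H kap = \sum_(x <- partitions n) c x * mcf n (P x) kap}.
Proof. exact: (tri_solve (partitions_uniq n) jbasis_diag jbasis_tri H). Qed.

Lemma jbasis_inj (c c' : seq nat -> R) :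
  {in partitions n, forall kap, \sum_(x <- partitions n) c x * mcf n (P x) kap =
    \sum_(x <- partitions n) c' x * mcf n (P x) kap} -> {in partitions n, c =1 c'}.
Proof. exact: (tri_inj2 (partitions_uniq n) jbasis_diag jbasis_tri). Qed.

Lemma jbasis_supp (S : seq nat -> Prop) (H c : seq nat -> R) :
  (forall x y, domi y x -> S x -> S y) ->
  {in partitions n, forall kap, H kap = \sum_(x <- partitions n) c x * mcf n (P x) kap} ->
  {in partitions n, forall kap, H kap != 0 -> S kap} ->
  {in partitions n, forall x, c x != 0 -> S x}.
Proof.
move=> Sd HE HS; apply: (tri_supp (partitions_uniq n) jbasis_diag jbasis_tri HE HS).
by move=> x y xn _; have [_ _ d _] := Pn xn; move=> /d /Sd.
Qed.

Lemma mcf_lin (c : seq nat -> R) kap :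
  mcf n (fun w => \sum_(x <- partitions n) c x * P x w) kap =
  \sum_(x <- partitions n) c x * mcf n (P x) kap.
Proof.
rewrite /mono_coef iprod_suml; apply: eq_bigr => x _; exact: iprodZl.
Qed.

Lemma jbasis_fun (c : seq nat -> R) phi :
  {in partitions n, forall kap, mcf n phi kap = \sum_(x <- partitions n) c x * mcf n (P x) kap} ->
  {in partitions n, forall lam, phi lam = \sum_(x <- partitions n) c x * P x lam}.
Proof.
move=> h; apply: (mcf_inj2 alpha_gt0 (psi := fun w => \sum_(x <- partitions n) c x * P x w)).
by move=> kap kn; rewrite mcf_lin h.
Qed.

Lemma jbasis_mcf (c : seq nat -> R) phi kap :
  {in partitions n, forall lam, phi lam = \sum_(x <- partitions n) c x * P x lam} ->
  mcf n phi kap = \sum_(x <- partitions n) c x * mcf n (P x) kap.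
Proof. by move=> h; rewrite -mcf_lin; apply: eq_iprod. Qed.

Lemma jbasis_fun_expand phi :
  exists c, {in partitions n, forall lam, phi lam = \sum_(x <- partitions n) c x * P x lam}.
Proof.
by have [c cP] := jbasis_expand (mcf n phi); exists c; apply: jbasis_fun.
Qed.

Lemma lapb_expand phi (c : seq nat -> R) : symf phi ->
  {in partitions n, forall lam, phi lam = \sum_(x <- partitions n) c x * P x lam} ->
  {in partitions n, forall lam,
     lapb phi lam = \sum_(x <- partitions n) c x * eigv x * P x lam}.
Proof.
move=> sp h; apply: jbasis_fun => kap kn.
rewrite (mcf_lapb alpha_gt0) // (jbasis_mcf _ h).
have -> : raise (mcf n phi) kap = \sum_(x <- partitions n) c x * raise (mcf n (P x)) kap.
  rewrite (@eq_raise R _ (fun t => \sum_(x <- partitions n) c x * mcf n (P x) t) kap).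
    by rewrite raise_sum; apply: eq_bigr => x _; rewrite raiseZ.
  by move=> t _ _; apply: jbasis_mcf.
rewrite mulr_sumr -big_split /=; apply: eq_big_seq => x xn.
by rewrite -(jackf_raise alpha_gt0 kap (Pn xn)); ring.
Qed.

End Basis.

Lemma jackf_uniq n gam phi psi : gam \in partitions n ->
  jackf n gam phi -> jackf n gam psi -> forall kap, mcf n phi kap = mcf n psi kap.
Proof.
move=> gn jp jq kap; have [kn|kn] := eqVneq (sumn kap) n; last first.
  have z f : mcf n f kap = 0.
    by apply/eqP; apply: contraNT kn => /mcf_sumn ->.
  by rewrite !z.
apply/eqP; rewrite -subr_eq0; apply/eqP.
have := @raise_uniq R alpha alpha_gt0 (size kap) gam (fun t => mcf n phi t - mcf n psi t).
apply=> //; rewrite ?(part_sumn gn) ?(part_sorted gn) //.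
- by move=> s t st; rewrite (mcf_sym _ _ phi st) (mcf_sym _ _ psi st).
- move=> t _ _ _; rewrite mulrBr (jackf_raise alpha_gt0 t jp) (jackf_raise alpha_gt0 t jq).
  have E s : mcf n phi s - mcf n psi s = mcf n phi s + -1 * mcf n psi s by ring.
  by rewrite (@eq_raise R _ _ t (fun s _ _ => E s)) raiseD raiseZ; ring.
- move=> t _ _; case: jp jq => [_ _ dp _] [_ _ dq _].
  have [e|/dp //] := eqVneq (mcf n phi t) 0.
  by rewrite e sub0r oppr_eq0 => /dq.
- move=> t _ nt; rewrite -(mcf_normp _ _ phi t) -(mcf_normp _ _ psi t) nt (normp_id gn).
  by case: jp jq => [_ _ _ ->] [_ _ _ ->]; rewrite subrr.
Qed.

End JackExpansions.

(** * Slices of a Jack function by the exponent of one variable *)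

Section RowRemoval.
Variables (R : realFieldType) (alpha : R).
Implicit Types (w v u kap lam gam del g : seq nat) (phi psi F : seq nat -> R).

Notation lapb := (laplace_beltrami alpha).
Notation eigv := (eigv alpha).
Notation mcf := (mono_coef alpha).
Notation jackf := (jackf alpha).
Notation jbasis := (jbasis alpha).

Lemma part_consP n a g : (a :: g) \in partitions n ->
  [/\ (0 < a)%N, g \in partitions (n - a), n = (a + (n - a))%N & path geq a g].
Proof.
move=> gn; have /andP[a0 an] := part_le gn (mem_head a g).
have := part_rem gn (mem_head a g); rewrite /= eqxx => ->.
by split; rewrite ?subnKC //; exact: part_sorted gn.
Qed.

Lemma part_cons_in m a g : (0 < a)%N -> g \in partitions m -> path geq a g ->
  (a :: g) \in partitions (a + m).
Proof.
move=> a0 /partP[_ g0 gm] pg; apply/partP; rewrite /= gm; split=> //.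
by rewrite inE negb_or g0 andbT neq_ltn a0.
Qed.

Lemma path_head_ge a g x : path geq a g -> x \in g -> (x <= a)%N.
Proof.
by rewrite (path_sortedE geq_trans) => /andP[/allP h _] /h.
Qed.

Lemma cvx_head a g : path geq a g -> cvx a (a :: g) = 0%N.
Proof.
move=> pg; rewrite cvx_cons subnn add0n /cvx big1_seq // => x /= xg.
by apply/eqP; rewrite subn_eq0; apply: path_head_ge xg.
Qed.

Lemma domi_head a g t kap : path geq a g -> domi (t :: kap) (a :: g) -> (t <= a)%N.
Proof.
by move=> pg [_ /(_ a)]; rewrite (cvx_head pg) cvx_cons; lia.
Qed.

Lemma domi_cons a s t : domi (a :: s) (a :: t) <-> domi s t.
Proof.
split=> -[e d]; split=> [|c]; first by move: e => /=; lia.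
- by have := d c; rewrite !cvx_cons leq_add2l.
- by rewrite /= e.
- by rewrite !cvx_cons leq_add2l.
Qed.

Lemma raise_cons F a kap : symf F ->
  raise F (a :: kap) = spick (fun y u =>
     \sum_(1 <= r < y.+1) (a%:R - y%:R + 2 * r%:R) * F [:: (a + r)%N, (y - r)%N & u]) kap
   + raise (fun t => F (a :: t)) kap.
Proof.
move=> sF; congr (_ + _); apply: eq_spair => x y u _.
apply: eq_bigr => r _; congr (_ * _); apply: sF.
by rewrite (perm_catCA [:: (x + r)%N; (y - r)%N] [:: a]).
Qed.

Hypothesis alpha_gt0 : 0 < alpha.

Lemma mcf_row_gt n a g phi t kap : path geq a g -> jackf n (a :: g) phi ->
  (a < t)%N -> mcf n phi (t :: kap) = 0.
Proof.
move=> pg [_ _ d _] at_; apply/eqP; apply: contraTT at_ => /d /(domi_head pg).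
by rewrite -leqNgt.
Qed.

(** In the equation at [a :: t], raising the exponent [a] gives coefficients that vanish by
    [mcf_row_gt]. The slice therefore satisfies the equation of [g], and [raise_uniq] identifies it
    with [P_g]. *)
Lemma mcf_row_eq m a g phi psi : (0 < a)%N -> path geq a g -> g \in partitions m ->
  jackf (a + m) (a :: g) phi -> jackf m g psi ->
  forall kap, mcf (a + m) phi (a :: kap) = mcf m psi kap.
Proof.
move=> a0 pg gm jp jq kap; have [km|km] := eqVneq (sumn kap) m; last first.
  have -> : mcf m psi kap = 0 by apply/eqP; apply: contraNT km => /mcf_sumn ->.
  apply/eqP; apply: contraNT km => /mcf_sumn /= e.
  by apply/eqP; lia.
apply/eqP; rewrite -subr_eq0; apply/eqP.
pose F t := mcf (a + m) phi t; have sF : symf F := mcf_sym alpha _ phi.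
have := @raise_uniq R alpha alpha_gt0 (size kap) g (fun t => F (a :: t) - mcf m psi t).
apply=> //; rewrite ?(part_sumn gm) ?(part_sorted gm) //.
- move=> s t st; rewrite (mcf_sym _ _ psi st); congr (_ - _).
  by apply: sF; rewrite perm_cons.
- move=> t _ tm _; rewrite mulrBr (jackf_raise alpha_gt0 t jq).
  have := jackf_raise alpha_gt0 (a :: t) jp; rewrite raise_cons // -/(F _).
  rewrite (@eq_spick _ _ (fun _ _ => 0)) => [|y u _]; last first.
    rewrite big_nat big1 // => r /andP[r0 _].
    by rewrite (mcf_row_gt _ pg jp) ?mulr0 //; lia.
  rewrite spick0 add0r /= (part_sumn gm) tm => e.
  have E s : F (a :: s) - mcf m psi s = F (a :: s) + -1 * mcf m psi s by ring.
  rewrite (@eq_raise R _ _ t (fun s _ _ => E s)) raiseD raiseZ -e; ring.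
- move=> t _ _; case: jp jq => [_ _ dp _] [_ _ dq _].
  have [e|/dp /domi_cons //] := eqVneq (F (a :: t)) 0.
  by rewrite e sub0r oppr_eq0 => /dq.
- move=> t _ nt.
  have <- : F (a :: normp t) = F (a :: t).
    apply: (stable_normp (F := fun t => F (a :: t))) => [s s' ss'|s].
      by apply: sF; rewrite perm_cons.
    rewrite -[RHS](mcf_cons0 alpha); apply: sF.
    by rewrite (perm_catCA [:: a] [:: 0%N]).
  rewrite -(mcf_normp _ _ psi t) nt (normp_id gm).
  by case: jp jq => [_ _ _ e1] [_ _ _ e2]; rewrite /F e1 e2 subrr.
Qed.

Lemma jackf_word m g psi v : jackf m g psi -> 0%N \notin v -> sumn v = m ->
  lapb psi v = eigv g * psi v.
Proof.
move=> [sp ep _ _] v0 vm; have pv := perm_normp v0.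
rewrite -(lapb_sym alpha sp pv) -(sp _ _ pv) ep //.
by rewrite -vm normp_partition.
Qed.

Lemma rem1_lapb m g psi : jackf m g psi ->
  {in partitions m.+1, forall lam, rem1 (lapb psi) lam = eigv g * rem1 psi lam}.
Proof.
move=> jp lam ln; rewrite /rem1 -spickZ; apply: eq_spick => x v xv.
have [x1|_] := eqVneq x 1%N; last by rewrite !mul0r mulr0.
rewrite !mul1r (jackf_word jp) //.
  by apply: contra (part_n0 ln) => v0; rewrite -(perm_mem xv) inE v0 orbT.
by have := part_sumn ln; rewrite -(perm_sumn xv) x1 /= => -[].
Qed.

Lemma downop_expand m g psi Q b : jackf m g psi -> jbasis m.+1 Q ->
  {in partitions m.+1, forall lam,
     alpha * rem1 psi lam = \sum_(x <- partitions m.+1) b x * Q x lam} ->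
  {in partitions m.+1, forall lam, alpha * downop psi lam =
     \sum_(x <- partitions m.+1) b x * (eigv x - eigv g) * Q x lam}.
Proof.
move=> jp jQ bE lam ln; have [sp _ _ _] := jp.
rewrite (downopE alpha_gt0 sp ln) (rem1_lapb jp ln) mulrBr [alpha * (eigv g * _)]mulrCA bE //.
have a0 : alpha != 0 by rewrite gt_eqF.
have bE' : {in partitions m.+1, forall lam,
   rem1 psi lam = \sum_(x <- partitions m.+1) (alpha^-1 * b x) * Q x lam}.
  move=> t tn; apply: (mulfI a0); rewrite bE // mulr_sumr.
  by apply: eq_bigr => x _; field.
rewrite (lapb_expand alpha_gt0 jQ (rem1_sym sp) bE' ln) !mulr_sumr -sumrB.
by apply: eq_bigr => x _; field.
Qed.

(* The coefficient of [x_1^(a-1)] in [P_(a, g)]: the eigenvalue equation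
   expresses it through [p_1 P_g]. *)
Lemma mcf_row_sub m a g phi psi Q b : (0 < a)%N -> path geq a g -> g \in partitions m ->
  jackf (a + m) (a :: g) phi -> jackf m g psi -> jbasis m.+1 Q ->
  {in partitions m.+1, forall lam,
     alpha * rem1 psi lam = \sum_(x <- partitions m.+1) b x * Q x lam} ->
  exists2 s : seq nat -> R,
    {in partitions m.+1, forall kap, mcf (a + m) phi (a.-1 :: kap) =
       \sum_(x <- partitions m.+1) s x * mcf m.+1 (Q x) kap} &
    {in partitions m.+1, forall x,
       (alpha * a.-1%:R + 1 - (eigv x - eigv g)) * s x =
       (a%:R - alpha^-1 * (eigv x - eigv g)) * b x}.
move=> a0 pg gm jp jq jQ bE; have al0 : alpha != 0 by rewrite gt_eqF.
pose F t := mcf (a + m) phi t; have sF : symf F := mcf_sym alpha _ phi.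
have [sp _ _ _] := jq.
have [s sE] := jbasis_expand jQ (fun t => F (a.-1 :: t)); exists s => //.
apply: (jbasis_inj jQ) => kap kn.
have sE' t : sumn t = m.+1 -> F (a.-1 :: t) = \sum_(x <- partitions m.+1) s x * mcf m.+1 (Q x) t.
  move=> tm; have <- : F (a.-1 :: normp t) = F (a.-1 :: t).
    apply: (stable_normp (F := fun t => F (a.-1 :: t))) => [u u' uu'|u].
      by apply: sF; rewrite perm_cons.
    rewrite -[RHS](mcf_cons0 alpha); apply: sF.
    by rewrite (perm_catCA [:: a.-1] [:: 0%N]).
  by rewrite sE -?tm ?normp_partition //; apply: eq_bigr => x _; rewrite mcf_normp.
have SE : \sum_(x <- partitions m.+1) s x * (eigv x * mcf m.+1 (Q x) kap) =
   eigv kap * F (a.-1 :: kap) + raise (fun t => F (a.-1 :: t)) kap.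
  have e t : size t = size kap -> sumn t = sumn kap ->
      F (a.-1 :: t) = \sum_(x <- partitions m.+1) s x * mcf m.+1 (Q x) t.
    by move=> _ tk; rewrite sE' // tk (part_sumn kn).
  rewrite (eq_raise e) raise_sum (e kap) // mulr_sumr -big_split.
  apply: eq_big_seq => x xn /=; rewrite raiseZ -(jackf_raise alpha_gt0 kap (jQ x xn)).
  by ring.
have doneE : \sum_(x <- partitions m.+1) b x * mcf m.+1 (Q x) kap =
   spick (fun y v => (0 < y)%:R * mcf m psi (y.-1 :: v)) kap.
  rewrite -(mcf_rem1 alpha_gt0) // -(jbasis_mcf _ kap bE).
  exact: iprodZl.
have downE : \sum_(x <- partitions m.+1) b x * (eigv x - eigv g) * mcf m.+1 (Q x) kap =
   alpha * spick (fun y v => (0 < y)%:R * (y.-1%:R * mcf m psi (y.-1 :: v))) kap.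
  rewrite -(mcf_downop alpha) // -(jbasis_mcf _ kap (downop_expand jq jQ bE)).
  exact: iprodZl.
have := jackf_raise alpha_gt0 (a.-1 :: kap) jp; rewrite raise_cons // -/(F _) /=.
(* From exponent [a - 1] only [r = 1] survives, larger exponents exceeding the first row. Its factor
   [a - (y - 1)] produces [a] times [p_1 P_g] minus [sum_j x_j^2 d/dx_j] applied to [P_g]. *)
have -> : spick (fun y u => \sum_(1 <= r < y.+1) (a.-1%:R - y%:R + 2 * r%:R) *
     mcf (a + m) phi [:: (a.-1 + r)%N, (y - r)%N & u]) kap =
  a%:R * spick (fun y v => (0 < y)%:R * mcf m psi (y.-1 :: v)) kap -
  spick (fun y v => (0 < y)%:R * (y.-1%:R * mcf m psi (y.-1 :: v))) kap.
  rewrite -spickZ -spickB; apply: eq_spickT => -[|y] u.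
    by rewrite big_geq // !mul0r mulr0 subrr.
  rewrite big_ltn // big_nat big1 ?addr0 => [|r /andP[r1 _]].
    rewrite addn1 prednK // subn1 /= (mcf_row_eq a0 pg gm jp jq) !mul1r.
    by rewrite -[in RHS](prednK a0) -!natr1; ring.
  by rewrite (mcf_row_gt _ pg jp) ?mulr0 //; lia.
rewrite -doneE => e.
transitivity ((alpha * a.-1%:R + 1 + eigv g) * F (a.-1 :: kap) -
    \sum_(x <- partitions m.+1) s x * (eigv x * mcf m.+1 (Q x) kap)).
  by rewrite sE // mulr_sumr -sumrB; apply: eq_bigr => x _; ring.
transitivity (a%:R * \sum_(x <- partitions m.+1) b x * mcf m.+1 (Q x) kap -
   alpha^-1 * \sum_(x <- partitions m.+1) b x * (eigv x - eigv g) * mcf m.+1 (Q x) kap); last first.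
  by rewrite !mulr_sumr -sumrB; apply: eq_bigr => x _; ring.
rewrite downE mulKf // SE; move: e; rewrite -/(F _) (part_sumn kn) (part_sumn gm).
move: (spick _ kap) (raise _ kap) (F _) (\sum_(_ <- _) _) => X1 X2 X3 X4.
have ha : a%:R = a.-1%:R + 1 :> R by rewrite natr1 prednK.
move=> e; have -> : a%:R * X4 - X1 = (a%:R * X4 - X1 + X2) - X2 by ring.
by rewrite -e ha -natr1; field.
Qed.

End RowRemoval.

(** * Multiplication by [p_1] compared before and after removing the first row *)

Section RowRemoval.
Variables (R : realFieldType) (alpha : R).
Hypothesis alpha_gt0 : 0 < alpha.
Implicit Types (w v u kap lam gam del g : seq nat) (phi psi F : seq nat -> R).

Notation eigv := (eigv alpha).
Notation mcf := (mono_coef alpha).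
Notation jackf := (jackf alpha).
Notation jbasis := (jbasis alpha).

Lemma rem1_expand_mcf m phi Q b kap : symf phi ->
  {in partitions m.+1, forall lam,
     alpha * rem1 phi lam = \sum_(x <- partitions m.+1) b x * Q x lam} ->
  \sum_(x <- partitions m.+1) b x * mcf m.+1 (Q x) kap =
  spick (fun y v => (0 < y)%:R * mcf m phi (y.-1 :: v)) kap.
Proof.
move=> sp bE; rewrite -(mcf_rem1 alpha_gt0) // -(jbasis_mcf _ kap bE).
exact: iprodZl.
Qed.

Lemma rem1_supp m a g phi Q b : path geq a g -> jackf m (a :: g) phi -> jbasis m.+1 Q ->
  {in partitions m.+1, forall lam,
     alpha * rem1 phi lam = \sum_(x <- partitions m.+1) b x * Q x lam} ->
  {in partitions m.+1, forall x, b x != 0 -> domi x (a.+1 :: g)}.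
Proof.
move=> pg jp jQ bE; have [sp _ d _] := jp.
apply: (jbasis_supp jQ (H := fun kap => spick (fun y v => (0 < y)%:R * mcf m phi (y.-1 :: v)) kap)).
- by move=> x y; apply: domi_trans.
- by move=> kap _; rewrite -(rem1_expand_mcf _ sp bE).
move=> kap _ /spick_neq0[y [v [yv]]]; rewrite mulf_eq0 negb_or pnatr_eq0 eqb0 negbK.
case/andP=> y0 /d dy; have yle := domi_head pg dy; case: dy => e dc.
apply: (domi_trans (domi_perm (t := y :: v) _)); first by rewrite perm_sym.
split=> [|c]; first by move: e => /=; lia.
by have := dc c; rewrite !cvx_cons; lia.
Qed.

(** Only first rows equal to [a] contribute: shorter ones do not reach the exponent [a], and longer
    ones are excluded by the support of [c]. *)
Lemma row_slice m a P P' (c : seq nat -> R) kap : (0 < a)%N ->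
  jbasis (a + m) P -> jbasis m P' ->
  {in partitions (a + m), forall x, c x != 0 -> (head 0 x <= a)%N} ->
  \sum_(x <- partitions (a + m)) c x * mcf (a + m) (P x) (a :: kap) =
  \sum_(x <- partitions m) (path geq a x)%:R * c (a :: x) * mcf m (P' x) kap.
Proof.
move=> a0 jP jP' csupp.
transitivity (\sum_(x <- [seq a :: y | y <- partitions m & path geq a y])
    c x * mcf (a + m) (P x) (a :: kap)); last first.
  rewrite big_map big_filter big_mkcond; apply: eq_big_seq => x xm /=.
  have [pax|_] := boolP (path geq a x); last by rewrite !mul0r.
  have aP := part_cons_in a0 xm pax.
  by rewrite (mcf_row_eq alpha_gt0 a0 pax xm (jP _ aP) (jP' _ xm)) mul1r.
rewrite (bigID (fun x => head 0%N x == a)) /= [X in _ + X]big_seq_cond.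
rewrite [X in _ + X]big1 ?addr0 => [|x /andP[xn xa]]; last first.
  case: x xn xa => [|d g] xn /= da.
    by have := part_sumn xn; rewrite /=; lia.
  have [->|/(csupp _ xn) /= dle] := eqVneq (c (d :: g)) 0; first by rewrite mul0r.
  have [_ _ _ pg] := part_consP xn.
  by rewrite (mcf_row_gt _ pg (jP _ xn)) ?mulr0 //; lia.
rewrite -big_filter; apply: perm_big; apply: uniq_perm.
- by rewrite filter_uniq // partitions_uniq.
- by rewrite map_inj_uniq ?filter_uniq ?partitions_uniq // => x y [].
move=> x; rewrite mem_filter; apply/andP/mapP => [[/eqP xa xn]|[y]].
  case: x xa xn => [|d g] /= da xn; first by rewrite -da in a0.
  rewrite da in xn *; have [_ gm _ pg] := part_consP xn.
  by exists g => //; rewrite mem_filter pg; rewrite addKn in gm.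
by rewrite mem_filter => /andP[pay ym] ->; rewrite eqxx part_cons_in.
Qed.

(** Compare coefficients of [x_1^(a+1)]: in [p_1 P_(a, g)] they arise only from [x_1] times [x_1^a],
    which leaves [P_g]. *)
Lemma row_top m a g phi Q b : (0 < a)%N -> path geq a g -> g \in partitions m ->
  jackf (a + m) (a :: g) phi -> jbasis (a.+1 + m) Q ->
  {in partitions (a + m).+1, forall lam,
     alpha * rem1 phi lam = \sum_(x <- partitions (a + m).+1) b x * Q x lam} ->
  {in partitions m, forall x, path geq a.+1 x -> b (a.+1 :: x) = (x == g)%:R}.
Proof.
move=> a0 pg gm jp jQ bE x xm px; have [sp _ _ _] := jp.
have [P' jP'] := jbasis_exists alpha_gt0 m.
have bsupp : {in partitions (a.+1 + m), forall x, b x != 0 -> (head 0 x <= a.+1)%N}.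
  move=> y yn /(rem1_supp pg jp jQ bE yn).
  have pg' : path geq a.+1 g by exact: path_geqS pg.
  by case: y yn => // d s _ /(domi_head pg').
have h : {in partitions m, forall kap,
   \sum_(x <- partitions m) (path geq a.+1 x)%:R * b (a.+1 :: x) * mcf m (P' x) kap =
   \sum_(x <- partitions m) (x == g)%:R * mcf m (P' x) kap}.
  move=> kap km; rewrite -(row_slice kap _ jQ jP' bsupp) //.
  rewrite (rem1_expand_mcf _ sp bE) /= mul1r.
  rewrite [X in _ + X](@eq_spickT _ _ (fun _ _ => 0)) ?spick0 ?addr0; last first.
    move=> y v; rewrite (mcf_sym _ _ phi (_ : perm_eq _ [:: a.+1, y.-1 & v])).
      by rewrite (mcf_row_gt _ pg jp) ?mulr0.
    by rewrite (perm_catCA [:: _] [:: _] v).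
  rewrite (mcf_row_eq alpha_gt0 a0 pg gm jp (jP' _ gm)).
  rewrite (bigD1_seq g) ?partitions_uniq //= eqxx mul1r big1 ?addr0 // => y /negbTE ->.
  by rewrite mul0r.
by have := jbasis_inj jP' h xm; rewrite px mul1r.
Qed.

(* If [p_1 P_g] has no component on [x], then [p_1 P_(a, g)] has none on [(a, x)]. *)
Lemma row_main m a g phi psi Q Q' c b x : (0 < a)%N -> path geq a g -> g \in partitions m ->
  jackf (a + m) (a :: g) phi -> jackf m g psi ->
  jbasis (a + m).+1 Q -> jbasis m.+1 Q' ->
  {in partitions (a + m).+1, forall lam,
     alpha * rem1 phi lam = \sum_(x <- partitions (a + m).+1) c x * Q x lam} ->
  {in partitions m.+1, forall lam,
     alpha * rem1 psi lam = \sum_(x <- partitions m.+1) b x * Q' x lam} ->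
  x \in partitions m.+1 -> path geq a x ->
  alpha * a.-1%:R + 1 - (eigv x - eigv g) != 0 ->
  alpha * a%:R + 1 - (eigv x - eigv g) != 0 ->
  b x = 0 -> c (a :: x) = 0.
Proof.
move=> a0 pg gm jp jq jQ jQ' cE bE xm px ne1 ne2 bx.
have pg' : path geq a.+1 g by exact: path_geqS pg.
have gpn : (a.+1 :: g) \in partitions (a + m).+1 := @part_cons_in m a.+1 g isT gm pg'.
have [sp _ _ _] := jp; have [sq _ _ _] := jq.
have [s sE sx] := mcf_row_sub alpha_gt0 a0 pg gm jp jq jQ' bE.
have [t tE tx] := @mcf_row_sub R alpha alpha_gt0 m a.+1 g _ _ _ _ isT pg' gm
  (jQ _ gpn) jq jQ' bE.
have sx0 : s x = 0.
  by move: (sx _ xm); rewrite bx mulr0 => /eqP; rewrite mulf_eq0 (negbTE ne1) => /eqP.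
have tx0 : t x = 0.
  by move: (tx _ xm); rewrite bx mulr0 => /eqP; rewrite mulf_eq0 (negbTE ne2) => /eqP.
have csupp : {in partitions (a + m).+1, forall x, c x != 0 -> (head 0 x <= a.+1)%N}.
  move=> y yn /(rem1_supp pg jp jQ cE yn).
  by case: y yn => // d r _ /(domi_head pg').
pose c1 y := if (head 0%N y <= a)%N then c y else 0.
have c1supp : {in partitions (a + m.+1), forall x, c1 x != 0 -> (head 0 x <= a)%N}.
  by move=> y _; rewrite /c1; case: ifP => //; rewrite eqxx.
have jQ2 : jbasis (a + m.+1) Q by rewrite addnS.
(* Take the coefficient of [x_1^a] in [p_1 P_(a, g)]. Multiplying by [x_1] gives [s] and by the
   other variables [b]. In the expansion, first rows [a] give [c1], while first rows [a + 1] reduce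
   to [(a + 1, g)] with coefficient 1, whose slice is [t]. *)
have h : {in partitions m.+1, forall kap,
   \sum_(y <- partitions m.+1) ((path geq a y)%:R * c1 (a :: y)) * mcf m.+1 (Q' y) kap =
   \sum_(y <- partitions m.+1) (s y + b y - t y) * mcf m.+1 (Q' y) kap}.
  move=> kap km.
  rewrite -(row_slice kap a0 jQ2 jQ' c1supp) addnS.
  have split : \sum_(y <- partitions (a + m).+1) c y * mcf (a + m).+1 (Q y) (a :: kap) =
     \sum_(y <- partitions (a + m).+1) c1 y * mcf (a + m).+1 (Q y) (a :: kap) +
     mcf (a + m).+1 (Q (a.+1 :: g)) (a :: kap).
    transitivity (\sum_(y <- partitions (a + m).+1) (c1 y + (y == a.+1 :: g)%:R) *
        mcf (a + m).+1 (Q y) (a :: kap)); last first.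
      under eq_bigr => y _ do rewrite mulrDl.
      rewrite big_split /=; congr (_ + _).
      rewrite (bigD1_seq (a.+1 :: g)) ?partitions_uniq //= eqxx mul1r big1 ?addr0 //.
      by move=> y /negbTE ->; rewrite mul0r.
    apply: eq_big_seq => y yn; congr (_ * _).
    have {}csupp := csupp _ yn.
    case: y yn csupp => [|d r] yn csupp; first by have := part_sumn yn.
    rewrite /c1 /=; case: leqP => [da|ad].
      have -> : (d :: r == a.+1 :: g) = false by rewrite eqseq_cons ltn_eqF.
      by rewrite addr0.
    rewrite add0r; have [ed|ne] := eqVneq d a.+1.
      move: yn; rewrite ed => yn; have [_ rm _ pr] := part_consP yn.
      rewrite -addSn addKn in rm.
      by rewrite (row_top a0 pg gm jp jQ cE rm pr) eqseq_cons eqxx.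
    rewrite eqseq_cons (negbTE ne) /=; apply/eqP; apply: contraTT ad => /csupp /=.
    by rewrite -leqNgt; move: ne; case: ltngtP => //; lia.
  move: split; rewrite (rem1_expand_mcf _ sp cE) /= a0 mul1r sE // tE //.
  have -> : spick (fun y v => (0 < y)%:R * mcf (a + m) phi [:: y.-1, a & v]) kap =
     \sum_(y <- partitions m.+1) b y * mcf m.+1 (Q' y) kap.
    rewrite (rem1_expand_mcf _ sq bE); apply: eq_spickT => y v; congr (_ * _).
    rewrite -(mcf_row_eq alpha_gt0 a0 pg gm jp jq); apply: mcf_sym.
    by rewrite (perm_catCA [:: _] [:: _] v).
  move/eqP; rewrite -subr_eq => /eqP <-.
  by rewrite -big_split -sumrB; apply: eq_bigr => y _ /=; ring.
have := jbasis_inj jQ' h xm; rewrite px mul1r sx0 tx0 bx addr0 subr0.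
by rewrite /c1 /= leqnn.
Qed.

Lemma row_top_in n a g phi Q b x : (a :: g) \in partitions n ->
  jackf n (a :: g) phi -> jbasis n.+1 Q ->
  {in partitions n.+1, forall lam,
     alpha * rem1 phi lam = \sum_(x <- partitions n.+1) b x * Q x lam} ->
  (a.+1 :: x) \in partitions n.+1 -> b (a.+1 :: x) = (x == g)%:R.
Proof.
move=> agn; have [a0 gm en pg] := part_consP agn.
move: (n - a)%N gm en => m gm en {agn}; subst n => jp jQ bE axn.
have [_ xm _ px] := part_consP axn; rewrite -addSn addKn in xm.
exact: (row_top a0 pg gm jp jQ bE xm px).
Qed.

Lemma row_main_in n a g phi psi Q Q' c b x : (a :: g) \in partitions n ->
  jackf n (a :: g) phi -> jackf (n - a) g psi ->
  jbasis n.+1 Q -> jbasis (n - a).+1 Q' ->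
  {in partitions n.+1, forall lam,
     alpha * rem1 phi lam = \sum_(x <- partitions n.+1) c x * Q x lam} ->
  {in partitions (n - a).+1, forall lam,
     alpha * rem1 psi lam = \sum_(x <- partitions (n - a).+1) b x * Q' x lam} ->
  (a :: x) \in partitions n.+1 ->
  alpha * a.-1%:R + 1 - (eigv x - eigv g) != 0 ->
  alpha * a%:R + 1 - (eigv x - eigv g) != 0 ->
  c (a :: x) != 0 -> b x != 0.
Proof.
move=> agn; have [a0 gm en pg] := part_consP agn.
move: (n - a)%N gm en => m gm en {agn}; subst n => jp jq jQ jQ' cE bE axn ne1 ne2.
have [_ xm _ px] := part_consP axn; rewrite -addnS addKn in xm.
apply: contraNneq => bx; apply/eqP.
exact: (row_main a0 pg gm jp jq jQ jQ' cE bE xm px).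
Qed.

End RowRemoval.

(** * Transfer of orthogonality to smaller degrees *)

Section Orthogonality.
Variables (R : realFieldType) (alpha : R).
Hypothesis alpha_gt0 : 0 < alpha.
Implicit Types (w v u kap lam gam del g : seq nat) (phi psi F : seq nat -> R).

Notation eigv := (eigv alpha).
Notation iprod := (jack_iprod alpha).
Notation weight := (zweight alpha).
Notation mcf := (mono_coef alpha).
Notation jackf := (jackf alpha).
Notation jbasis := (jbasis alpha).

Definition orthl n := forall P, jbasis n P ->
  {in partitions n &, forall x y, x != y -> iprod n (P x) (P y) = 0}.

Lemma iprod_self_eq0 n phi : iprod n phi phi = 0 ->
  {in partitions n, forall lam, phi lam = 0}.
Proof.
have w0 s : 0 <= weight s by rewrite invr_ge0 mulr_ge0 ?ler0n ?exprn_ge0 ?ltW.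
move=> /eqP; rewrite /jack_iprod psumr_eq0 => [/allP h lam ln|lam _].
  have /= := h lam ln; rewrite -expr2 mulf_eq0 gt_eqF ?weight_gt0 ?(part_n0 ln) //=.
  by rewrite expf_eq0 /= => /eqP.
by rewrite mulr_ge0 // -expr2 sqr_ge0.
Qed.

Lemma jackf_neq0 n x phi : jackf n x phi -> iprod n phi phi != 0.
Proof.
move=> [_ _ _ e]; apply/eqP => /iprod_self_eq0 h; move/eqP: e.
rewrite /mono_coef /jack_iprod big_seq big1 => [|lam /h ->]; last by rewrite mul0r mulr0.
by rewrite eq_sym oner_eq0.
Qed.

Lemma iprod_eigv n x y phi psi : jackf n x phi -> jackf n y psi ->
  eigv x != eigv y -> iprod n phi psi = 0.
Proof.
move=> [sp ep _ _] [sq eq _ _] ne.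
have := iprod_lapb alpha_gt0 n sp sq.
rewrite (eq_iprod alpha ep (fun w _ => erefl (psi w))) iprodZl.
rewrite (eq_iprod alpha (fun w _ => erefl (phi w)) eq) iprodZr.
move/eqP; rewrite -subr_eq0 -mulrBl mulf_eq0 subr_eq0 (negbTE ne) /=.
by move/eqP.
Qed.

Lemma eigv_rcons1 s : eigv (rcons s 1%N) = eigv s - (size s)%:R.
Proof.
elim: s => [|k s IH] /=; first by ring.
by rewrite IH sumn_rcons natrD -[(size s).+1%:R]natr1; ring.
Qed.

Lemma jackf_uniq_in n x phi psi : x \in partitions n ->
  jackf n x phi -> jackf n x psi -> {in partitions n, phi =1 psi}.
Proof.
move=> xn jp jq; apply: (mcf_inj2 alpha_gt0) => kap _.
exact: (jackf_uniq alpha_gt0 xn jp jq).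
Qed.

Lemma part_rcons1 n x : x \in partitions n -> rcons x 1%N \in partitions n.+1.
Proof.
move=> /partP[sx x0 sn]; apply/partP; split.
- case: x sx x0 {sn} => //= a g; rewrite rcons_path => -> /= => a0.
  by rewrite lt0n; apply: contra a0 => /eqP <-; apply: mem_last.
- by rewrite mem_rcons inE negb_or x0.
- by rewrite sumn_rcons sn addn1.
Qed.

Lemma coef_iprod n phi Q c y : orthl n.+1 -> symf phi -> jbasis n.+1 Q ->
  {in partitions n.+1, forall lam,
     alpha * rem1 phi lam = \sum_(x <- partitions n.+1) c x * Q x lam} ->
  y \in partitions n.+1 ->
  iprod n phi (add1 (Q y)) = c y * iprod n.+1 (Q y) (Q y).
Proof.
move=> orth sp jQ cE yn; have [sQ _ _ _] := jQ _ yn.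
rewrite iprodC iprod_add1 // iprodC -iprodZl.
rewrite (eq_iprod alpha cE (fun w _ => erefl (Q y w))) iprod_suml.
rewrite (bigD1_seq y) ?partitions_uniq //= iprodZl big_seq_cond big1 ?addr0 //.
by move=> z /andP[zn zy]; rewrite iprodZl orth ?mulr0.
Qed.

Lemma mcf_add1_supp n y phi kap : jackf n.+1 y phi -> mcf n (add1 phi) kap != 0 ->
  domi (1%N :: kap) y.
Proof.
move=> [sp _ d _]; rewrite (mcf_add1 alpha_gt0) // mulf_eq0 negb_or.
by case/andP=> _ /d.
Qed.

(** The adjoint of [p_1] sends the Jack function of [rcons y 1] to [alpha P_y] plus terms strictly
    below [y]. Their eigenvalues are smaller than [eigv y = eigv x], so they are orthogonal to
    [P_x], and the coefficient [c] is a nonzero multiple of the pairing of [P_x] and [P_y]. *)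
Lemma orth_coef n x y phi psi Q c : orthl n.+1 ->
  x \in partitions n -> y \in partitions n -> eigv x = eigv y ->
  jackf n x phi -> jackf n y psi -> jbasis n.+1 Q ->
  {in partitions n.+1, forall lam,
     alpha * rem1 phi lam = \sum_(z <- partitions n.+1) c z * Q z lam} ->
  iprod n phi psi != 0 -> c (rcons y 1%N) != 0.
Proof.
move=> orth xn yn exy jp jq jQ cE; apply: contraNneq => c0.
have y1n := part_rcons1 yn; have [sp _ _ _] := jp.
have [P jP] := jbasis_exists alpha_gt0 n.
have [b bE] := jbasis_fun_expand alpha_gt0 jP (add1 (Q (rcons y 1%N))).
have y1p : perm_eq (rcons y 1%N) (1%N :: y) by rewrite perm_rcons.
have bsupp : {in partitions n, forall z, b z != 0 -> domi z y}.
  apply: (jbasis_supp jP (H := mcf n (add1 (Q (rcons y 1%N))))).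
  - by move=> u v; apply: domi_trans.
  - by move=> kap _; apply: jbasis_mcf.
  move=> kap _ /(mcf_add1_supp (jQ _ y1n)) d; apply/domi_cons.
  by apply: domi_trans d (domi_perm y1p).
have by_ : b y = alpha.
  have := jbasis_mcf alpha y bE; rewrite (mcf_add1 alpha_gt0) ?(proj1 (jQ _ y1n)); last first.
    by case: (jQ _ y1n).
  rewrite -(mcf_sym _ _ (Q (rcons y 1%N)) y1p); case: (jQ _ y1n) => [_ _ _ ->].
  rewrite mulr1 (bigD1_seq y) ?partitions_uniq //=; case: (jP _ yn) => [_ _ _ ->].
  rewrite mulr1 big_seq_cond big1 ?addr0 // => z /andP[zn zy].
  have [->|bz] := eqVneq (b z) 0; first by rewrite mul0r.
  have [->|mz] := eqVneq (mcf n (P z) y) 0; first by rewrite mulr0.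
  have [_ _ d _] := jP _ zn; have := domi_part_lt zn yn (bsupp _ zn bz) zy.
  by have := domi_quad (d _ mz); lia.
have := coef_iprod orth sp jQ cE y1n; rewrite c0 mul0r.
rewrite (eq_iprod alpha (fun w _ => erefl (phi w)) bE) iprod_sumr.
rewrite (bigD1_seq y) ?partitions_uniq //= iprodZr by_ big_seq_cond big1.
  rewrite addr0 => /eqP; rewrite mulf_eq0 gt_eqF //= => /eqP <-.
  by apply/eqP; apply: eq_iprod => //; apply: jackf_uniq_in yn jq (jP _ yn).
move=> z /andP[zn zy]; rewrite iprodZr.
have [->|bz] := eqVneq (b z) 0; first by rewrite mul0r.
rewrite (iprod_eigv jp (jP _ zn)) ?mulr0 // exy gt_eqF //.
apply: eigv_lt => //; [exact: part_sorted yn | exact: bsupp |].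
by rewrite (normp_id zn) (normp_id yn); apply/eqP.
Qed.

Lemma eigv_cons_inj a g h : sumn g = sumn h ->
  eigv (a :: g) = eigv (a :: h) -> eigv g = eigv h.
Proof. by move=> /= -> /addrI /addIr. Qed.

Lemma rows_eq n x y phi psi Q c d :
  x \in partitions n -> y \in partitions n -> eigv x = eigv y ->
  jackf n x phi -> jackf n y psi -> jbasis n.+1 Q ->
  {in partitions n.+1, forall lam,
     alpha * rem1 phi lam = \sum_(z <- partitions n.+1) c z * Q z lam} ->
  {in partitions n.+1, forall lam,
     alpha * rem1 psi lam = \sum_(z <- partitions n.+1) d z * Q z lam} ->
  c (rcons y 1%N) != 0 -> d (rcons x 1%N) != 0 -> x = y.
Proof.
elim/ltn_ind: n x y phi psi Q c d => n IH x y phi psi Q c d.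
case: x => [|a g] xn.
  have /= n0 := part_sumn xn; case: y => // b h yn.
  by have := part_le yn (mem_head b h); rewrite -n0; lia.
case: y => [|b h] yn.
  have /= n0 := part_sumn yn.
  by have := part_le xn (mem_head a g); rewrite -n0; lia.
move=> exy jp jq jQ cE dE cy dx.
have [a0 gm en pg] := part_consP xn; have [b0 hm en' ph] := part_consP yn.
(* The support bound allows [b' = a' + 1] at most. In that case [row_top_in] forces
   [g' = rcons h' 1], so the two partitions differ by moving a box from a last part 1 to the first
   row, which changes the content sum. *)
have top a' b' g' h' phi' c' : (0 < a')%N -> (a' :: g') \in partitions n ->
    (b' :: h') \in partitions n -> eigv (a' :: g') = eigv (b' :: h') ->
    jackf n (a' :: g') phi' ->
    {in partitions n.+1, forall lam,
      alpha * rem1 phi' lam = \sum_(z <- partitions n.+1) c' z * Q z lam} ->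
    c' (rcons (b' :: h') 1%N) != 0 -> (b' <= a')%N.
  move=> a0' xn' yn' exy' jp' cE' cy'.
  have [_ gm' ena' pg'] := part_consP xn'; have [b0' hm' _ ph'] := part_consP yn'.
  have pg1 : path geq a'.+1 g' by exact: path_geqS pg'.
  have dom := rem1_supp alpha_gt0 pg' jp' jQ cE' (part_rcons1 yn') cy'.
  have := domi_head pg1 dom; rewrite leq_eqVlt => /orP[/eqP e|//].
  move: cy' exy' (part_rcons1 yn'); rewrite e rcons_cons => cy' exy' yn1.
  move: cy' exy'; rewrite (row_top_in alpha_gt0 xn' jp' jQ cE' yn1).
  rewrite pnatr_eq0 eqb0 negbK => /eqP <-.
  rewrite /= eigv_rcons1 sumn_rcons addn1 -!natr1.
  have al0 := alpha_gt0; have s0 : 0 <= (size h')%:R :> R by exact: ler0n.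
  have : 0 <= alpha * a'%:R by rewrite mulr_ge0 ?ler0n // ltW.
  move=> ka /eqP; rewrite -subr_eq0.
  rewrite [X in X == _](_ : _ = - (alpha * a'%:R + (size h')%:R + 1)); last by field.
  by rewrite oppr_eq0 gt_eqF //; lra.
have ba : (b <= a)%N by apply: (top a b g h phi c).
have ab : (a <= b)%N by apply: (top b a h g psi d).
have {ba ab} eab : b = a by apply/eqP; rewrite eqn_leq ba.
move: b0 hm en' ph yn exy jq cy dE top; rewrite {}eab => _ hm _ ph yn exy jq cy dE _.
have egh : eigv g = eigv h.
  by apply: (eigv_cons_inj (a := a)) exy; rewrite (part_sumn gm) (part_sumn hm).
congr (_ :: _).
have [psi1 jpsi1] := jackf_exists alpha_gt0 gm.
have [psi2 jpsi2] := jackf_exists alpha_gt0 hm.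
have [Q' jQ'] := jbasis_exists alpha_gt0 (n - a).+1.
have [c' c'E] := jbasis_fun_expand alpha_gt0 jQ' (fun w => alpha * rem1 psi1 w).
have [d' d'E] := jbasis_fun_expand alpha_gt0 jQ' (fun w => alpha * rem1 psi2 w).
have low g1 h1 phi1 psi0 c1 c2 : g1 \in partitions (n - a) -> h1 \in partitions (n - a) ->
   (a :: g1) \in partitions n -> (a :: h1) \in partitions n -> eigv g1 = eigv h1 ->
   jackf n (a :: g1) phi1 -> jackf (n - a) g1 psi0 -> 
   {in partitions n.+1, forall lam,
      alpha * rem1 phi1 lam = \sum_(z <- partitions n.+1) c1 z * Q z lam} ->
   {in partitions (n - a).+1, forall lam,
      alpha * rem1 psi0 lam = \sum_(z <- partitions (n - a).+1) c2 z * Q' z lam} ->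
   c1 (rcons (a :: h1) 1%N) != 0 -> c2 (rcons h1 1%N) != 0.
  move=> gm1 hm1 pg1 ph1 egh1 jp1 jp0 c1E c2E.
  (* The new part 1 has content [- size h1], so the factor is at least 1. *)
  have ne k : alpha * k%:R + 1 - (eigv (rcons h1 1%N) - eigv g1) != 0.
    have s0 : 0 <= (size h1)%:R :> R by exact: ler0n.
    have k0 : 0 <= alpha * k%:R by rewrite mulr_ge0 ?ler0n // ltW.
    by rewrite eigv_rcons1 egh1 gt_eqF //; lra.
  rewrite rcons_cons; apply: (row_main_in alpha_gt0 pg1 jp1 jp0 jQ jQ' c1E c2E) => //.
  by rewrite -rcons_cons; apply: part_rcons1.
apply: (IH (n - a)%N _ g h psi1 psi2 Q' c' d') => //; first by lia.
  exact: (low _ _ _ _ _ _ gm hm xn yn egh jp jpsi1 cE c'E cy).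
exact: (low _ _ _ _ _ _ hm gm yn xn (esym egh) jq jpsi2 dE d'E dx).
Qed.

Lemma orth_down n : orthl n.+1 -> orthl n.
Proof.
move=> orth P jP x y xn yn xy; apply/eqP; apply: contraNT xy => ne.
have [e|/(iprod_eigv (jP _ xn) (jP _ yn)) e] := eqVneq (eigv x) (eigv y); last first.
  by rewrite e eqxx in ne.
have [Q jQ] := jbasis_exists alpha_gt0 n.+1.
have [c cE] := jbasis_fun_expand alpha_gt0 jQ (fun w => alpha * rem1 (P x) w).
have [d dE] := jbasis_fun_expand alpha_gt0 jQ (fun w => alpha * rem1 (P y) w).
apply/eqP; apply: (rows_eq xn yn e (jP _ xn) (jP _ yn) jQ cE dE).
  exact: (orth_coef orth xn yn e (jP _ xn) (jP _ yn) jQ cE ne).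
by apply: (orth_coef orth yn xn (esym e) (jP _ yn) (jP _ xn) jQ dE); rewrite iprodC.
Qed.

Lemma orth_le n m : (m <= n)%N -> orthl n -> orthl m.
Proof.
move=> mn; rewrite -(subnK mn); elim: (n - m)%N => // k IH h.
by apply: IH; apply: orth_down.
Qed.

End Orthogonality.

(** * Content products and the Pieri rule *)

Section Contents.
Variables (R : realFieldType) (alpha : R).
Hypothesis alpha_gt0 : 0 < alpha.
Implicit Types (w v u kap lam gam del g : seq nat) (phi psi F : seq nat -> R).

Notation eigv := (eigv alpha).
Notation iprod := (jack_iprod alpha).
Notation mcf := (mono_coef alpha).
Notation jackf := (jackf alpha).
Notation jbasis := (jbasis alpha).
Notation orthl := (orthl alpha).

(* [thetaX lam X] is the product of [X + alpha j - i] over the boxes [(i, j)]. *)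
Fixpoint thetaX lam (X : R) : R :=
  if lam is a :: g then \prod_(0 <= j < a) (X + alpha * j%:R) * thetaX g (X - 1)
  else 1.

(* The product of the alpha-contents of the boxes other than [(0, 0)]. *)
Definition theta lam : R :=
  if lam is a :: g then \prod_(1 <= j < a) (alpha * j%:R) * thetaX g (-1) else 1.

(** By adjointness, [c y] nonzero means that [P_x] occurs in the adjoint of [p_1] applied to [Q y],
    where no exponent exceeds the first row of [y]. The vanishing of [cvx (head 0 y)] expresses this
    bound and is inherited downwards in dominance. *)
Lemma coef_head n x y phi Q c : orthl n -> orthl n.+1 ->
  x \in partitions n -> jackf n x phi -> jbasis n.+1 Q ->
  {in partitions n.+1, forall lam,
     alpha * rem1 phi lam = \sum_(z <- partitions n.+1) c z * Q z lam} ->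
  y \in partitions n.+1 -> c y != 0 -> (head 0 x <= head 0 y)%N.
Proof.
move=> orth orth1 xn jp jQ cE yn cy; have [sp _ _ _] := jp.
have [P jP] := jbasis_exists alpha_gt0 n.
have [b bE] := jbasis_fun_expand alpha_gt0 jP (add1 (Q y)).
have yh : cvx (head 0 y) y = 0%N.
  case: y yn {cy bE} => [|d h] yn; first by rewrite /cvx big_nil.
  by have [_ _ _ ph] := part_consP yn; rewrite cvx_head.
have bsupp : {in partitions n, forall z, b z != 0 -> cvx (head 0 y) z = 0%N}.
  apply: (jbasis_supp jP (H := mcf n (add1 (Q y)))).
  - by move=> u v [_ /(_ (head 0%N y)) h] e; apply/eqP; rewrite -leqn0 -e.
  - by move=> kap _; apply: jbasis_mcf.
  move=> kap _ /(mcf_add1_supp alpha_gt0 (jQ _ yn)) [_ /(_ (head 0%N y))].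
  by rewrite yh cvx_cons leqn0 addn_eq0 => /andP[_ /eqP].
suff bx : b x != 0.
  have := bsupp _ xn bx; case: x xn {jp bx} => // a g xn.
  by rewrite cvx_cons => /eqP; rewrite addn_eq0 subn_eq0 => /andP[].
have := coef_iprod alpha_gt0 orth1 sp jQ cE yn.
apply: contra_eq_neq => b0.
rewrite (eq_iprod alpha (fun w _ => erefl (phi w)) bE) iprod_sumr big_seq big1.
  by rewrite eq_sym mulf_neq0 // (jackf_neq0 alpha_gt0 (jQ _ yn)).
move=> z zn; rewrite iprodZr; have [->|zx] := eqVneq z x; first by rewrite b0 mul0r.
rewrite (_ : iprod n phi (P z) = iprod n (P x) (P z)).
  by rewrite orth ?mulr0 // eq_sym.
by apply: eq_iprod => //; apply: (jackf_uniq_in alpha_gt0 xn jp (jP _ xn)).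
Qed.

(** This keeps the two factors in [row_main] positive. From [a :: g] to [a :: h], each threshold
    [1 <= c < a] adds at most 1 to [quad] and larger ones nothing, while [nstat] grows by at least
    1. *)
Lemma eigv_head_bound n a g h : (a :: g) \in partitions n -> (a :: h) \in partitions n.+1 ->
  domi (a :: h) (a.+1 :: g) -> eigv (a :: h) - eigv (a :: g) <= alpha * a.-1%:R - 1.
Proof.
move=> gn hn dom; have [a0 gm _ pg] := part_consP gn; have [_ hm _ ph] := part_consP hn.
have pg1 : path geq a.+1 g by exact: path_geqS pg.
have q : (quad (a :: h) <= quad (a :: g) + a.-1)%N.
  have an : (a <= n.+1)%N by have := part_le hn (mem_head a h); lia.
  rewrite (@quad_cvx n.+1) ?(part_sumn hn) // (@quad_cvx n.+1 (a :: g)) ?(part_sumn gn) //.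
  have <- : (\sum_(1 <= c < n.+2) (c < a)%N = a.-1)%N.
    rewrite (@big_cat_nat _ _ _ a) //=; last by lia.
    rewrite [X in (_ + X)%N]big_nat [X in (_ + X)%N]big1 ?addn0; last first.
      by move=> c /andP[ac _]; rewrite ltnNge ac.
    rewrite (eq_big_nat _ _ (F2 := fun=> 1%N)) => [|c /andP[_ ca]]; last by rewrite ca.
    by rewrite sum_nat_const_nat muln1 subn1.
  rewrite -big_split /=; apply: leq_sum => c _.
  have [ca|ac] := ltnP c a.
    by case: dom => _ /(_ c); rewrite !cvx_cons; lia.
  suff -> : cvx c (a :: h) = 0%N by [].
  have := cvx_head ph; rewrite /cvx => /eqP; rewrite sum_nat_seq_eq0 => /allP z.
  rewrite big1_seq // => x /= /z /=; rewrite !subn_eq0; lia.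
have s : (nstat (a :: g) + 1 <= nstat (a :: h))%N.
  suff : (nstat g <= nstat h)%N.
    by have := part_sumn hn; have := part_sumn gn; rewrite /=; lia.
  rewrite (@nstat_drop (size g + size h) g) ?leq_addr //.
  rewrite (@nstat_drop (size g + size h) h) ?leq_addl //.
  apply: leq_sum => k _; have := @domi_drop (a :: h) (a.+1 :: g) k.+1.
  by rewrite /= pg1 => /(_ isT dom).
rewrite !eigvE.
have q' : alpha * (quad (a :: h))%:R <= alpha * ((quad (a :: g))%:R + a.-1%:R).
  by rewrite ler_pM2l // -natrD ler_nat.
have s' : (nstat (a :: g))%:R + 1 <= (nstat (a :: h))%:R :> R by rewrite natr1 ler_nat -addn1.
lra.
Qed.

(* Pieri rule: [p_1 P_x] only involves [P_y] with [y] obtained by adding a box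
   to [x]; its content is [eigv y - eigv x]. *)
Lemma pieri n x y phi Q c : (forall k, (k <= n.+1)%N -> orthl k) ->
  x \in partitions n -> jackf n x phi -> jbasis n.+1 Q ->
  {in partitions n.+1, forall lam,
     alpha * rem1 phi lam = \sum_(z <- partitions n.+1) c z * Q z lam} ->
  y \in partitions n.+1 -> c y != 0 ->
  (forall X, thetaX y X = thetaX x X * (X + (eigv y - eigv x))) /\
  ((0 < n)%N -> theta y = theta x * (eigv y - eigv x)).
Proof.
elim/ltn_ind: n x y phi Q c => n IH x y phi Q c orth xn jp jQ cE yn cy.
case: x xn jp => [|a g] xn jp.
  have /= n0 := part_sumn xn; subst n; split=> // X.
  case: y yn {cy} => [|d h] yn; first by have := part_sumn yn.
  have /andP[d0 d1] := part_le yn (mem_head d h).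
  have := part_sumn yn; have -> : d = 1%N by lia.
  case: h yn => [|e h] yn; last first.
    by have := part_le yn (_ : e \in [:: d, e & h]); rewrite !inE eqxx orbT /= => /(_ isT); lia.
  by rewrite /= big_nat1; move=> _; field.
case: y yn cy => [|d h] yn cy; first by have := part_sumn yn.
have [a0 gm en pg] := part_consP xn; have [d0 hm en' ph] := part_consP yn.
have pg1 : path geq a.+1 g by exact: path_geqS pg.
have dom := rem1_supp alpha_gt0 pg jp jQ cE yn cy.
have := domi_head pg1 dom.
have := coef_head (orth n (leqnSn n)) (orth _ (leqnn _)) xn jp jQ cE yn cy => /= ad.
(* Either the first row grows, [h = g] and the new content is [alpha * a], or the first rows agree
   and the induction hypothesis for [g] and [h] applies with contents shifted by -1. *)
rewrite leq_eqVlt => /orP[/eqP e|da].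
  move: cy yn; rewrite e => cy yn.
  move: cy; rewrite (row_top_in alpha_gt0 xn jp jQ cE yn) pnatr_eq0 eqb0 negbK => /eqP ->.
  have ev : eigv (a.+1 :: g) - eigv (a :: g) = alpha * a%:R.
    by rewrite /= -natr1; field.
  rewrite ev; split=> [X|_].
    by rewrite /= big_nat_recr //=; ring.
  by rewrite /= big_nat_recr //=; ring.
have {ad da d0} eda : d = a by apply/eqP; rewrite eqn_leq ad -ltnS da.
move: yn cy ph hm en' dom; rewrite {}eda => yn cy ph hm _ dom.
have an : (a <= n)%N by rewrite en leq_addr.
have na : (n - a < n)%N by rewrite {2}en -{1}[(n - a)%N]add0n ltn_add2r.
have bd := eigv_head_bound xn yn dom.
have ev : eigv (a :: h) - eigv (a :: g) = eigv h - eigv g - 1.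
  have sh : sumn h = (sumn g).+1 by rewrite (part_sumn hm) (part_sumn gm) subSn.
  by rewrite /= sh -natr1; ring.
have [psi jq] := jackf_exists alpha_gt0 gm.
have [Q' jQ'] := jbasis_exists alpha_gt0 (n - a).+1.
have [b bE] := jbasis_fun_expand alpha_gt0 jQ' (fun w => alpha * rem1 psi w).
have hn : h \in partitions (n - a).+1 by rewrite -subSn.
have bh : b h != 0.
  apply: (row_main_in alpha_gt0 xn jp jq jQ jQ' cE bE yn _ _ cy).
    by rewrite gt_eqF //; lra.
  have : alpha * a.-1%:R <= alpha * a%:R by rewrite ler_pM2l // ler_nat leq_pred.
  by move=> ?; rewrite gt_eqF //; lra.
have [] := IH (n - a)%N na g h psi Q' b _ gm jq jQ' bE hn bh.
  by move=> k kn; apply/orth/(leq_trans kn); rewrite ltnS leq_subr.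
move=> th _; rewrite ev; split=> [X|_].
  by rewrite /= th; ring.
by rewrite /= th; ring.
Qed.

End Contents.

(** * Evaluation at [p_k = X] and the coefficient of [p_n] *)

Section Evaluation.
Variables (R : realFieldType) (alpha : R).
Hypothesis alpha_gt0 : 0 < alpha.
Implicit Types (w v u kap lam gam del g : seq nat) (phi psi F : seq nat -> R).

Notation lapb := (laplace_beltrami alpha).
Notation eigv := (eigv alpha).
Notation iprod := (jack_iprod alpha).
Notation weight := (zweight alpha).
Notation jackf := (jackf alpha).
Notation jbasis := (jbasis alpha).
Notation orthl := (orthl alpha).
Notation theta := (theta alpha).
Notation thetaX := (thetaX alpha).

(* Pairing with [expsize X] is the specialisation [p_k = X] for all [k]. *)
Definition expsize (X : R) w : R := X ^+ size w.

Lemma expsize_sym X : symf (expsize X).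
Proof. by move=> v v' vv'; rewrite /expsize (perm_size vv'). Qed.

(** Every letter contributes its size: lowering it keeps the length, and deleting a letter 1 loses a
    factor [X] that is put back. *)
Lemma expsize_lower X w : X * rem1 (expsize X) w + downop (expsize X) w =
  (sumn w)%:R * expsize X w.
Proof.
rewrite /rem1 /downop -spickZ -spickD.
rewrite (@eq_spick _ _ (fun x _ => x%:R * expsize X w)) => [|x v xv].
  elim: (w) (expsize X w) => [|k s IH] c /=; first by rewrite mul0r.
  by rewrite IH natrD mulrDl.
rewrite /expsize -(perm_size xv) /= exprS.
case: x {xv} => [|[|x]]; rewrite ?mul0r ?mulr0 ?mul1r ?addr0 //=.
by rewrite add0r.
Qed.

Lemma add1_expand n y phi P b : y \in partitions n.+1 -> jackf n.+1 y phi -> jbasis n P ->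
  {in partitions n, forall lam, add1 phi lam = \sum_(z <- partitions n) b z * P z lam} ->
  {in partitions n, forall lam, alpha * upop phi lam =
     \sum_(z <- partitions n) b z * (eigv y - eigv z) * P z lam}.
Proof.
move=> yn jp jP bE lam ln; have [sp _ _ _] := jp.
have -> : alpha * upop phi lam = add1 (lapb phi) lam - lapb (add1 phi) lam.
  by rewrite (add1_lapb _ _ sp) addrC addKr.
rewrite (lapb_expand alpha_gt0 jP (add1_sym sp) bE ln) /add1 (jackf_word jp).
- rewrite -/(add1 phi lam) bE // mulr_sumr -sumrB.
  by apply: eq_bigr => z _; ring.
- by rewrite inE negb_or /= (part_n0 ln).
- by rewrite /= (part_sumn ln).
Qed.

Lemma add1_coef_neq0 n x y P Q b c : orthl n -> orthl n.+1 ->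
  x \in partitions n -> y \in partitions n.+1 -> jbasis n P -> jbasis n.+1 Q ->
  {in partitions n, forall lam, add1 (Q y) lam = \sum_(z <- partitions n) b z * P z lam} ->
  {in partitions n.+1, forall lam,
     alpha * rem1 (P x) lam = \sum_(z <- partitions n.+1) c z * Q z lam} ->
  b x * iprod n (P x) (P x) = c y * iprod n.+1 (Q y) (Q y).
Proof.
move=> orth orth1 xn yn jP jQ bE cE; have [sp _ _ _] := jP _ xn.
rewrite -(coef_iprod alpha_gt0 orth1 sp jQ cE yn).
rewrite (eq_iprod alpha (fun w _ => erefl (P x w)) bE) iprod_sumr.
rewrite (bigD1_seq x) ?partitions_uniq //= iprodZr big_seq_cond big1 ?addr0 //.
by move=> z /andP[zn zx]; rewrite iprodZr orth ?mulr0 // eq_sym.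
Qed.

(** Both quantities share the scalar [u] because they obey one recursion: expand the adjoint of
    [p_1] on [P_y] as [sum_z b_z P_z]; by the Pieri rule every [z] contributes [b_z u_z] times the
    product attached to [y]. *)
Lemma jackf_eval n y phi : (forall k, (k <= n)%N -> orthl k) ->
  y \in partitions n -> jackf n y phi ->
  exists u : R, (forall X, iprod n phi (expsize X) = u * thetaX y X) /\
    ((0 < n)%N -> phi [:: n] = alpha * n%:R * u * theta y).
Proof.
elim: n y phi => [|n IH] y phi orth yn jp.
  have y0 : y = [::] by case: y yn {jp} => // d h yn; have := part_le yn (mem_head d h); lia.
  exists (weight [::] * phi [::]); split=> // X.
  by rewrite y0 /= /jack_iprod /= big_seq1 /expsize expr0 !mulr1.
have [P jP] := jbasis_exists alpha_gt0 n.
have [u uP] : exists u : seq nat -> R, {in partitions n, forall z,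
   (forall X, iprod n (P z) (expsize X) = u z * thetaX z X) /\
    ((0 < n)%N -> P z [:: n] = alpha * n%:R * u z * theta z)}.
  apply: (@fin_choice _ _ 0 (partitions n) (fun z (t : R) =>
    (forall X, iprod n (P z) (expsize X) = t * thetaX z X) /\
    ((0 < n)%N -> P z [:: n] = alpha * n%:R * t * theta z))) => z zn; apply: IH (jP _ zn) => // k kn.
  by apply: orth; apply: leqW.
have [Q jQ] := jbasis_exists alpha_gt0 n.+1.
have [b bE] := jbasis_fun_expand alpha_gt0 jP (add1 phi).
have [sp _ _ _] := jp.
have bQ : {in partitions n, forall lam, add1 (Q y) lam = \sum_(z <- partitions n) b z * P z lam}.
  move=> lam ln; rewrite -bE // /add1; have [sQ _ _ _] := jQ _ yn.
  have l0 : 0%N \notin 1%N :: lam by rewrite inE negb_or /= (part_n0 ln).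
  have pl := perm_normp l0.
  rewrite -(sQ _ _ pl) -(sp _ _ pl); apply/esym.
  apply: (jackf_uniq_in alpha_gt0 yn jp (jQ _ yn)).
  by have := normp_partition (1%N :: lam); rewrite /= (part_sumn ln).
have step z : z \in partitions n -> b z != 0 ->
   (forall X, thetaX y X = thetaX z X * (X + (eigv y - eigv z))) /\
  ((0 < n)%N -> theta y = theta z * (eigv y - eigv z)).
  move=> zn bz.
  have [c cE] := jbasis_fun_expand alpha_gt0 jQ (fun w => alpha * rem1 (P z) w).
  apply: (pieri alpha_gt0 orth zn (jP _ zn) jQ cE yn).
  have := add1_coef_neq0 (orth n (leqnSn n)) (orth _ (leqnn _)) zn yn jP jQ bQ cE.
  apply: contra_eq_neq => ->; rewrite mul0r mulf_neq0 //.
  exact: (jackf_neq0 alpha_gt0 (jP _ zn)).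
pose K := \sum_(z <- partitions n) b z * u z.
have n1 : n.+1%:R != 0 :> R by rewrite pnatr_eq0.
have al0 : alpha != 0 by rewrite gt_eqF.
have evalE X : iprod n.+1 phi (expsize X) = K / (alpha * n.+1%:R) * thetaX y X.
  apply: (mulfI (mulf_neq0 al0 n1)).
  transitivity (iprod n (fun w => X * add1 phi w + alpha * upop phi w) (expsize X)).
    rewrite iprodDl !iprodZl iprod_add1 ?iprod_upop //; try exact: expsize_sym.
    rewrite [X * _]mulrCA -mulrDr -[X * _]iprodZr -iprodDr -mulrA; congr (_ * _).
    rewrite -[LHS]iprodZr; apply: eq_iprod => // lam ln.
    by rewrite expsize_lower (part_sumn ln).
  have E : {in partitions n, forall lam, X * add1 phi lam + alpha * upop phi lam =
     \sum_(z <- partitions n) (b z * (X + (eigv y - eigv z))) * P z lam}.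
    move=> lam ln; rewrite bE // (add1_expand yn jp jP bE ln) mulr_sumr -big_split.
    by apply: eq_bigr => z _ /=; ring.
  rewrite (eq_iprod alpha E (fun w _ => erefl (expsize X w))) iprod_suml.
  transitivity (K * thetaX y X); last first.
    by rewrite mulrA [_ * (K / _)]mulrC divfK ?mulf_neq0.
  rewrite mulr_suml; apply: eq_big_seq => z zn; rewrite iprodZl (proj1 (uP _ zn)).
  have [->|bz] := eqVneq (b z) 0; first by rewrite !mul0r.
  by rewrite (proj1 (step _ zn bz)); ring.
exists (K / (alpha * n.+1%:R)); split=> // _.
have [n0|n0] := posnP n.
  subst n; have y1 : y = [:: 1%N].
    case: y yn {jp bQ step evalE bE} => [|d h] yn; first by have := part_sumn yn.
    have /andP[d0 d1] := part_le yn (mem_head d h).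
    have := part_sumn yn; have {d0 d1} -> : d = 1%N by lia.
    case: h yn => // e h yn.
    by have := part_le yn (_ : e \in [:: d, e & h]); rewrite !inE eqxx orbT /= => /(_ isT); lia.
  have := evalE 1; rewrite y1 /= big_nat1 /theta /= big_geq // mulr0 addr0 !mulr1.
  rewrite /jack_iprod /= big_seq1 /zweight zee_cons /= /zee big_nil expr1 !mulr1 => <-.
  by rewrite mulVKf.
have nn : [:: n] \in partitions n.
  by apply/partP; rewrite /= inE addn0 eq_sym -lt0n n0.
have n0' : n%:R != 0 :> R by rewrite pnatr_eq0 -lt0n.
have -> : alpha * n.+1%:R * (K / (alpha * n.+1%:R)) = K by rewrite mulrC divfK ?mulf_neq0.
apply: (mulfI (mulf_neq0 al0 n0')).
have := add1_expand yn jp jP bE nn; rewrite /upop /= addr0 mulrA => ->.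
rewrite mulrA [_ * K]mulrC mulr_suml mulr_suml; apply: eq_big_seq => z zn.
rewrite (proj2 (uP _ zn)) //.
have [->|bz] := eqVneq (b z) 0; first by rewrite !mul0r.
by rewrite (proj2 (step _ zn bz)) //; ring.
Qed.

End Evaluation.

(** * Removal of the first column and the hook normalisation *)

Section Columns.
Variables (R : realFieldType) (alpha : R).
Implicit Types (w v u kap lam gam del g : seq nat) (phi psi F : seq nat -> R).

Notation eigv := (eigv alpha).
Notation iprod := (jack_iprod alpha).
Notation powc := (@powc R).
Notation mcf := (mono_coef alpha).
Notation jackf := (jackf alpha).
Notation orthl := (orthl alpha).
Notation theta := (theta alpha).
Notation thetaX := (thetaX alpha).

(* The sum of [H] over the compositions of [m] into [N] parts. *)
Fixpoint csum (N m : nat) (H : seq nat -> R) : R :=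
  if N is N'.+1 then \sum_(0 <= k < m.+1) csum N' (m - k)%N (fun s => H (k :: s))
  else (m == 0%N)%:R * H [::].

Lemma eq_csum N m H H' :
  (forall s, size s = N -> sumn s = m -> H s = H' s) -> csum N m H = csum N m H'.
Proof.
elim: N m H H' => [|N IH] m H H' HH /=.
  by case: eqP => [m0|]; rewrite ?mul0r // HH.
apply: eq_big_nat => k /andP[_ km]; apply: IH => s sN sm.
by apply: HH; rewrite /= ?sN // sm; lia.
Qed.

Lemma csum0 N m : csum N m (fun=> 0) = 0.
Proof. by elim: N m => [|N IH] m /=; rewrite ?mulr0 // big1. Qed.

Lemma csumD N m H H' : csum N m (fun s => H s + H' s) = csum N m H + csum N m H'.
Proof.
elim: N m H H' => [|N IH] m H H' /=; first by rewrite mulrDr.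
by rewrite -big_split; apply: eq_bigr => k _ /=.
Qed.

Lemma csumZ N m c H : csum N m (fun s => c * H s) = c * csum N m H.
Proof.
elim: N m H => [|N IH] m H /=; first by rewrite mulrCA.
by rewrite mulr_sumr; apply: eq_bigr => k _.
Qed.

Lemma csum_sum (I : eqType) (r : seq I) N m (H : I -> seq nat -> R) :
  csum N m (fun s => \sum_(i <- r) H i s) = \sum_(i <- r) csum N m (H i).
Proof.
elim: r => [|i r IH].
  rewrite big_nil -[RHS](csum0 N m); apply: eq_csum => s _ _; exact: big_nil.
rewrite big_cons -IH -csumD; apply: eq_csum => s _ _; exact: big_cons.
Qed.

(** Choosing one of the [N] entries and lowering it by [k] reaches each composition of [m] in [N]
    ways. *)
Lemma csum_shift N m k H : symf H ->
  csum N (m + k) (spick (fun y v => (k <= y)%:R * H ((y - k)%N :: v))) =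
  N%:R * csum N m H.
Proof.
elim: N m H => [|N IH] m H sH /=; first by rewrite mulr0 mul0r.
under eq_bigr => j _ do rewrite csumD csumZ.
rewrite big_split /= -natr1 mulrDl mul1r addrC; congr (_ + _).
  rewrite (@big_cat_nat _ _ _ m.+1) //=; last by lia.
  rewrite [X in _ + X]big_nat [X in _ + X]big1 ?addr0 => [|j /andP[mj jm]]; last first.
    rewrite -[RHS](csum0 N (m + k - j)); apply: eq_csum => s _ sm.
    rewrite -[RHS](spick0 R s); apply: eq_spick => y v yv.
    have -> : (k <= y)%N = false.
      by have := perm_sumn yv; rewrite /= sm; lia.
    by rewrite mul0r.
  rewrite mulr_sumr; apply: eq_big_nat => j /andP[_ jm].
  have -> : (m + k - j = m - j + k)%N by lia.
  rewrite -IH; last by move=> v v' vv'; apply: sH; rewrite perm_cons.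
  apply: eq_csum => s _ _; apply: eq_spickT => y v; congr (_ * _); apply: sH.
  by rewrite (perm_catCA [:: _] [:: _] v).
rewrite (@big_cat_nat _ _ _ k) //=; last by lia.
rewrite big_nat big1 ?add0r => [|j /andP[_ jk]]; last by rewrite leqNgt jk mul0r.
rewrite -{1}[k]add0n big_addn -addSn addnK; apply: eq_bigr => j _.
by rewrite leq_addl mul1r addnK subnDr.
Qed.

(** Summing all coefficients sets the [N] variables to 1, where each power sum equals [N]. *)
Lemma csum_powc N w : csum N (sumn w) (powc w) = N%:R ^+ size w.
Proof.
elim: w => [|k w IH] /=.
  elim: N => [|N IHN] /=; first by rewrite mulr1.
  by rewrite big_nat1.
by rewrite addnC csum_shift ?IH ?exprS //; apply: powc_symr.
Qed.

Lemma csum_succ N m H : (forall s, size s = N -> 0%N \in s -> H s = 0) ->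
  csum N (m + N) H = csum N m (fun s => H (map succn s)).
Proof.
elim: N m H => [|N IH] m H H0 /=; first by rewrite addn0.
rewrite big_ltn // (@eq_csum _ _ _ (fun=> 0)) ?csum0 ?add0r; last first.
  by move=> s sN _; apply: H0; rewrite ?mem_head //= sN.
rewrite big_add1 /= (@big_cat_nat _ _ _ m.+1) //=; last by lia.
rewrite [X in _ + X]big_nat [X in _ + X]big1 ?addr0 => [|j /andP[mj jm]]; last first.
  rewrite -[RHS](csum0 N (m + N.+1 - j.+1)); apply: eq_csum => s sN sm.
  apply: H0; first by rewrite /= sN.
  rewrite inE /=; apply: contraT => s0.
  have : (size s <= sumn s)%N.
    elim: (s) s0 => //= x r IHr; rewrite inE negb_or => /andP[x0 /IHr]; lia.
  by rewrite sN sm; lia.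
apply: eq_big_nat => j /andP[_ jm].
have -> : (m + N.+1 - j.+1 = m - j + N)%N by lia.
by apply: IH => s sN s0; apply: H0; rewrite /= ?sN // inE s0 orbT.
Qed.

Lemma iprod_expsize n phi N :
  iprod n phi (expsize N%:R) = csum N n (mcf n phi).
Proof.
rewrite /mono_coef /jack_iprod csum_sum; apply: eq_big_seq => lam ln.
rewrite csumZ; congr (_ * _); rewrite csumZ; congr (_ * _).
by rewrite -[in csum _ n _](part_sumn ln) csum_powc.
Qed.

Lemma spick_map (f : nat -> nat) (G : nat -> seq nat -> R) w :
  spick G (map f w) = spick (fun x v => G (f x) (map f v)) w.
Proof. by elim: w G => //= k w IH G; rewrite IH. Qed.

Lemma spair_map (f : nat -> nat) (H : nat -> nat -> seq nat -> R) w :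
  spair H (map f w) = spair (fun a b u => H (f a) (f b) (map f u)) w.
Proof. by elim: w H => //= k w IH H; rewrite IH spick_map. Qed.

Lemma eigv_succ s :
  eigv (map succn s) = eigv s + alpha * (sumn s)%:R - 'C(size s, 2)%:R.
Proof.
have sm r : sumn (map succn r) = (sumn r + size r)%N.
  by elim: r => //= x r ->; lia.
elim: s => [|a s IH] /=; first by rewrite bin_small // mulr0 subr0 addr0.
by rewrite IH sm binS bin1 !natrD -natr1; field.
Qed.

Lemma perm_pad s t : normp s = normp t -> size s = size t -> perm_eq s t.
Proof.
move=> nst sst.
have e r : perm_eq r (normp r ++ nseq (size r - size (normp r)) 0%N).
  have pr : perm_eq r ([seq x <- r | x != 0%N] ++ [seq x <- r | ~~ (x != 0%N)]).
    by rewrite perm_sym; apply: permEl (perm_filterC _ _).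
  rewrite (permPl pr) /normp size_sort; apply: perm_cat.
    by rewrite perm_sym; apply: permEl (perm_sort _ _).
  have -> : (size r - size [seq x <- r | x != 0%N] = size [seq x <- r | ~~ (x != 0%N)])%N.
    by rewrite {1}(perm_size pr) size_cat addKn.
  have /all_pred1P e0 : all (pred1 0%N) [seq x <- r | ~~ (x != 0%N)].
    by apply/allP => x; rewrite mem_filter negbK => /andP[].
  by rewrite {1}e0.
by rewrite (permPl (e s)) nst sst perm_sym (permPl (e t)).
Qed.

Lemma count_nz_cvx s : (cvx 1 s + count (fun x => x != 0%N) s = sumn s)%N.
Proof.
elim: s => [|x s IH] /=; first by rewrite /cvx big_nil.
rewrite cvx_cons -IH; move: (count _ s) (cvx 1 s) => c d.
by case: x => [|x] /=; lia.
Qed.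

(** Comparing [cvx 1] shows that a word below [y] in dominance has at least as many nonzero entries
    as [y]. *)
Lemma mcf_zero_part n y phi t : y \in partitions n -> jackf n y phi ->
  size t = size y -> 0%N \in t -> mcf n phi t = 0.
Proof.
move=> yn [_ _ d _] ts t0; apply/eqP; apply: contraTT t0 => /d [e /(_ 1%N) c1].
have := count_nz_cvx t; have := count_nz_cvx y.
have : count (fun x => x != 0%N) y = size y.
  by apply/eqP; rewrite -all_count; apply/allP => x xy; apply: contraNneq (part_n0 yn) => <-.
have := count_size (fun x => x != 0%N) t => c cy h1 h2.
have : all (fun x => x != 0%N) t by rewrite all_count; lia.
by move=> /allP h; apply/negP => /h.
Qed.

Lemma cvx_succ c s : cvx c.+1 (map succn s) = cvx c s.
Proof. by rewrite /cvx big_map; apply: eq_bigr => x _; rewrite subSS. Qed.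

Lemma sumn_succ s : sumn (map succn s) = (sumn s + size s)%N.
Proof. by elim: s => //= x s ->; lia. Qed.

Hypothesis alpha_gt0 : 0 < alpha.

(* Dividing [P_lam] in [size lam] variables by their product gives the function
   of the partition obtained by deleting the first column. *)
Lemma mcf_column n g0 g phi psi : map succn g0 \in partitions n -> g = normp g0 ->
  jackf n (map succn g0) phi -> jackf (n - size g0) g psi ->
  forall kap, size kap = size g0 -> mcf n phi (map succn kap) = mcf (n - size g0) psi kap.
Proof.
move=> yn eg jp jq kap sk.
have sn := part_sumn yn; rewrite sumn_succ in sn.
have gm : g \in partitions (n - size g0) by rewrite eg -sn addnK normp_partition.
have [km|km] := eqVneq (sumn kap) (n - size g0)%N; last first.
  have -> : mcf (n - size g0) psi kap = 0 by apply/eqP; apply: contraNT km => /mcf_sumn ->.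
  apply/eqP; apply: contraNT km => /mcf_sumn; rewrite sumn_succ sk => e.
  by apply/eqP; lia.
have sg0 : sorted geq g0.
  by have := part_sorted yn; rewrite sorted_map.
have eg0 : eigv g0 = eigv g.
  have [d1 d2] := domi_normp g0; rewrite -eg in d1 d2.
  rewrite !eigvE eg quad_normp -eg; congr (_ - _%:R).
  apply/eqP; rewrite eqn_leq; apply/andP; split.
    exact: (domi_nstat sg0 d2).
  exact: (domi_nstat (part_sorted gm) d1).
apply/eqP; rewrite -subr_eq0; apply/eqP.
pose F t := mcf n phi (map succn t); have sF : symf F.
  by move=> s t st; apply: (mcf_sym alpha n phi); apply: perm_map.
have := @raise_uniq R alpha alpha_gt0 (size g0) g (fun t => F t - mcf (n - size g0) psi t).
apply=> //; rewrite ?(part_sumn gm) ?(part_sorted gm) //.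
- by move=> s t st; rewrite (mcf_sym _ _ psi st) (sF _ _ st).
- move=> t st tm _; rewrite mulrBr (jackf_raise alpha_gt0 t jq).
  have := jackf_raise alpha_gt0 (map succn t) jp.
  have -> : raise (mcf n phi) (map succn t) = raise F t.
    rewrite /raise spair_map; apply: eq_spair => a b u abu.
    (* The last value of [r] empties a variable and drops out by [mcf_zero_part]; the other terms
       commute with the shift by 1. *)
    rewrite big_nat_recr //= [X in _ + X](_ : _ = 0) ?addr0.
      rewrite big_nat [RHS]big_nat; apply: eq_bigr => r /andP[r0 rb].
      rewrite /F /= -!natr1 addSn subSn //; ring.
    rewrite subnn (mcf_zero_part yn jp) ?mulr0 ?inE ?orbT //.
    by rewrite /= !size_map -st -(perm_size abu).
  (* The shift changes an eigenvalue by a quantity depending only on length and sum, which cancels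
     in the difference. *)
  rewrite !eigv_succ st eg0 tm; have -> : (sumn g0 = n - size g0)%N by lia.
  rewrite -/(F t) => e.
  have E s : F s - mcf (n - size g0) psi s = F s + -1 * mcf (n - size g0) psi s by ring.
  rewrite (@eq_raise R _ _ t (fun s _ _ => E s)) raiseD raiseZ -e; ring.
- move=> t st _; case: jp jq => [_ _ dp _] [_ _ dq _].
  have [e|/dp [e1 c1] _] := eqVneq (F t) 0.
    by rewrite e sub0r oppr_eq0 => /dq.
  split=> [|c]; first by move: e1; rewrite !sumn_succ (part_sumn gm); lia.
  by have := c1 c.+1; rewrite !cvx_succ eg cvx_normp.
- move=> t st nt.
  have pt : perm_eq t g0 by apply: perm_pad; rewrite ?st // nt (normp_id gm).
  rewrite (sF _ _ pt) -(mcf_normp _ _ psi t) nt (normp_id gm).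
  by case: jp jq => [_ _ _ e1] [_ _ _ e2]; rewrite /F e1 e2 subrr.
Qed.

Lemma thetaX_gt0 g X : (size g)%:R <= X -> 0 < thetaX g X.
Proof.
elim: g X => [|a g IH] X /= gX; first exact: ltr01.
rewrite -natr1 in gX; have g0 : 0 <= (size g)%:R :> R by exact: ler0n.
rewrite mulr_gt0 ?IH //; last by lra.
apply: prodr_gt0 => j _; have : 0 <= alpha * j%:R by rewrite mulr_ge0 ?ler0n ?ltW.
by lra.
Qed.

Lemma hookp_cons a g : hookp alpha (a :: g) =
  \prod_(0 <= c < a) (alpha * (a - c).-1%:R + (count (fun x => c < x)%N g)%:R + 1) *
  hookp alpha g.
Proof.
rewrite /hookp big_ord_recl /=; congr (_ * _).
by rewrite big_mkord /leg /= drop0.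
Qed.

(** The factor of a row is the hook of its first box in [map succn g], and also, at [X = size g],
    the content factor of its last box. This coincidence links contents to hooks. *)
Fixpoint colprod g : R :=
  if g is a :: g' then (alpha * a%:R + (size g')%:R + 1) * colprod g' else 1.

Lemma hookp_succ g : hookp alpha (map succn g) = hookp alpha g * colprod g.
Proof.
elim: g => [|a g IH]; first by rewrite /hookp !big_ord0 mulr1.
rewrite /= !hookp_cons big_ltn // IH subn0 /=.
have -> : count (fun x => 0 < x)%N (map succn g) = size g.
  by elim: (g) => //= x s ->.
rewrite big_add1 /= (eq_bigr (fun c =>
   alpha * (a - c).-1%:R + (count (fun x => c < x)%N g)%:R + 1)) => [|c _].
  by ring.
by rewrite subSS count_map.
Qed.

Lemma thetaX_succ g : thetaX (map succn g) (size g)%:R = thetaX g (size g)%:R * colprod g.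
Proof.
elim: g => [|a g IH]; first by rewrite /= mulr1.
rewrite /= big_nat_recr //= -!natr1 addrK IH; ring.
Qed.

Lemma hookp_pad g k : hookp alpha (g ++ nseq k 0%N) = hookp alpha g.
Proof.
elim: g => [|a g IH] /=.
  elim: k => [|k IHk] //=; rewrite hookp_cons big_geq // mul1r IHk.
  by rewrite /hookp big_ord0.
rewrite !hookp_cons IH; congr (_ * _); apply: eq_bigr => c _.
by rewrite count_cat (count_nseq _ k 0%N) /= addn0.
Qed.

Lemma thetaX_pad g k X : thetaX (g ++ nseq k 0%N) X = thetaX g X.
Proof.
elim: g X => [|a g IH] X /=; last by rewrite IH.
by elim: k X => [|k IHk] X //=; rewrite big_geq // mul1r IHk.
Qed.

Lemma sorted_pad s : sorted geq s ->
  s = normp s ++ nseq (size s - size (normp s)) 0%N.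
Proof.
move=> ss; have e : normp s = [seq x <- s | x != 0%N].
  by apply: sorted_sort geq_trans _ _; apply: sorted_filter geq_trans _ _ ss.
rewrite e; elim: s ss {e} => [|x s IH] //= xs.
have := xs; rewrite (path_sortedE geq_trans) => /andP[/allP xl ss].
case: x xs xl => [|x] xs xl /=; last by rewrite -IH.
have /all_pred1P e : all (pred1 0%N) s by apply/allP => y /xl; rewrite /= leqn0.
rewrite e (_ : [seq y <- nseq _ 0%N | y != 0%N] = [::]) ?size_nseq //.
by elim: (size s).
Qed.

(** Set as many variables as [y] has rows equal to 1. Deleting the first column preserves this
    value, and divides both the content product and the hook product by [colprod], so [u * hookp] is
    unchanged; for the empty partition it is 1. *)
Lemma jackf_hook n y phi : (forall k, (k <= n)%N -> orthl k) ->
  y \in partitions n -> jackf n y phi ->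
  exists u : R, [/\ u * hookp alpha y = 1, (forall X, iprod n phi (expsize X) = u * thetaX y X) &
    ((0 < n)%N -> phi [:: n] = alpha * n%:R * u * theta y)].
Proof.
elim/ltn_ind: n y phi => n IH y phi orth yn jp.
have [u [uX ut]] := jackf_eval alpha_gt0 orth yn jp; exists u; split=> //.
case: (posnP n) => [n0|n0].
  subst n; have y0 : y = [::].
    by case: y yn {jp uX ut} => // d h yn; have := part_le yn (mem_head d h); lia.
  move: (uX 1); rewrite y0 /= mulr1 => <-; rewrite /hookp big_ord0 mulr1.
  by case: jp => _ _ _; rewrite y0 /mono_coef /jack_iprod /= !big_seq1.
pose g0 := map predn y; pose g := normp g0.
have ey : y = map succn g0.
  rewrite /g0 -map_comp -[LHS]map_id; apply/eq_in_map => x xy /=.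
  by rewrite prednK // lt0n; apply: contraNneq (part_n0 yn) => <-.
have sg0 : size g0 = size y by rewrite size_map.
have sy : sumn y = (sumn g0 + size g0)%N by rewrite {1}ey sumn_succ.
rewrite (part_sumn yn) in sy.
have y0 : (0 < size y)%N.
  by case: (y) (part_sumn yn) n0 => // <-.
have gm : g \in partitions (n - size g0) by rewrite sy addnK normp_partition.
have [psi jq] := jackf_exists alpha_gt0 gm.
have [|k kn|v [vh vX _]] := IH (n - size g0)%N _ g psi _ gm jq; first by lia.
  by apply: orth; lia.
have sort0 : sorted geq g0 by have := part_sorted yn; rewrite ey sorted_map.
have pad := sorted_pad sort0; rewrite -/g in pad.
have := uX (size y)%:R; rewrite iprod_expsize.
rewrite {1}sy -{1}sg0 csum_succ => [|s ss s0]; last first.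
  by rewrite (mcf_zero_part yn jp) // ss.
have jp' : jackf n (map succn g0) phi by rewrite -ey.
have yn' : map succn g0 \in partitions n by rewrite -ey.
rewrite (@eq_csum _ _ _ (mcf (n - size g0) psi)) => [|s ss _]; last first.
  by rewrite -(mcf_column yn' erefl jp' jq) -?sy.
rewrite {1}(_ : sumn g0 = n - size g0)%N; last by lia.
rewrite sg0 -iprod_expsize -{1}sg0 vX.
have -> : thetaX y (size y)%:R = thetaX g (size y)%:R * colprod g0.
  rewrite {1}ey -sg0 thetaX_succ; congr (_ * _).
  by rewrite {1}pad thetaX_pad.
have gs : (size g <= size y)%N by rewrite -sg0 pad size_cat leq_addr.
have tg : thetaX g (size y)%:R != 0 by rewrite gt_eqF // thetaX_gt0 // ler_nat.
rewrite mulrA [u * _]mulrC -mulrA mulrC => /(mulfI tg) e.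
by rewrite ey hookp_succ {1}pad hookp_pad mulrCA -e mulrC.
Qed.

End Columns.

(** * The second commutator as a cut-and-join operator *)

Section Commutator.
Variables (R : realFieldType) (alpha : R).
Implicit Types (w v u kap : seq nat) (phi : seq nat -> R).

Notation lapb := (laplace_beltrami alpha).

Definition cutjoin phi w : R := spick (fun x v => x%:R *
  ((alpha - 1) * x.-1%:R * phi (x.-1 :: v)
   + \sum_(1 <= d < x.-1) phi [:: (x.-1 - d)%N, d & v]
   + alpha * spick (fun y u => y%:R * phi ((x + y).-1 :: u)) v)) w.

(* Differs from [downop] by the junk letter [0] produced from a letter [1]. *)
Definition low phi w : R := spick (fun x v => x%:R * phi (x.-1 :: v)) w.

Lemma low_sym phi : symf phi -> symf (low phi).
Proof.
move=> sp v v' vv'; apply: spick_perm vv' => x u u' uu'.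
by rewrite (sp (x.-1 :: u) (x.-1 :: u')) // perm_cons.
Qed.

Lemma downop_low phi w : (forall v, 0%N \in v -> phi v = 0) -> downop phi w = low phi w.
Proof.
move=> van; apply: eq_spickT => -[|[|x]] v; rewrite ?mul1r ?mul0r //.
by rewrite van ?mem_head // mulr0.
Qed.

Lemma cutjoin_sum (I : Type) (r : seq I) (G : I -> R) (F : I -> seq nat -> R) w :
  cutjoin (fun v => \sum_(i <- r) G i * F i v) w =
  \sum_(i <- r) G i * cutjoin (F i) w.
Proof.
rewrite /cutjoin; under [RHS]eq_bigr => i _ do rewrite -spickZ.
rewrite -spick_sum; apply: eq_spickT => x v.
rewrite exchange_big /= (_ : spick _ v = \sum_(i <- r) G i *
  spick (fun y u => y%:R * F i ((x + y).-1 :: u)) v); last first.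
  under [RHS]eq_bigr => i _ do rewrite -spickZ.
  rewrite -spick_sum; apply: eq_spickT => y u; rewrite mulr_sumr.
  by apply: eq_bigr => i _; rewrite mulrCA.
rewrite !mulr_sumr -!big_split mulr_sumr; apply: eq_bigr => i _ /=.
by rewrite -mulr_sumr; ring.
Qed.

Section LowCommute.
Variable phi : seq nat -> R.
Hypothesis sp : symf phi.
Hypothesis van : forall v, 0%N \in v -> phi v = 0.

Let swap2 a b v : phi [:: a, b & v] = phi [:: b, a & v].
Proof. by apply: sp; rewrite (perm_catCA [:: a] [:: b]). Qed.

Let diag f w := spick (fun x v => x%:R * (x%:R - 1) * f (x :: v)) w : R.
Let cut f w := spick (fun x v => x%:R * \sum_(1 <= a < x) f [:: a, (x - a)%N & v]) w : R.
Let join f w := spick (fun x v => x%:R * spick (fun y u => y%:R * f ((x + y)%N :: u)) v) w : R.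

(** As in the next two lemmas, terms where the two operators touch different letters cancel after
    exchanging picks. On a common letter the weights are [x - 1] times [x] and [x - 2], hence the
    2. *)
Let low_diag w : diag (low phi) w - low (diag phi) w =
  2 * spick (fun x v => x%:R * (x.-1%:R * phi (x.-1 :: v))) w.
Proof.
rewrite /diag /low /=; under eq_spickT => x v do rewrite mulrDr.
under [X in _ - X]eq_spickT => x v do rewrite mulrDr.
rewrite !spickD opprD addrACA [X in _ + X](_ : _ = 0) ?addr0; last first.
  apply/eqP; rewrite subr_eq0; apply/eqP.
  under eq_spickT => x v do rewrite -spickZ.
  under [RHS]eq_spickT => x v do rewrite -spickZ.
  rewrite [RHS]spick_swap; apply: eq_spickT => x v; apply: eq_spickT => y u.
  by rewrite swap2; ring.
rewrite -spickB -spickZ; apply: eq_spickT => -[|x] v /=; first by rewrite !mul0r mulr0 subrr.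
by rewrite -natr1; ring.
Qed.

(** Pieces of total [x - 1] arise with weight [x + 1] by cutting and then lowering a piece, and with
    weight [x - 1] by lowering first. A piece 1 lowered to 0 is killed by [van]. *)
Let low_cut w : cut (low phi) w - low (cut phi) w =
  2 * spick (fun x v => x%:R * \sum_(1 <= d < x.-1) phi [:: (x.-1 - d)%N, d & v]) w.
Proof.
rewrite /cut /low /=.
have -> : spick (fun x v => x%:R * \sum_(1 <= a < x) (a%:R * phi [:: a.-1, (x - a)%N & v] +
   ((x - a)%:R * phi [:: (x - a).-1, a & v] +
    spick (fun y u => y%:R * phi [:: y.-1, a, (x - a)%N & u]) v))) w =
  spick (fun x v => x%:R * \sum_(1 <= a < x) (a%:R * phi [:: a.-1, (x - a)%N & v] +
   (x - a)%:R * phi [:: (x - a).-1, a & v])) w +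
  spick (fun x v => spick (fun y u => x%:R * \sum_(1 <= a < x) (y%:R * phi [:: y.-1, a, (x - a)%N & u])) v) w.
  rewrite -spickD; apply: eq_spickT => x v.
  rewrite spickZ spick_sum -mulrDr -big_split /=; congr (_ * _).
  by apply: eq_bigr => a _; rewrite addrA.
under [X in _ - X]eq_spickT => x v do rewrite mulrDr -[X in _ + X]spickZ.
rewrite [X in _ - X]spickD opprD addrACA [X in _ + X](_ : _ = 0) ?addr0; last first.
  apply/eqP; rewrite subr_eq0; apply/eqP.
  rewrite [RHS]spick_swap; apply: eq_spickT => x v; apply: eq_spickT => y u.
  rewrite mulrCA; congr (_ * _); rewrite mulr_sumr; apply: eq_bigr => a _.
  by congr (_ * _); apply: sp; rewrite (perm_catCA [:: y.-1] [:: a; (x - a)%N]).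
rewrite -spickB -spickZ; apply: eq_spickT => -[|x] v /=; first by rewrite !mul0r mulr0 subrr.
rewrite -mulrBr mulrCA; congr (_ * _).
case: x => [|x]; first by rewrite !big_geq // !mulr0 subrr.
rewrite big_split /= big_ltn // van ?mem_head // mulr0 add0r big_add1 /=.
rewrite [X in _ + X - _]big_nat_recr //= subSnn /= van ?mem_head // mulr0 addr0.
rewrite -big_split /= mulr_sumr -sumrB mulr_sumr big_nat [RHS]big_nat.
apply: eq_bigr => a /andP[a0 ax].
have -> : ((x.+2 - a).-1 = x.+1 - a)%N by lia.
rewrite subSS (swap2 a) natrB; last by lia.
by rewrite -!natr1; ring.
Qed.

(** Up to the factor [x y], joining and then lowering has weight [x + y]; lowering one of the two
    letters first has weight [x + y - 2] once ordered pairs are symmetrised. *)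
Let low_join w : join (low phi) w - low (join phi) w =
  2 * spick (fun x v => x%:R * spick (fun y u => y%:R * phi ((x + y).-1 :: u)) v) w.
Proof.
rewrite /join /low /=.
pose tri := spick (fun x v => spick (fun y u => spick (fun z t =>
  x%:R * (y%:R * (z%:R * phi [:: z.-1, (x + y)%N & t]))) u) v) w.
have -> : spick (fun x v => x%:R * spick (fun y u => y%:R *
   ((x + y)%:R * phi ((x + y).-1 :: u) +
    spick (fun z t => z%:R * phi [:: z.-1, (x + y)%N & t]) u)) v) w =
  spick (fun x v => spick (fun y u => x%:R * (y%:R * ((x + y)%:R * phi ((x + y).-1 :: u)))) v) w + tri.
  rewrite -spickD; apply: eq_spickT => x v; rewrite -spickZ -spickD.
  by apply: eq_spickT => y u; rewrite !spickZ -!mulrDr.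
have -> : spick (fun x v => x%:R * (x.-1%:R * spick (fun y u => y%:R * phi ((x.-1 + y)%N :: u)) v +
   spick (fun y u => y%:R * (x.-1%:R * phi ((y + x.-1)%N :: u) +
     spick (fun z t => z%:R * phi [:: (y + z)%N, x.-1 & t]) u)) v)) w =
  spick (fun x v => spick (fun y u => 2 * (x%:R * (x.-1%:R * (y%:R * phi ((x + y).-1 :: u))))) v) w + tri.
  have -> : tri = spick (fun x v => spick (fun y u => spick (fun z t =>
     x%:R * (y%:R * (z%:R * phi [:: (y + z)%N, x.-1 & t]))) u) v) w.
    pose G x y z t := x%:R * (y%:R * (z%:R * phi [:: z.-1, (x + y)%N & t])).
    transitivity (spick (fun x v => spick (fun y u => spick (fun z t => G x z y t) u) v) w).
      by apply: eq_spickT => x v; rewrite (spick_swap (G x)).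
    rewrite (spick_swap (fun x y u => spick (fun z t => G x z y t) u)).
    apply: eq_spickT => x v; apply: eq_spickT => y u; apply: eq_spickT => z t.
    by rewrite /G swap2; ring.
  rewrite -spickD; apply: eq_spickT => x v.
  rewrite -!spickZ -!spickD -spickZ; apply: eq_spickT => y u.
  rewrite !spickZ [(y + _)%N]addnC; case: x => [|x] /=; first by rewrite !mul0r mulr0 addr0.
  by ring.
rewrite opprD addrACA subrr addr0.
pose G x y u := x%:R * (x.-1%:R * (y%:R * phi ((x + y).-1 :: u))).
have -> : spick (fun x v => spick (fun y u => 2 * (x%:R * (x.-1%:R * (y%:R * phi ((x + y).-1 :: u))))) v) w =
  spick (fun x v => spick (fun y u => G x y u) v) w + spick (fun x v => spick (fun y u => G y x u) v) w.
  rewrite -(spick_swap G) -spickD; apply: eq_spickT => x v; rewrite -spickD.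
  by apply: eq_spickT => y u; rewrite /G; ring.
rewrite -spickD -spickB -spickZ; apply: eq_spickT => x v.
rewrite -spickD -spickB -!spickZ; apply: eq_spickT => y u.
rewrite /G [(y + x)%N]addnC; case: x => [|x]; first by rewrite !(mul0r, mulr0, addr0, subrr).
case: y => [|y]; first by rewrite !(mul0r, mulr0, addr0, subrr).
by rewrite natrD /= -!natr1; ring.
Qed.

Lemma low_commute w : lapb (low phi) w - low (lapb phi) w = cutjoin phi w.
Proof.
have E f v : lapb f v = 2^-1 * ((alpha - 1) * diag f v + cut f v + alpha * join f v).
  by rewrite /laplace_beltrami !spickD -!spickZ; congr (_ * (_ + _ + _)); apply: eq_spickT => x u; rewrite ?mulrA.
have EL : low (lapb phi) w = 2^-1 * ((alpha - 1) * low (diag phi) w + low (cut phi) w + alpha * low (join phi) w).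
  rewrite /low -!spickZ -!spickD -spickZ; apply: eq_spickT => x v.
  by rewrite E; ring.
have EC : cutjoin phi w = (alpha - 1) * spick (fun x v => x%:R * (x.-1%:R * phi (x.-1 :: v))) w +
  spick (fun x v => x%:R * \sum_(1 <= d < x.-1) phi [:: (x.-1 - d)%N, d & v]) w +
  alpha * spick (fun x v => x%:R * spick (fun y u => y%:R * phi ((x + y).-1 :: u)) v) w.
  rewrite /cutjoin -!spickZ -!spickD; apply: eq_spickT => x v; ring.
rewrite EL EC; apply: (mulfI (_ : 2 != 0)); first by rewrite pnatr_eq0.
transitivity ((alpha - 1) * (diag (low phi) w - low (diag phi) w) +
  (cut (low phi) w - low (cut phi) w) + alpha * (join (low phi) w - low (join phi) w)).
  by rewrite E; field.
by rewrite low_diag low_cut low_join; ring.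
Qed.
End LowCommute.
End Commutator.

(** * The counting definition of coefficients agrees with the recursive one *)

Section Coefficients.
Variable R : realFieldType.
Notation powc := (@powc R).

Lemma spick_map_uniq (T : eqType) (f : T -> nat) (G : nat -> seq nat -> R) r :
  uniq r -> spick G (map f r) = \sum_(i <- r) G (f i) (map f (rem i r)).
Proof.
elim: r G => [|i r IH] G /=; first by rewrite big_nil.
case/andP=> ir ur; rewrite big_cons eqxx IH //; congr (_ + _).
apply: eq_big_seq => j jr; case: eqP => [e|] //.
by rewrite e jr in ir.
Qed.

(** This is [pm_coef] with the exponents as a function, so that lowering one of them keeps the index
    type in the induction on [mu]. *)
Definition fiber_count (n : nat) (mu : seq nat) (kap : 'I_n -> nat) : nat :=
  #|[set f : {ffun 'I_(size mu) -> 'I_n} |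
      [forall i : 'I_n, \sum_(j < size mu | f j == i) nth 0 mu j == kap i]%N]|.

Definition ffcons n (T : finType) (p : T * {ffun 'I_n -> T}) : {ffun 'I_n.+1 -> T} :=
  [ffun j => if unlift ord0 j is Some j' then p.2 j' else p.1].

Lemma ffcons_bij n T : bijective (@ffcons n T).
Proof.
exists (fun f : {ffun 'I_n.+1 -> T} => (f ord0, [ffun j : 'I_n => f (lift ord0 j)])).
  case=> i g; rewrite /ffcons !ffunE unlift_none /=; congr (_, _).
  by apply/ffunP => j; rewrite !ffunE liftK.
move=> f; apply/ffunP => j; rewrite !ffunE /=.
by case: unliftP => [j' ->|->]; rewrite ?ffunE.
Qed.

Lemma fiber_count_powc n mu (kap : 'I_n -> nat) :
  (fiber_count mu kap)%:R = powc mu [seq kap i | i <- enum 'I_n].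
Proof.
elim: mu kap => [|k mu IH] kap.
  rewrite /= /fiber_count all_map -sum1dep_card big_mkcond /=.
  have -> : all (preim kap (pred1 0%N)) (enum 'I_n) = [forall i, kap i == 0%N].
    by apply/allP/forallP => [h i|h i _]; [apply: h; rewrite mem_enum | apply: h].
  rewrite (eq_bigr (fun=> ([forall i, kap i == 0%N] : nat))) => [|f _].
    by rewrite sum_nat_const card_ffun !card_ord expn0 mul1n.
  have -> : [forall i : 'I_n, \sum_(j < 0 | f j == i) nth 0%N [::] j == kap i]%N =
      [forall i, kap i == 0%N].
    by apply: eq_forallb => i; rewrite big_ord0 eq_sym.
  by case: [forall i, _].
have enumu : uniq (enum 'I_n) by exact: enum_uniq.
rewrite /= spick_map_uniq // /fiber_count -sum1dep_card.
rewrite (reindex (@ffcons (size mu) 'I_n)) /=; last first.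
  by apply: onW_bij; apply: ffcons_bij.
rewrite big_mkcond /= -(pair_bigA _ (fun i g => if [forall i' : 'I_n,
   \sum_(j < (size mu).+1 | ffcons (i, g) j == i') nth 0%N (k :: mu) j == kap i']%N then 1%N else 0%N)) /=.
rewrite natr_sum big_enum /=; apply: eq_bigr => i _.
pose kap' j := if j == i then (kap i - k)%N else kap j.
have cond g : [forall i' : 'I_n,
   \sum_(j < (size mu).+1 | ffcons (i, g) j == i') nth 0%N (k :: mu) j == kap i']%N =
   (k <= kap i)%N && [forall i' : 'I_n, \sum_(j < size mu | g j == i') nth 0%N mu j == kap' i']%N.
  have e i' : (\sum_(j < (size mu).+1 | ffcons (i, g) j == i') nth 0%N (k :: mu) j =
     (i' == i) * k + \sum_(j < size mu | g j == i') nth 0%N mu j)%N.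
    rewrite big_mkcond big_ord_recl /= ffunE unlift_none /= [in RHS]big_mkcond; congr (_ + _)%N.
      by rewrite eq_sym; case: eqP; rewrite ?mul1n ?mul0n.
    by apply: eq_bigr => j _; rewrite ffunE liftK.
  apply/forallP/andP => [h|[ki /forallP h] i'].
    split; first by have := h i; rewrite e eqxx mul1n => /eqP <-; rewrite leq_addr.
    apply/forallP => i'; have := h i'; rewrite e /kap'; case: (eqVneq i' i) => [->|_].
      by rewrite mul1n => /eqP <-; rewrite addKn.
    by rewrite mul0n.
  rewrite e; have := h i'; rewrite /kap'; case: (eqVneq i' i) => [->|_] /eqP ->.
    by rewrite mul1n subnKC.
  by rewrite mul0n.
under eq_bigr => g _ do rewrite cond.
have [ki|_] /= := boolP (k <= kap i)%N; last by rewrite mul0r big1.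
rewrite mul1r -big_mkcond /= sum1dep_card -/(fiber_count mu kap') IH.
apply: powc_symr.
have ie : i \in enum 'I_n by rewrite mem_enum.
rewrite (permPl (perm_map kap' (perm_to_rem ie))) /= /kap' eqxx perm_cons.
have /eq_in_map -> : {in rem i (enum 'I_n), kap' =1 kap}.
  by move=> j; rewrite rem_filter // mem_filter /= /kap'; case/andP => /negbTE ->.
 exact: perm_refl.
Qed.

Lemma pm_coef_powc mu kap : (pm_coef mu kap)%:R = powc mu kap.
Proof.
have := @fiber_count_powc (size kap) mu (fun i => nth 0%N kap i).
have -> : map (fun i : 'I_(size kap) => nth 0%N kap i) (enum 'I_(size kap)) = kap.
  by rewrite (map_comp (nth 0%N kap) val) val_enum_ord map_nth_iota0 // take_size.
by [].
Qed.

End Coefficients.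

(** * From the given family [J] to monic eigenfunctions *)

Section JackHypothesis.
Variables (R : realFieldType) (alpha : R).
Implicit Types (w v u kap lam gam : seq nat) (phi psi f g : seq nat -> R).

Notation lapb := (laplace_beltrami alpha).
Notation eigv := (eigv alpha).
Notation iprod := (jack_iprod alpha).
Notation weight := (zweight alpha).
Notation mcf := (mono_coef alpha).
Notation jbasis := (jbasis alpha).
Notation orthl := (orthl alpha).
Notation theta := (theta alpha).

Lemma dominated_domi n kap lam : kap \in partitions n -> lam \in partitions n ->
  dominated kap lam -> domi kap lam.
Proof.
move=> kn ln /andP[/eqP e /forallP h]; apply: take_domi => // [|k].
  exact: part_sorted kn.
case: (ltnP k (size kap + size lam).+1) => [lt|ge]; first exact: (h (Ordinal lt)).
by rewrite !take_oversize ?e //; lia.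
Qed.

(* The functional [w |-> <f, p_w>]; words with a letter [0] are sent to [0]. *)
Definition jpair f w : R := if 0%N \in w then 0 else (weight w)^-1 * f (normp w).

Hypothesis alpha_gt0 : 0 < alpha.

Lemma jpair_sym f : symf (jpair f).
Proof.
move=> v v' vv'.
by rewrite /jpair (perm_mem vv') (weight_perm alpha vv') (normp_perm vv').
Qed.

Lemma jpair_zero f v : 0%N \in v -> jpair f v = 0.
Proof. by rewrite /jpair => ->. Qed.

Lemma weight_jpair n f lam : lam \in partitions n -> weight lam * jpair f lam = f lam.
Proof.
move=> ln; have l0 := part_n0 ln; rewrite /jpair (negbTE l0) (normp_id ln).
by rewrite mulVKf // gt_eqF // weight_gt0.
Qed.

Lemma mcf_jpair n f kap : mcf n (jpair f) kap = mcoef n f kap.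
Proof.
rewrite /mono_coef /jack_iprod /mcoef big_seq [RHS]big_seq; apply: eq_bigr => lam ln.
by rewrite mulrA (weight_jpair f ln) pm_coef_powc.
Qed.

Lemma iprod_jpair n f g : iprod n (jpair f) (jpair g) = jscal alpha n f g.
Proof.
rewrite /jack_iprod /jscal big_seq [RHS]big_seq; apply: eq_bigr => lam ln.
rewrite [_ * (_ * _)]mulrA (weight_jpair f ln) /jpair (negbTE (part_n0 ln)) (normp_id ln).
by rewrite /zweight invrK; ring.
Qed.

Lemma hookp_gt0 lam : 0 < hookp alpha lam.
Proof.
apply: prodr_gt0 => r _; apply: prodr_gt0 => c _.
by rewrite ltr_wpDl // addr_ge0 // mulr_ge0 // ltW.
Qed.

Section Jack.
Variables (n : nat) (J : seq nat -> seq nat -> R).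
Hypothesis hJ : is_jack alpha n J.

Let Jh gam := jpair (J gam).

Let Jh_supp gam kap : gam \in partitions n -> mcf n (Jh gam) kap != 0 -> domi kap gam.
Proof.
move=> gn nz; have sk := mcf_sumn nz.
have kn : normp kap \in partitions n by rewrite -sk normp_partition.
apply: domi_trans (domi_normp kap).1 _; apply: (dominated_domi kn gn).
by apply: (hJ.1 gam gn).1 => //; rewrite -mcf_jpair mcf_normp.
Qed.

Let Jh_diag gam : gam \in partitions n -> mcf n (Jh gam) gam = hookp alpha gam.
Proof. by move=> gn; rewrite mcf_jpair (hJ.1 gam gn).2. Qed.

Let Jh_orth : {in partitions n &, forall x y, x != y -> iprod n (Jh x) (Jh y) = 0}.
Proof. by move=> x y xn yn xy; rewrite iprod_jpair hJ.2. Qed.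

Let Jh_self x : x \in partitions n -> iprod n (Jh x) (Jh x) != 0.
Proof.
move=> xn; apply/eqP => /(iprod_self_eq0 alpha_gt0) z.
have := Jh_diag xn; rewrite /mono_coef /jack_iprod big_seq big1 => [e|lam ln].
  by have := hookp_gt0 x; rewrite -e ltxx.
by rewrite z // mul0r mulr0.
Qed.

Let Jh_tri : {in partitions n &, forall x y,
  mcf n (Jh x) y != 0 -> (y == x) || (quad y < quad x)%N}.
Proof.
move=> x y xn yn /(Jh_supp xn) d; case: (eqVneq y x) => //= ne.
exact: domi_part_lt yn xn d ne.
Qed.

Let lapb_Jh gam : gam \in partitions n -> exists c : seq nat -> R,
  {in partitions n, forall x, c x != 0 -> domi x gam} /\
  {in partitions n, forall lam, lapb (Jh gam) lam = \sum_(x <- partitions n) c x * Jh x lam}.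
Proof.
move=> gn.
have dg : {in partitions n, forall x, mcf n (Jh x) x != 0}.
  by move=> x xn; rewrite Jh_diag // gt_eqF // hookp_gt0.
have [c cE] := tri_solve (partitions_uniq n) dg Jh_tri (mcf n (lapb (Jh gam))).
exists c; split.
  apply: (tri_supp (S := fun x => domi x gam) (partitions_uniq n) dg Jh_tri cE) => [y yn|x y xn yn].
    rewrite (mcf_lapb alpha_gt0); last exact: jpair_sym.
    case: (dombP y gam) => // nd; case/eqP.
    have z t : domi y t -> mcf n (Jh gam) t = 0.
      move=> dt; apply/eqP/negP => /negP /(Jh_supp gn) d; case: nd; exact: domi_trans dt d.
    rewrite z // mulr0 add0r; apply: raise_eq0 => [|t _ dt _]; last exact: z.
    exact: part_sorted yn.
  move=> /(Jh_supp xn) d dx; exact: domi_trans d dx.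
apply: (mcf_inj2 alpha_gt0) => kap kn; rewrite (cE _ kn) /mono_coef iprod_suml.
by apply: eq_bigr => x _; rewrite iprodZl.
Qed.

Let Jh_eig gam : gam \in partitions n ->
  {in partitions n, forall lam, lapb (Jh gam) lam = eigv gam * Jh gam lam}.
Proof.
move=> gn.
have ip x c : x \in partitions n -> forall phi,
    {in partitions n, forall lam, phi lam = \sum_(z <- partitions n) c z * Jh z lam} ->
    iprod n phi (Jh x) = c x * iprod n (Jh x) (Jh x).
  move=> xn phi e.
  rewrite (eq_iprod alpha e (psi' := Jh x)) // iprod_suml.
  rewrite (bigD1_seq x) ?partitions_uniq //= iprodZl big_seq_cond big1 ?addr0 //.
  by move=> z /andP[zn zx]; rewrite iprodZl Jh_orth // mulr0.
have [c [cd ce]] := lapb_Jh gn.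
(* Self-adjointness makes [c x] and [c' gam] vanish together; if they did not vanish, [x] and [gam]
   would each lie below the other. *)
have c0 x : x \in partitions n -> x != gam -> c x = 0.
  move=> xn xg; have [c' [cd' ce']] := lapb_Jh xn.
  have e : c x * iprod n (Jh x) (Jh x) = c' gam * iprod n (Jh gam) (Jh gam).
    rewrite -(ip _ _ xn _ ce) -(ip _ _ gn _ ce') [RHS]iprodC.
    by apply: iprod_lapb => //; apply: jpair_sym.
  apply/eqP/negP => /negP cx.
  have c'g : c' gam != 0.
    apply: contra_neq cx => z; apply: (mulIf (Jh_self xn)).
    by rewrite e z !mul0r.
  have := domi_part_lt xn gn (cd _ xn cx) xg.
  by have := domi_quad (cd' _ gn c'g); lia.
have ce1 : {in partitions n, forall lam, lapb (Jh gam) lam = c gam * Jh gam lam}.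
  move=> lam ln; rewrite ce // (bigD1_seq gam) ?partitions_uniq //=.
  by rewrite big_seq_cond big1 ?addr0 // => x /andP[xn xg]; rewrite c0 ?mul0r.
suff -> : eigv gam = c gam by [].
have hg : hookp alpha gam != 0 by rewrite gt_eqF // hookp_gt0.
apply: (mulIf hg); rewrite -Jh_diag //.
have e : mcf n (lapb (Jh gam)) gam = c gam * mcf n (Jh gam) gam.
  by rewrite /mono_coef -iprodZl; apply: eq_iprod.
rewrite -e (mcf_lapb alpha_gt0) ?raise_eq0 ?addr0 //; last exact: jpair_sym.
  exact: part_sorted gn.
move=> t _ _ qt; apply/eqP/negP => /negP /(Jh_supp gn) /domi_quad; lia.
Qed.

Definition jackn gam w : R := (hookp alpha gam)^-1 * Jh gam w.

Lemma jackn_basis : jbasis n jackn.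
Proof.
move=> gam gn.
have hg : hookp alpha gam != 0 by rewrite gt_eqF // hookp_gt0.
split.
- by move=> v v' vv'; rewrite /jackn /Jh (jpair_sym (J gam) vv').
- move=> lam ln.
  have -> : lapb (jackn gam) lam = (hookp alpha gam)^-1 * lapb (Jh gam) lam by apply: lapbZ.
  by rewrite Jh_eig // /jackn; ring.
- by move=> kap; rewrite /mono_coef iprodZl mulf_eq0 negb_or => /andP[_]; apply: Jh_supp.
- by rewrite /mono_coef iprodZl -/(mcf n (Jh gam) gam) Jh_diag // mulVf.
Qed.

Lemma jackn_zero gam v : 0%N \in v -> jackn gam v = 0.
Proof. by move=> v0; rewrite /jackn /Jh jpair_zero // mulr0. Qed.

Lemma jackn_sym gam : symf (jackn gam).
Proof. by move=> v v' vv'; rewrite /jackn /Jh (jpair_sym (J gam) vv'). Qed.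

Lemma is_jack_orthl : orthl n.
Proof.
move=> P Pn x y xn yn xy.
have e z : z \in partitions n -> {in partitions n, P z =1 jackn z}.
  by move=> zn; apply: (jackf_uniq_in alpha_gt0 zn (Pn _ zn)); apply: jackn_basis.
rewrite (eq_iprod alpha (e x xn) (e y yn)) /jackn iprodZl iprodZr Jh_orth //.
by rewrite !mulr0.
Qed.

(** The hook factors of [J g lam] and [J g nu] cancel those of the norm, and [J g [:: n]] is
    [theta g] by [jackf_hook]. The prefactor converts the coefficient at [lam] into a pairing; the
    one at [nu] leaves [weight nu]. *)
Lemma conn_jackn lam nu : (0 < n)%N -> lam \in partitions n -> nu \in partitions n ->
  conn alpha n J lam [:: n] nu = weight nu * \sum_(g <- partitions n)
    jackn g lam * theta g * jackn g nu / iprod n (jackn g) (jackn g).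
Proof.
move=> n0 ln nn.
have on k : (k <= n)%N -> orthl k.
  by move=> kn; exact: (orth_le alpha_gt0 kn is_jack_orthl).
have nP : [:: n] \in partitions n.
  by apply/partP; rewrite /= addn0 inE eq_sym -lt0n n0.
rewrite /conn big_distrr /= mulr_sumr big_seq [RHS]big_seq; apply: eq_bigr => g gn.
have hg : hookp alpha g != 0 by rewrite gt_eqF // hookp_gt0.
have [u [uh _ ev]] := jackf_hook alpha_gt0 on gn (jackn_basis gn).
have Jn : J g [:: n] = theta g.
  have an : alpha * n%:R != 0 by rewrite mulf_neq0 ?gt_eqF // ltr0n.
  have := ev n0; rewrite /jackn => e; rewrite -(weight_jpair (J g) nP).
  have -> : jpair (J g) [:: n] = alpha * n%:R * theta g.
    apply: (mulfI (invr_neq0 hg)); rewrite e.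
    have -> : (hookp alpha g)^-1 = u by rewrite -[LHS]mul1r -uh mulfK.
    ring.
  rewrite /zweight zee_cons /zee /= big_nil expr1 !muln1.
  by field; move: an; rewrite mulf_eq0 negb_or => /andP[-> ->].
rewrite Jn -(weight_jpair (J g) nn) -(weight_jpair (J g) ln).
rewrite /jackn iprodZl iprodZr -iprod_jpair -/(Jh g).
have wl : weight lam != 0 by rewrite gt_eqF // weight_gt0 // (part_n0 ln).
have -> : alpha ^+ size lam * (zee lam)%:R = (weight lam)^-1 by rewrite invrK.
have := Jh_self gn; move: wl hg; set a := weight _; set b := hookp _ _; set d := iprod _ _ _.
by move=> a0 b0 d0; field; rewrite a0 b0 d0.
Qed.

End Jack.
End JackHypothesis.

(** * Partition operations of the recurrence as sums over letters *)

Section PartitionOperations.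
Variables (R : realFieldType) (alpha : R).
Implicit Types (w v u nu lam : seq nat) (phi : seq nat -> R).

Notation weight := (zweight alpha).

Lemma symf_normp phi v : symf phi -> 0%N \notin v -> phi (normp v) = phi v.
Proof. by move=> sp v0; apply/sp/perm_normp. Qed.

Lemma sum_count_mem (m : nat) (H : nat -> R) s : all (fun x => x < m)%N s ->
  \sum_(x <- s) H x = \sum_(0 <= k < m) (count_mem k s)%:R * H k.
Proof.
elim: s => [|x s IH] /=; first by rewrite big_nil big1 // => k _; rewrite mul0r.
case/andP=> xm /IH e; rewrite big_cons e.
under [RHS]eq_bigr => k _ do rewrite natrD mulrDl.
rewrite big_split /=; congr (_ + _).
rewrite (bigD1_seq x) ?iota_uniq ?mem_index_iota //= eqxx mul1r.
by rewrite big1 ?addr0 // => k; rewrite eq_sym => /negbTE ->; rewrite mul0r.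
Qed.

Lemma perm_set_nth lam i y : (i < size lam)%N ->
  perm_eq (set_nth 0%N lam i y) (y :: drop_idx lam i).
Proof.
move=> il; rewrite -[set_nth _ _ _ _](mkseq_nth 0%N) size_set_nth (maxn_idPr il) /mkseq.
have iin : i \in iota 0 (size lam) by rewrite mem_iota.
rewrite (permPl (perm_map _ (perm_to_rem iin))) /= nth_set_nth /= eqxx perm_cons.
rewrite /drop_idx rem_filter ?iota_uniq //.
rewrite (@eq_in_map _ _ _ (nth 0%N lam) _).1 // => j.
by rewrite mem_filter nth_set_nth /= => /andP[/negbTE ->].
Qed.

Lemma perm_drop_idx lam i : (i < size lam)%N ->
  perm_eq lam (nth 0%N lam i :: drop_idx lam i).
Proof.
move=> il; rewrite -(permPr (perm_set_nth _ il)).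
rewrite (_ : set_nth 0%N lam i (nth 0%N lam i) = lam) //.
apply: (@eq_from_nth _ 0%N) => [|j _]; first by rewrite size_set_nth (maxn_idPr il).
by rewrite nth_set_nth /=; case: eqP => [->|].
Qed.

Lemma perm_drop_idx2 lam i j : (j < size lam)%N -> j != i ->
  perm_eq (drop_idx lam i) (nth 0%N lam j ::
    [seq nth 0%N lam k | k <- iota 0 (size lam) & (k != i) && (k != j)]).
Proof.
move=> jl ji; have jin : j \in [seq k <- iota 0 (size lam) | k != i].
  by rewrite mem_filter ji mem_iota.
rewrite /drop_idx (permPl (perm_map _ (perm_to_rem jin))) /= perm_cons.
rewrite rem_filter ?filter_uniq ?iota_uniq // -filter_predI.
by rewrite (@eq_filter _ _ (fun k => (k != i) && (k != j))) // => k; rewrite /= andbC.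
Qed.

Lemma cutjoin_parts phi lam : symf phi -> 0%N \notin lam -> 
  \sum_(i < size lam)
      (nth 0%N lam i)%:R *
      ((alpha - 1) * ((nth 0%N lam i).-1)%:R * phi (part_down lam i)
       + \sum_(1 <= d < (nth 0%N lam i).-1)
            phi (part_split lam i ((nth 0%N lam i).-1 - d) d)
       + alpha * \sum_(j < size lam | j != i)
            (nth 0%N lam j)%:R * phi (part_join lam i j)) = cutjoin alpha phi lam.
Proof.
move=> sp l0; rewrite /cutjoin spick_nth; apply: eq_bigr => i _.
have pos j : (j < size lam)%N -> nth 0%N lam j != 0%N.
  by move=> jl; apply: contraNneq l0 => <-; rewrite mem_nth.
have dr0 (p : pred nat) : 0%N \notin [seq nth 0%N lam k | k <- iota 0 (size lam) & p k].
  apply/mapP => -[k]; rewrite mem_filter mem_iota /= => /andP[_ ks] /eqP.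
  by rewrite eq_sym (negbTE (pos k ks)).
congr (_ * (_ + _ + _ * _)).
(* For a part 1 [part_down] discards the resulting 0 and [cutjoin] keeps it, but the coefficient is
   then 0. *)
- case: (posnP (nth 0%N lam i).-1) => [->|x1]; first by rewrite mulr0 !mul0r.
  congr (_ * _); have pe := perm_set_nth (nth 0%N lam i).-1 (ltn_ord i).
  rewrite /part_down symf_normp ?(sp _ _ pe) // (perm_mem pe) inE negb_or dr0 andbT.
  by rewrite eq_sym -lt0n.
- rewrite big_nat [RHS]big_nat; apply: eq_bigr => d /andP[d0 dx].
  by rewrite /part_split symf_normp // !inE !negb_or dr0 andbT; lia.
rewrite /drop_idx spick_map_uniq ?filter_uniq ?iota_uniq //.
rewrite -(big_mkord (fun j => j != i) (fun j => (nth 0%N lam j)%:R * phi (part_join lam i j))).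
rewrite /index_iota subn0 -big_filter.
apply: eq_big_seq => j; rewrite mem_filter mem_iota /= => /andP[ji jl]; congr (_ * _).
rewrite /part_join (symf_normp sp).
  rewrite rem_filter ?filter_uniq ?iota_uniq // -filter_predI; congr (phi (_ :: map _ _)).
  by apply: eq_filter => k; rewrite /= andbC.
rewrite inE negb_or dr0 andbT.
have := pos i (ltn_ord i); have := pos j jl.
by case: (nth 0%N lam i) => // a; case: (nth 0%N lam j) => // b; rewrite addSn addnS.
Qed.

(** Removing the part [i] from the raised partition or one part [i - 1] from [nu] leaves the same
    word. Applying [weight_cons] to both shows that [i (m_i + 1)] times the weight of the former is
    [(i - 1) m_(i-1)] times the weight of [nu]. *)
Lemma upop_parts n phi nu : symf phi -> nu \in partitions n ->
  \sum_(1 <= i < n.+2 | mult i.-1 nu != 0%N)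
    i%:R * (mult i nu).+1%:R * (weight (part_up nu i.-1) * phi (part_up nu i.-1)) =
  weight nu * upop phi nu.
Proof.
move=> sp nn; have n0 := part_n0 nn.
rewrite /upop spickE => [|x v v' vv']; last by rewrite (sp (x.+1 :: v) (x.+1 :: v')) ?perm_cons.
rewrite (@sum_count_mem n.+1); last first.
  by apply/allP => x xn; have /andP[] := part_le nn xn.
rewrite big_add1 /= mulr_sumr big_mkcond; apply: eq_bigr => k _.
rewrite -/(mult k nu); case: eqP => [->|/eqP kn] /=; first by rewrite mul0r mulr0.
have kin : k \in nu by rewrite -has_pred1 has_count lt0n.
have k0 : (0 < k)%N by have /andP[] := part_le nn kin.
have pk := perm_to_rem kin.
have v0 : 0%N \notin k.+1 :: rem k nu by rewrite inE /=; apply: contra n0 => /mem_rem.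
rewrite /part_up (symf_normp sp v0) (symf_normp (weight_perm alpha) v0) (weight_perm alpha pk).
have := weight_cons alpha (rem k nu) k0.
have := weight_cons alpha (rem k nu) (ltn0Sn k).
have -> : count_mem k.+1 (rem k nu) = mult k.+1 nu by rewrite /mult (permP pk) /= (ltn_eqF (ltnSn k)).
have -> : (count_mem k (rem k nu)).+1 = mult k nu by rewrite /mult (permP pk) /= eqxx.
set a := weight _; set b := weight _; set c := weight _ => e1 e2.
transitivity ((a * (k.+1%:R * (mult k.+1 nu).+1%:R)) * phi (k.+1 :: rem k nu)); first by ring.
by rewrite e1 -e2; ring.
Qed.

End PartitionOperations.

(** * The cut-and-join operator on Jack functions *)

Section CutJoinExpansion.
Variables (R : realFieldType) (alpha : R).
Implicit Types (w v u nu lam : seq nat) (phi psi : seq nat -> R).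

Notation lapb := (laplace_beltrami alpha).
Notation eigv := (eigv alpha).
Notation jackf := (jackf alpha).
Notation jbasis := (jbasis alpha).

Lemma lapb_zero phi w : (forall v, 0%N \in v -> phi v = 0) -> 0%N \in w -> lapb phi w = 0.
Proof.
move=> van w0; rewrite /laplace_beltrami (_ : spick _ _ = 0) ?mulr0 //.
rewrite -[RHS](spick0 R w); apply: eq_spick => -[|x] v pv.
  by rewrite !mul0r !mulr0 mul0r !addr0.
have v0 : 0%N \in v by move: w0; rewrite -(perm_mem pv).
rewrite van ?inE ?v0 ?orbT // mulr0 add0r big1 => [|a _]; last by rewrite van // !inE v0 !orbT.
rewrite mulr0 add0r (_ : spick _ _ = 0) ?mulr0 // -[RHS](spick0 R v).
apply: eq_spick => -[|y] u pu; first by rewrite mul0r.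
by rewrite van ?mulr0 //; move: v0; rewrite -(perm_mem pu) !inE => /orP[//|->]; rewrite orbT.
Qed.

Hypothesis alpha_gt0 : 0 < alpha.

Lemma cutjoin_expand m g psi Q b : jackf m g psi -> jbasis m.+1 Q ->
  (forall v, 0%N \in v -> psi v = 0) ->
  {in partitions m.+1, forall lam,
     alpha * rem1 psi lam = \sum_(x <- partitions m.+1) b x * Q x lam} ->
  {in partitions m.+1, forall lam, alpha * cutjoin alpha psi lam =
     \sum_(x <- partitions m.+1) b x * (eigv x - eigv g) ^+ 2 * Q x lam}.
Proof.
move=> jp jQ van bE lam ln; have [sp _ _ _] := jp.
have lowE : {in partitions m.+1, forall lam, alpha * low psi lam =
     \sum_(x <- partitions m.+1) b x * (eigv x - eigv g) * Q x lam}.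
  by move=> l lm; rewrite -(downop_low _ van) (downop_expand alpha_gt0 jp jQ bE).
have lapE := lapb_expand alpha_gt0 jQ (_ : symf (fun w => alpha * low psi w)) lowE.
have sl : symf (fun w => alpha * low psi w) by move=> v v' vv'; rewrite (low_sym sp vv').
have low_lapb : low (lapb psi) lam = eigv g * low psi lam.
  rewrite /low -spickZ; apply: eq_spick => x v pv.
  case: x pv => [|x] pv; first by rewrite !mul0r mulr0.
  rewrite /= (_ : lapb psi (x :: v) = eigv g * psi (x :: v)); first by ring.
  have [xv0|xv0] := boolP (0%N \in x :: v); first by rewrite lapb_zero // van // mulr0.
  apply: (jackf_word jp xv0).
  by have := perm_sumn pv; rewrite /= (part_sumn ln); lia.
rewrite -low_commute // mulrBr low_lapb -lapbZ (lapE sl) // mulrCA lowE //.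
rewrite mulr_sumr -sumrB; apply: eq_bigr => x _; ring.
Qed.

End CutJoinExpansion.

(** * Exchange of the two commutator expansions *)

Section Recurrence.
Variables (R : realFieldType) (alpha : R).
Hypothesis alpha_gt0 : 0 < alpha.
Variables (n : nat) (P Q : seq nat -> seq nat -> R).
Implicit Types (w v u nu lam : seq nat) (phi psi : seq nat -> R).

Notation theta := (theta alpha).
Notation iprod := (jack_iprod alpha).
Notation orthl := (orthl alpha).
Notation jbasis := (jbasis alpha).

Hypotheses (n_gt0 : (0 < n)%N) (orthn : orthl n.+1) (jP : jbasis n P) (jQ : jbasis n.+1 Q).
Hypothesis vanP : forall x v, 0%N \in v -> P x v = 0.

(* Both sides equal [\sum_x \sum_y theta y * (b / |Q y|^2) * (e_y - e_x) * Q y lam * P x nu]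
   up to [alpha]: adjointness exchanges the coefficients, and the Pieri rule turns the extra
   factor [e_y - e_x] of the cut-and-join side into [theta y / theta x]. *)
Lemma upop_cutjoin lam nu : lam \in partitions n.+1 -> nu \in partitions n ->
  \sum_(y <- partitions n.+1) Q y lam * theta y * upop (Q y) nu / iprod n.+1 (Q y) (Q y) =
  \sum_(x <- partitions n) cutjoin alpha (P x) lam * theta x * P x nu / iprod n (P x) (P x).
Proof.
move=> ln nn.
have orthk k : (k <= n.+1)%N -> orthl k by move=> kn; exact: (orth_le alpha_gt0 kn orthn).
have [c cE] : exists c : seq nat -> seq nat -> R, {in partitions n, forall x,
    {in partitions n.+1, forall l, alpha * rem1 (P x) l =
       \sum_(z <- partitions n.+1) c x z * Q z l}}.
  apply: (fin_choice (fun _ : seq nat => 0 : R) (Q := fun x (h : seq nat -> R) => {in partitions n.+1, forall l,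
    alpha * rem1 (P x) l = \sum_(z <- partitions n.+1) h z * Q z l})) => x _.
  exact: (jbasis_fun_expand alpha_gt0 jQ (fun l => alpha * rem1 (P x) l)).
have [b bE] : exists b : seq nat -> seq nat -> R, {in partitions n.+1, forall y,
    {in partitions n, forall l, add1 (Q y) l = \sum_(z <- partitions n) b y z * P z l}}.
  apply: (fin_choice (fun _ : seq nat => 0 : R) (Q := fun y (h : seq nat -> R) => {in partitions n, forall l,
    add1 (Q y) l = \sum_(z <- partitions n) h z * P z l})) => y _.
  exact: (jbasis_fun_expand alpha_gt0 jP).
apply: (mulfI (lt0r_neq0 alpha_gt0)); rewrite !mulr_sumr.
pose e := eigv alpha.
transitivity (\sum_(y <- partitions n.+1) \sum_(x <- partitions n)
   Q y lam * theta y * (b y x * (e y - e x) * P x nu) / iprod n.+1 (Q y) (Q y)).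
  rewrite big_seq [RHS]big_seq; apply: eq_bigr => y yn.
  rewrite -mulr_suml -mulr_sumr -(add1_expand alpha_gt0 yn (jQ yn) jP (bE y yn)) //; ring.
rewrite exchange_big /= big_seq [RHS]big_seq; apply: eq_bigr => x xn.
transitivity (alpha * cutjoin alpha (P x) lam * (theta x * P x nu / iprod n (P x) (P x))); last by ring.
rewrite (cutjoin_expand alpha_gt0 (jP xn) jQ (@vanP x) (cE x xn)) // mulr_suml.
rewrite big_seq [RHS]big_seq; apply: eq_bigr => y yn.
have adj := add1_coef_neq0 alpha_gt0 (orthk n (leqnSn n)) orthn xn yn jP jQ (bE y yn) (cE x xn).
have Px := jackf_neq0 alpha_gt0 (jP xn); have Qy := jackf_neq0 alpha_gt0 (jQ yn).
(* The Pieri rule speaks only of nonzero coefficients; when [c x y] is zero, adjointness makes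
   [b y x] zero as well. *)
have [c0|c0] := eqVneq (c x y) 0.
  have b0 : b y x = 0 by apply: (mulIf Px); rewrite adj c0 !mul0r.
  by rewrite c0 b0 !(mul0r, mulr0).
have [_ /(_ n_gt0) ->] := pieri alpha_gt0 orthk xn (jP xn) jQ (cE x xn) yn c0.
have -> : b y x = c x y * iprod n.+1 (Q y) (Q y) / iprod n (P x) (P x) by rewrite -adj mulfK.
by rewrite /e; field; rewrite Px Qy.
Qed.

End Recurrence.

Theorem theorem1 (R : realFieldType) (alpha : R) (halpha : 0 < alpha)
    (n : nat) (hn : (0 < n)%N) (nu lam : seq nat)
    (hnu : is_partition n nu) (hlam : is_partition n.+1 lam)
    (J : seq nat -> seq nat -> R)
    (hJn : is_jack alpha n J) (hJn1 : is_jack alpha n.+1 J) :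
  \sum_(1 <= i < n.+2 | mult i.-1 nu != 0%N)
      i%:R * (mult i nu).+1%:R * conn alpha n.+1 J lam [:: n.+1] (part_up nu i.-1)
  =
  \sum_(i < size lam)
      (nth 0%N lam i)%:R *
      ((alpha - 1) * ((nth 0%N lam i).-1)%:R * conn alpha n J (part_down lam i) [:: n] nu
       + \sum_(1 <= d < (nth 0%N lam i).-1)
            conn alpha n J (part_split lam i ((nth 0%N lam i).-1 - d) d) [:: n] nu
       + alpha * \sum_(j < size lam | j != i)
            (nth 0%N lam j)%:R * conn alpha n J (part_join lam i j) [:: n] nu).
Proof.
have nn : nu \in partitions n by rewrite mem_partitions.
have ln : lam \in partitions n.+1 by rewrite mem_partitions.
have l0 := part_n0 ln; have n0 := part_n0 nn.
pose P := jackn alpha J.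
have jP : jbasis alpha n P := jackn_basis halpha hJn.
have jQ : jbasis alpha n.+1 P := jackn_basis halpha hJn1.
have sP x : symf (P x) by apply: jackn_sym.
have vanP x v : 0%N \in v -> P x v = 0 by apply: jackn_zero.
transitivity (zweight alpha nu * \sum_(y <- partitions n.+1)
    P y lam * theta alpha y * upop (P y) nu / jack_iprod alpha n.+1 (P y) (P y)).
  transitivity (\sum_(y <- partitions n.+1) P y lam * theta alpha y / jack_iprod alpha n.+1 (P y) (P y) *
     \sum_(1 <= i < n.+2 | mult i.-1 nu != 0%N) i%:R * (mult i nu).+1%:R *
        (zweight alpha (part_up nu i.-1) * P y (part_up nu i.-1))).
    under [RHS]eq_bigr => y _ do rewrite mulr_sumr.
    rewrite exchange_big /=; apply: eq_bigr => i mi.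
    have un : part_up nu i.-1 \in partitions n.+1.
      have iin : i.-1 \in nu by rewrite -has_pred1 has_count lt0n.
      have -> : n.+1 = sumn (i.-1.+1 :: rem i.-1 nu).
        by have := perm_sumn (perm_to_rem iin); rewrite (part_sumn nn) /= => ->.
      exact: normp_partition.
    rewrite (conn_jackn halpha hJn1) // !mulr_sumr; apply: eq_bigr => y _; rewrite -/P; ring.
  by rewrite mulr_sumr; apply: eq_bigr => y _; rewrite (upop_parts _ _ nn) //; ring.
rewrite (upop_cutjoin halpha hn (is_jack_orthl halpha hJn1) jP jQ vanP ln nn) mulr_sumr.
(* [cf] extends the connection coefficients from partitions to all words, as a combination of the
   [P x], so that [cutjoin] can be applied to them and is linear. *)
pose cf mu := \sum_(x <- partitions n)
  (zweight alpha nu * theta alpha x * P x nu / jack_iprod alpha n (P x) (P x)) * P x mu.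
have scf : symf cf by move=> v v' vv'; apply: eq_bigr => x _; rewrite (sP x _ _ vv').
transitivity (cutjoin alpha cf lam).
  by rewrite cutjoin_sum; apply: eq_bigr => x _; rewrite -?/P; ring.
have connE mu : mu \in partitions n -> conn alpha n J mu [:: n] nu = cf mu.
  move=> mn; rewrite (conn_jackn halpha hJn) // mulr_sumr; apply: eq_bigr => x _; rewrite -?/P; ring.
have normn s : sumn s = n -> normp s \in partitions n by move=> <-; apply: normp_partition.
have sumi i : (i < size lam)%N -> (nth 0%N lam i + sumn (drop_idx lam i) = n.+1)%N.
  by move=> il; have := perm_sumn (perm_drop_idx il); rewrite (part_sumn ln) /= => ->.
have pos i : (i < size lam)%N -> (0 < nth 0%N lam i)%N.
  by move=> il; rewrite lt0n; apply: contraNneq l0 => <-; rewrite mem_nth.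
rewrite -(cutjoin_parts alpha scf l0); apply: eq_bigr => i _.
have si := sumi i (ltn_ord i); have pi := pos i (ltn_ord i).
congr (_ * (_ + _ + _)).
- congr (_ * _); rewrite connE //; apply: normn.
  by rewrite (perm_sumn (perm_set_nth _ (ltn_ord i))) /=; apply/eqP; rewrite -eqSS -addSn prednK // si.
- rewrite big_nat [RHS]big_nat; apply: eq_bigr => d /andP[d0 dx].
  by rewrite connE //; apply: normn => /=; lia.
congr (_ * _); apply: eq_bigr => j ji; rewrite connE //; apply: normn => /=.
move: si; rewrite (perm_sumn (perm_drop_idx2 (ltn_ord j) ji)) /= addnA => si.
by apply/eqP; rewrite -eqSS -addSn prednK ?si // addn_gt0 pi.
Qed.
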